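(* Let $m\in\mathbb N$ and let $\mathcal L=\sum_{|\gamma|=m}a_\gamma\partial^\gamma$ (with $a_\gamma\in\mathbb C$) be an elliptic operator of anisotropic order $m$ on $\mathbb R^d$. Suppose $0<\alpha<\eta<m$ and $\alpha,\eta\notin\mathbb N$. There exists a constant $C$ such that for all $\rho>0$ and all germs $U$ over $\mathbb R^d$ with $[U]_{G^\eta_\rho}<\infty$ it holds $$[U]_{G^\eta_\rho}\le C\big([\mathcal LU]_{G^{\eta-m}_\rho}+[U]_{G^{\eta,\alpha}_\rho}+\rho^{-\eta}\|U\|_{<\rho}\big).$$
   Context: Fix a scaling $\mathfrak s\in\mathbb N^d$; for $\beta\in\mathbb N_0^d$, $|\beta|:=\sum_i\mathfrak s_i\beta_i$; $d(x,y):=\sum_i|x_i-y_i|^{1/\mathfrak s_i}$, $B_R(x)$ the open ball for $d$, $\mathcal P_k$ the polynomials $\sum_{|\beta|\le k}c_\beta z^\beta$. $\mathcal L$ is elliptic if for every open $D\subseteq\mathbb R^d$ and $u\in\mathcal D'(D)$, $\mathcal Lu\in C^\infty(D)$ implies $u\in C^\infty(D)$. A germ over $\mathbb R^d$ is a family $U=(U_x)_{x\in\mathbb R^d}$ of continuous $U_x:\mathbb R^d\to\mathbb C$; $\mathcal LU:=(\mathcal LU_x)_x$ ($\mathcal L$ acting distributionally in the active variable). For $R>0$: $\|U\|_{<R}:=\sup_{x,y:\,d(x,y)<R}|U_x(y)|$; for $\gamma>0$, $[U]_{G^\gamma_R}:=\sup_{x,y:\,0<d(x,y)<R}|U_x(y)|/d(x,y)^\gamma$;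 for $\gamma<0$ and a family $V=(V_x)_x$ of distributions on $\mathbb R^d$, $[V]_{G^\gamma_R}:=\sup_{\varphi\in\mathcal B}\sup_{0<\lambda<R}\sup_{x\in\mathbb R^d}\lambda^{-\gamma}|\langle V_x,\varphi^\lambda_x\rangle|$, where, with $k:=\lceil|\gamma|\rceil$, $\mathcal B$ is the set of $\varphi\in C_c^\infty(\mathbb R^d)$ supported in $B_1(0)$ with $\sup_{|\beta|\le k}\sup|\partial^\beta\varphi|\le1$ and $\varphi_x^\lambda(y):=\lambda^{-\sum_i\mathfrak s_i}\varphi(\lambda^{-\mathfrak s_1}(y_1-x_1),\dots,\lambda^{-\mathfrak s_d}(y_d-x_d))$; for $\gamma>0$ and $\alpha\in(0,\gamma)$, $$[U]_{G^{\gamma,\alpha}_R}:=\sup_{x,y:\,0<d(x,y)<R}\ \inf_{P\in\mathcal P_{\lfloor\gamma\rfloor}}\ \sup_{z:\,0<d(y,z)<R}\frac{|(U_x-U_y-P)(z)|}{d(y,z)^\alpha(d(x,y)+d(y,z))^{\gamma-\alpha}}.$$ *)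

(* Defs.v *)
From HB Require Import structures.
From mathcomp Require Import all_boot all_order all_algebra.
From mathcomp Require Import all_classical all_reals all_analysis.
From mathcomp Require Import complex.
Set Implicit Arguments. Unset Strict Implicit. Unset Printing Implicit Defensive.
Import Order.TTheory GRing.Theory Num.Theory.
Import numFieldNormedType.Exports.
Local Open Scope classical_set_scope.
Local Open Scope ring_scope.

Fixpoint iint {R : realType} (n : nat) : ('rV[R]_n -> R) -> R :=
  match n return ('rV[R]_n -> R) -> R with
  | 0 => fun f => f 0
  | n'.+1 => fun f => Rintegral (@lebesgue_measure R) setT
       (fun t : R => @iint R n' (fun y : 'rV[R]_n' => f (row_mx (const_mx t : 'rV[R]_1) y)))
  end.

Definition cre {R : Type} (z : complex R) : R := let: Complex a _ := z in a.
Definition cim {R : Type} (z : complex R) : R := let: Complex _ b := z in b.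

Section Defs.
Context {R : realType} {d : nat}.
Local Notation pt := 'rV[R]_d.
Local Notation C := R[i].

Definition aweight (s : 'I_d -> nat) (b : 'I_d -> nat) : nat := (\sum_i s i * b i)%N.

Definition sdist (s : 'I_d -> nat) (x y : pt) : R :=
  \sum_i `|x ord0 i - y ord0 i| `^ ((s i)%:R^-1).

Definition cabs (z : C) : R := Normc.normc z.

Definition unit_vec (i : 'I_d) : pt := \row_j (j == i)%:R.
Definition partial (i : 'I_d) (f : pt -> R) : pt -> R := fun x => 'D_(unit_vec i) f x.
Definition iter_partials (l : seq 'I_d) (f : pt -> R) : pt -> R := foldr partial f l.
Definition dpow (b : 'I_d -> nat) (f : pt -> R) : pt -> R :=
  foldr (fun i g => iter (b i) (partial i) g) f (enum 'I_d).

Definition smooth_on (D : set pt) (f : pt -> R) : Prop :=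
  forall l : seq 'I_d,
    (forall x, D x -> {for x, continuous (iter_partials l f)}) /\
    (forall i x, D x -> derivable (iter_partials l f) x (unit_vec i)).

Definition smoothC_on (D : set pt) (f : pt -> C) : Prop :=
  smooth_on D (fun x => cre (f x)) /\ smooth_on D (fun x => cim (f x)).

Definition supp (f : pt -> R) : set pt := closure [set y | f y != 0].

Definition test_fun (D : set pt) (f : pt -> R) : Prop :=
  smooth_on setT f /\ compact (supp f) /\ supp f `<=` D.

(* distributions on D (complex-valued, acting on real test functions,
   which is equivalent to complex test functions by C-linear extension):
   linear, and for every compact K in D there are c, N with
   |T f| <= c * max_{order <= N} sup |partial f| for f supported in K *)
Definition distribution (D : set pt) (T : (pt -> R) -> C) : Prop :=
  [/\ (forall f g, test_fun D f -> test_fun D g -> T (f \+ g) = T f + T g),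
      (forall (c : R) f, test_fun D f -> T (fun x => c * f x) = Complex c 0 * T f) &
      (forall K, compact K -> K `<=` D -> exists (c : R) (N : nat),
         forall f, test_fun D f -> supp f `<=` K -> forall M : R,
           (forall l : seq 'I_d, (size l <= N)%N -> forall x, `|iter_partials l f x| <= M) ->
           cabs (T f) <= c * M)].

Definition pairf (f : pt -> C) (psi : pt -> R) : C :=
  Complex (iint (fun y => cre (f y) * psi y)) (iint (fun y => cim (f y) * psi y)).

(* L = sum_{|g| = m} a_g partial^g acting on a distribution T:
   <L T, phi> = sum_g a_g (-1)^{|g|_1} <T, partial^g phi>.
   Multi-indices of anisotropic weight m have entries <= m (since s_i >= 1),
   so they are represented as elements of {ffun 'I_d -> 'I_m.+1}. *)
Definition Ldist (s : 'I_d -> nat) (m : nat) (a : {ffun 'I_d -> 'I_m.+1} -> C)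
  (T : (pt -> R) -> C) : (pt -> R) -> C :=
  fun phi => \sum_(g : {ffun 'I_d -> 'I_m.+1} | aweight s (fun i => g i) == m)
     a g * (-1) ^+ (\sum_i (g i : nat))%N * T (dpow (fun i => g i) phi).

(* ellipticity (= hypoellipticity as in the paper) *)
Definition elliptic (s : 'I_d -> nat) (m : nat) (a : {ffun 'I_d -> 'I_m.+1} -> C) : Prop :=
  forall D : set pt, open D -> forall T : (pt -> R) -> C, distribution D T ->
    (exists f : pt -> C, smoothC_on D f /\
       forall phi, test_fun D phi -> Ldist s a T phi = pairf f phi) ->
    exists g : pt -> C, smoothC_on D g /\
       forall phi, test_fun D phi -> T phi = pairf g phi.

Definition germ (U : pt -> pt -> C) : Prop :=
  forall x, continuous (fun y => cre (U x y)) /\ continuous (fun y => cim (U x y)).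

Definition supnorm (s : 'I_d -> nat) (U : pt -> pt -> C) (rho : R) : \bar R :=
  ereal_sup [set r | exists x y, sdist s x y < rho /\ r = (cabs (U x y))%:E].

Definition posnorm (s : 'I_d -> nat) (gam : R) (U : pt -> pt -> C) (rho : R) : \bar R :=
  ereal_sup [set r | exists x y, 0 < sdist s x y < rho /\
     r = (cabs (U x y) / sdist s x y `^ gam)%:E].

Definition Bset (s : 'I_d -> nat) (k : nat) (phi : pt -> R) : Prop :=
  [/\ smooth_on setT phi, supp phi `<=` [set y | sdist s 0 y < 1] &
      forall b : 'I_d -> nat, (aweight s b <= k)%N -> forall y, `|dpow b phi y| <= 1].

Definition resc (s : 'I_d -> nat) (phi : pt -> R) (lam : R) (x : pt) : pt -> R :=
  fun y => lam ^- (\sum_i s i)%N * phi (\row_i (lam ^- (s i) * (y ord0 i - x ord0 i))).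

Definition negnorm (s : 'I_d -> nat) (gam : R) (V : pt -> (pt -> R) -> C) (rho : R) : \bar R :=
  ereal_sup [set r | exists phi lam x,
     [/\ Bset s `|Num.ceil `|gam| |%N phi, 0 < lam, lam < rho &
         r = (lam `^ (- gam) * cabs (V x (resc s phi lam x)))%:E]].

(* polynomials of P_k: z |-> sum_{|b| <= k} c_b z^b (entries b_i <= k since s_i >= 1) *)
Definition polyval (s : 'I_d -> nat) (k : nat) (c : {ffun 'I_d -> 'I_k.+1} -> C) (z : pt) : C :=
  \sum_(b : {ffun 'I_d -> 'I_k.+1} | (aweight s (fun i => b i) <= k)%N)
     c b * Complex (\prod_i (z ord0 i) ^+ (b i)) 0.

Definition holnorm_k (s : 'I_d -> nat) (k : nat) (gam alp : R) (U : pt -> pt -> C) (rho : R)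
  : \bar R :=
  ereal_sup [set r | exists x y, 0 < sdist s x y < rho /\
    r = ereal_inf [set q | exists c : {ffun 'I_d -> 'I_k.+1} -> C,
       q = ereal_sup [set t | exists z, 0 < sdist s y z < rho /\
          t = (cabs (U x z - U y z - polyval s c z) /
               (sdist s y z `^ alp * (sdist s x y + sdist s y z) `^ (gam - alp)))%:E]]].

Definition holnorm (s : 'I_d -> nat) (gam alp : R) (U : pt -> pt -> C) (rho : R) : \bar R :=
  holnorm_k s (Num.truncn gam) gam alp U rho.

End Defs.

(* Main.v *)
(** The proof is by blow-up.  If no constant works, rescaling the failing germs
    around almost extremal pairs (x_j, y_j) gives functions V_j with
    |V_j(z)| <= d(0,z)^eta on balls whose radii tend to infinity (because of the
    term rho^(-eta) ||U||), with |V_j(e_j)| >= 1/2 at some e_j with d(0,e_j) = 1,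
    and with L V_j -> 0 weakly.  The seminorm [U]_{G^{eta,alpha}} serves only to
    make the V_j locally equicontinuous, so that they converge locally uniformly
    (along an ultrafilter) to a nonzero entire solution v of L v = 0 with
    |v(z)| <= d(0,z)^eta.

    Such a v vanishes.  By ellipticity every solution is smooth, so the error of
    interpolating it on the scale h along a coordinate axis, with n nodes, is
    O(h^n); the uniform boundedness principle makes this uniform over solutions of
    prescribed growth.  Applied to the rescalings of v this shows, once n > eta,
    that v coincides with its interpolation, so v is polynomial in each variable.
    Then v is a polynomial along every curve (t^{s_i} z_i)_i, where it is bounded
    by a multiple of t^eta; as eta is not an integer, v = 0. *)
Require Import Defs.
From HB Require Import structures.
From mathcomp Require Import all_boot all_order all_algebra.
From mathcomp Require Import all_classical all_reals all_analysis.
From mathcomp Require Import complex.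
From mathcomp Require Import ring lra zify.
Import Order.TTheory GRing.Theory Num.Theory.
Import numFieldNormedType.Exports.
Local Open Scope classical_set_scope.
Local Open Scope ring_scope.

Set Implicit Arguments.
Unset Strict Implicit.
Unset Printing Implicit Defensive.

(** Ellipticity is only the qualitative statement that solutions are smooth, while the Liouville
    step needs bounds uniform over solutions. Interpolation errors divided by h^n replace
    derivatives here: each is a finite combination of point values, hence bounded in a weighted sup
    norm on merely continuous functions, and smoothness of a single solution bounds them in h.
    Rescaling by L costs L^eta and gains at least L^(-n) through the step h = L^(-s_i), whence n >
    eta. In the compactness step the seminorm compares V_j with another member of the germ only up
    to an unknown polynomial. Its coefficients need no control of their own: its degree is bounded
    independently of j, and the growth bounds confine it on a neighbourhood of fixed size. *)

Section IteratedIntegral.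
Context {R : realType}.
Implicit Types (h f g : R -> R) (M c : R).
Local Notation mu := (@lebesgue_measure R).

(** * Integrals on the line of continuous functions with compact support *)

Lemma Rintegral_support h (a b : R) : (forall t, ~~ (a <= t <= b) -> h t = 0) ->
  Rintegral mu setT h = Rintegral mu `[a, b] h.
Proof.
move=> h0; rewrite [RHS]Rintegral_mkcond; apply: eq_Rintegral => t _.
rewrite patchE; case: ifPn => // /negP tab; apply: h0; apply/negP => tI; apply: tab.
by rewrite inE/= in_itv.
Qed.

Lemma csupp_within h M : (forall t, M < `|t| -> h t = 0) ->
  forall t, ~~ (- M <= t <= M) -> h t = 0.
Proof. by move=> h0 t; rewrite -ler_norml -ltNge => /h0. Qed.

Lemma csupp_integrable h M : continuous h -> (forall t, M < `|t| -> h t = 0) ->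
  mu.-integrable setT (EFin \o h).
Proof.
move=> ch h0.
have -> : EFin \o h = (EFin \o h) \_ `[- M, M].
  apply/funext => t; rewrite patchE; case: ifPn => //= /negP tM.
  rewrite (csupp_within h0)//; apply/negP => tI; apply: tM.
  by rewrite inE/= in_itv.
have mI : measurable (`[- M, M] : set R) by exact: measurable_itv.
apply/(integrable_mkcond (mu := mu) (EFin \o h) mI).
apply: continuous_compact_integrable; first exact: segment_compact.
exact: continuous_subspaceT.
Qed.

Lemma csupp_Rintegral_le h M (B : R) : continuous h -> (forall t, M < `|t| -> h t = 0) ->
  0 <= M -> (forall t, `|h t| <= B) -> `|Rintegral mu setT h| <= M *+ 2 * B.
Proof.
move=> ch h0 M0 hB; rewrite (Rintegral_support (csupp_within h0)).
have Mle : - M <= M by move: M0; lra.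
have hi : mu.-integrable `[- M, M] (EFin \o h).
  by apply: continuous_compact_integrable;
    [exact: segment_compact | exact: continuous_subspaceT].
apply: (le_trans (le_normr_Rintegral _ hi)); first exact: measurable_itv.
have -> : M *+ 2 * B = Rintegral mu `[- M, M] (fun=> B).
  rewrite Rintegral_cst//= lebesgue_measure_itv/= lte_fin.
  case: ifPn => [_|]/=; first by rewrite opprK mulr2n mulrC.
  rewrite -leNgt => MM; have -> : M = 0 by lra.
  by rewrite mul0rn mul0r mulr0.
apply: le_Rintegral => //.
- apply: continuous_compact_integrable; first exact: segment_compact.
  by apply: continuous_subspaceT => x; apply: continuous_comp (ch x) (@norm_continuous _ R^o _).
- apply: continuous_compact_integrable; first exact: segment_compact.
  by apply: continuous_subspaceT => x; exact: cvg_cst.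
Qed.

(** Compact support turns the substitution on the whole line into one between [[a, b]] and
    [[- M, M]], with [a] and [b] the preimages of [- M] and [M] under [F]. *)
Lemma csupp_Rintegral_affine h M c p : continuous h ->
  (forall t, M < `|t| -> h t = 0) -> 0 < c ->
  Rintegral mu setT (fun t => h (c * (t - p))) = c^-1 * Rintegral mu setT h.
Proof.
move=> ch h0 c0.
wlog M0 : M h0 / 0 <= M.
  move=> W; apply: (W (Num.max M 0)); last by rewrite le_max lexx orbT.
  by move=> t; rewrite gt_max => /andP[/h0].
pose F t := c * (t - p); pose a := p - M / c; pose b := p + M / c.
have ab : a <= b by rewrite /a /b lerD2l; have := divr_ge0 M0 (ltW c0); lra.
have Fa : F a = - M by rewrite /F /a; field; lra.
have Fb : F b = M by rewrite /F /b; field; lra.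
have dF (t : R) : is_derive t (1 : R) F c.
  have -> : F = c \*: (id - cst p) by [].
  by apply: is_derive_eq; rewrite subr0 -[RHS]mulr1.
have F'E : (derive1 F) = cst c by apply/funext => t; rewrite derive1E derive_val.
have cF : continuous F.
  by move=> t; apply/differentiable_continuous/derivable1_diffP.
rewrite (Rintegral_support (csupp_within h0)).
rewrite (@Rintegral_support (fun t => h (c * (t - p))) a b); last first.
  move=> t tab; apply: h0; rewrite ltNge ler_norml; apply: contra tab.
  rewrite -Fa -Fb /F !ler_pM2l// !lerD2r; exact.
have -> : Rintegral mu `[- M, M] h = Rintegral mu `[a, b] (fun t => c * h (F t)).
  rewrite /Rintegral -Fa -Fb integration_by_substitution_increasing//.
  - congr fine; apply: eq_integral => t _ /=.
    by rewrite F'E /= [X in (X)%:E]/GRing.mul/= mulrC.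
  - by move=> x y _ _ xy; rewrite /F ltr_pM2l// ltrD2r.
  - by rewrite F'E => x _; exact: cvg_cst.
  - by rewrite F'E; apply/cvg_ex; exists c; exact: cvg_cst.
  - by rewrite F'E; apply/cvg_ex; exists c; exact: cvg_cst.
  - split.
    + by move=> x _; have := dF x.
    + exact: cvg_at_right_filter (cF a).
    + exact: cvg_at_left_filter (cF b).
  - exact: continuous_subspaceT.
rewrite RintegralZl.
- by rewrite mulrA mulVf ?mul1r //; lra.
- exact: measurable_itv.
- apply: continuous_compact_integrable; first exact: segment_compact.
  by apply: continuous_subspaceT => x; apply: continuous_comp; [exact: cF|exact: ch].
Qed.

Lemma csupp_Rintegral_gt0 h M t0 : continuous h -> (forall t, M < `|t| -> h t = 0) ->
  (forall t, 0 <= h t) -> 0 < h t0 -> 0 < Rintegral mu setT h.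
Proof.
move=> ch h0 hge ht0.
have hi := csupp_integrable ch h0.
have hh0 : 0 < h t0 / 2 by lra.
have /cvgrPdist_lt/(_ _ hh0)/nbhs_ballP[e /= e0 he] := ch t0.
have lb : forall t, t0 - e / 2 <= t <= t0 + e / 2 -> h t0 / 2 <= h t.
  move=> t /andP[t1 t2]; have /he : ball t0 e t.
    rewrite /ball/= ltr_norml; lra.
  rewrite /= ltr_norml; lra.
pose k : R -> R := fun t => if t0 - e / 2 <= t <= t0 + e / 2 then h t0 / 2 else 0.
have mI : measurable (`[t0 - e / 2, t0 + e / 2] : set R) by exact: measurable_itv.
have kE : EFin \o k = (EFin \o (fun=> h t0 / 2)) \_ `[t0 - e / 2, t0 + e / 2].
  by apply/funext => t; rewrite patchE mem_setE in_itv /= /k; case: ifP.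
have ki : mu.-integrable setT (EFin \o k).
  rewrite kE; apply/(integrable_mkcond (mu := mu) (EFin \o (fun=> h t0 / 2)) mI).
  apply: continuous_compact_integrable; first exact: segment_compact.
  by apply: continuous_subspaceT => x; exact: cvg_cst.
apply: (@lt_le_trans _ _ (Rintegral mu setT k)); last first.
  apply: le_Rintegral => // t _; rewrite /k; case: ifP => // /lb //.
rewrite (@Rintegral_support k (t0 - e / 2) (t0 + e / 2)); last first.
  by move=> t /negbTE tI; rewrite /k tI.
have -> : Rintegral mu `[t0 - e / 2, t0 + e / 2] k
        = Rintegral mu `[t0 - e / 2, t0 + e / 2] (fun=> h t0 / 2).
  by apply: eq_Rintegral => t; rewrite mem_setE in_itv /= /k => ->.
rewrite Rintegral_cst//= lebesgue_measure_itv/= lte_fin ifT; last lra.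
rewrite /=; apply: mulr_gt0; lra.
Qed.


Lemma csupp_Rintegral_lin h g M (a b : R) : continuous h -> continuous g ->
  (forall t, M < `|t| -> h t = 0) -> (forall t, M < `|t| -> g t = 0) ->
  Rintegral mu setT (fun t => a * h t + b * g t) =
  a * Rintegral mu setT h + b * Rintegral mu setT g.
Proof.
move=> ch cg h0 g0; have ih := csupp_integrable ch h0; have ig := csupp_integrable cg g0.
rewrite RintegralD//; last 2 first.
- by have := integrableZl measurableT a ih.
- by have := integrableZl measurableT b ig.
by rewrite !RintegralZl.
Qed.

(** * Uniformly continuous functions supported in a cube, and the iterated integral *)

Lemma rV_ballP n (x y : 'rV[R]_n) e : 0 < e ->
  ball x e y <-> forall i, `|x ord0 i - y ord0 i| < e.
Proof.
move=> e0; split=> [[_ xy] i|xy]; first exact: xy.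
by split=> // j i; rewrite ord1; exact: xy.
Qed.

Lemma rV_continuous_atP n (f : 'rV[R]_n -> R) (x : 'rV[R]_n) : {for x, continuous f} <->
  forall e : R, 0 < e -> exists2 r : R, 0 < r &
    forall y : 'rV[R]_n, (forall i, `|x ord0 i - y ord0 i| < r) -> `|f x - f y| < e.
Proof.
split=> [cf e e0|cf].
  have /cvgrPdist_lt/(_ e e0)/nbhs_ballP[r /= r0 H] := cf.
  by exists r => // y /(rV_ballP _ _ r0)/H.
suff : f y @[y --> x] --> f x by [].
move=> A /nbhs_ballP[e /= e0 eA]; have [r r0 H] := cf e e0.
by apply/nbhs_ballP; exists r => //= y /(rV_ballP _ _ r0)/H fxy; apply: eA.
Qed.

Definition box n M (x : 'rV[R]_n) := forall i, `|x ord0 i| <= M.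

Lemma compact_box n M : compact (box M : set 'rV[R]_n).
Proof.
have := @rV_compact R n (fun=> `[- M, M]%classic) (fun=> @segment_compact R _ _).
congr compact; apply/seteqP; split=> x /= bx i; have := bx i;
  by rewrite in_itv/= ler_norml.
Qed.

Lemma box_le n M M' (x : 'rV[R]_n) : M <= M' -> box M x -> box M' x.
Proof. by move=> MM bx i; exact: le_trans (bx i) MM. Qed.

(* Uniform continuity together with support in a cube: this class is inherited by
   slices and by integration in one variable. *)
Definition ucc n M (f : 'rV[R]_n -> R) :=
  (forall x, ~ box M x -> f x = 0) /\
  (forall e : R, 0 < e -> exists2 r : R, 0 < r & forall x y : 'rV[R]_n,
     (forall i, `|x ord0 i - y ord0 i| < r) -> `|f x - f y| < e).

(** Heine-Cantor on the cube of half-side [M + 1]. The margin covers the other points: if [x] is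
    outside the larger cube and [y] is within 1 of it, both values vanish. *)
Lemma continuous_ucc n M (f : 'rV[R]_n -> R) : continuous f ->
  (forall x, ~ box M x -> f x = 0) -> ucc M f.
Proof.
move=> cf f0; split=> // e e0.
have /compact_near_coveringP ncK := @compact_box n (M + 1).
have := ncK R (0^'+) (fun (r : R) (x : 'rV[R]_n) => forall y : 'rV[R]_n,
  (forall i, `|x ord0 i - y ord0 i| < r) -> `|f x - f y| < e) _.
move=> /(_ _)[].
  move=> x _; have e2 : 0 < e / 2 by lra.
  have [r r0 H] := (rV_continuous_atP f x).1 (cf x) _ e2.
  have r2 : 0 < r / 2 by lra.
  exists (ball x (r / 2), [set t | t < r / 2]); first split => /=.
  - exact: nbhsx_ballx.
  - exact: nbhs_right_lt.
  - move=> [x' t] /= [/(rV_ballP _ _ r2) xx' tr] y x'y.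
    have h1 : `|f x - f x'| < e / 2.
      by apply: H => i; apply: lt_trans (xx' i) _; lra.
    have h2 : `|f x - f y| < e / 2.
      apply: H => i; have := xx' i; have := x'y i; rewrite !ltr_norml; lra.
    move: h1 h2; rewrite !ltr_norml; lra.
move=> r /= r0 H.
pose t := Num.min (r / 2) 1.
have t0 : 0 < t by rewrite lt_min; apply/andP; split; lra.
have tr : t < r by rewrite gt_min; apply/orP; left; lra.
have t1 : t <= 1 by rewrite ge_min lexx orbT.
exists t => // x y xy.
have [bx|bx] := pselect (box (M + 1) x).
  apply: (H t) => //=; first by rewrite /ball/= sub0r normrN gtr0_norm.
rewrite (f0 x) ?(f0 y) ?subrr ?normr0//.
  move=> by_; apply: bx => i; have := by_ i; have := xy i.
  rewrite ltr_norml !ler_norml; lra.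
by move=> b; apply: bx; apply: box_le b; lra.
Qed.

Definition consr n (t : R) (y : 'rV[R]_n) : 'rV[R]_n.+1 := row_mx (const_mx t : 'rV_1) y.

Lemma consrE n t (y : 'rV[R]_n) i :
  consr t y ord0 i = if unlift ord0 i is Some j then y ord0 j else t.
Proof.
case: unliftP => [j ->|->].
  have -> : lift ord0 j = rshift 1 j by exact: val_inj.
  by rewrite /consr (@row_mxEr _ 1 1 n).
have -> : ord0 = lshift n ord0 :> 'I_(1 + n) by exact: val_inj.
by rewrite /consr (@row_mxEl _ 1 1 n) mxE.
Qed.

Definition tailr n (x : 'rV[R]_n.+1) : 'rV[R]_n := \row_i x ord0 (lift ord0 i).

Lemma consr_eta n (x : 'rV[R]_n.+1) : x = consr (x ord0 ord0) (tailr x).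
Proof. by apply/rowP => i; rewrite consrE; case: unliftP => [j|] ->; rewrite ?mxE. Qed.

Lemma iintS n (f : 'rV[R]_n.+1 -> R) :
  iint f = Rintegral mu setT (fun t => iint (fun y => f (consr t y))).
Proof. by []. Qed.

Lemma ucc_slice n M (f : 'rV[R]_n.+1 -> R) t : ucc M f -> ucc M (fun y => f (consr t y)).
Proof.
move=> [f0 uf]; split=> [y yM|e e0].
  apply: f0 => byt; apply: yM => i; have := byt (lift ord0 i).
  by rewrite consrE liftK.
have [r r0 H] := uf e e0; exists r => // x y xy; apply: H => i.
by rewrite !consrE; case: unliftP => // _; rewrite subrr normr0.
Qed.

Lemma ucc_slice0 n M (f : 'rV[R]_n.+1 -> R) t y : ucc M f -> M < `|t| -> f (consr t y) = 0.
Proof.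
move=> [f0 _] Mt; apply: f0 => /(_ ord0).
by rewrite consrE unlift_none leNgt Mt.
Qed.

Lemma ucc_lin n M (f g : 'rV[R]_n -> R) a b : ucc M f -> ucc M g ->
  ucc M (fun x => a * f x + b * g x).
Proof.
move=> [f0 uf] [g0 ug]; split=> [x xM|e e0]; first by rewrite f0// g0// !mulr0 addr0.
pose k := `|a| + `|b| + 1.
have k0 : 0 < k by have := normr_ge0 a; have := normr_ge0 b; rewrite /k; lra.
have ek : 0 < e / k by rewrite divr_gt0.
have [r r0 H] := uf _ ek; have [r' r'0 H'] := ug _ ek.
exists (Num.min r r'); first by rewrite lt_min r0.
move=> x y xy.
have h1 : `|f x - f y| < e / k by apply: H => i; have := xy i; rewrite lt_min => /andP[].
have h2 : `|g x - g y| < e / k by apply: H' => i; have := xy i; rewrite lt_min => /andP[].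
have -> : a * f x + b * g x - (a * f y + b * g y) = a * (f x - f y) + b * (g x - g y) by ring.
apply: le_lt_trans (ler_normD _ _) _; rewrite !normrM.
have -> : e = `|a| * (e / k) + `|b| * (e / k) + e / k by rewrite /k; field; exact: lt0r_neq0.
have := ler_wpM2l (normr_ge0 a) (ltW h1); have := ler_wpM2l (normr_ge0 b) (ltW h2); lra.
Qed.

Lemma iint0 n : iint (fun _ : 'rV[R]_n => 0) = 0.
Proof.
elim: n => //= n IH; under eq_Rintegral do rewrite IH.
by rewrite Rintegral_cst ?mul0r//; exact: measurableT.
Qed.

Lemma iint_slice_supp n M (f : 'rV[R]_n.+1 -> R) t : ucc M f -> M < `|t| ->
  iint (fun y => f (consr t y)) = 0.
Proof.
move=> uf Mt; rewrite -[RHS](iint0 n); congr iint.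
by apply/funext => y; exact: ucc_slice0 uf Mt.
Qed.

(** Predicates of [n], since bound and linearity are proved in one induction: together, in dimension
    [n], they make slice integrals continuous, which both need in dimension [n.+1]. *)
Definition iint_bound_stmt n := forall (M B : R) (f : 'rV[R]_n -> R), 0 <= M ->
  ucc M f -> (forall x, `|f x| <= B) -> `|iint f| <= (M *+ 2) ^+ n * B.

Definition iint_lin_stmt n := forall (M a b : R) (f g : 'rV[R]_n -> R), 0 <= M ->
  ucc M f -> ucc M g -> iint (fun x => a * f x + b * g x) = a * iint f + b * iint g.

Lemma iint_slice_continuous_aux n M (f : 'rV[R]_n.+1 -> R) :
  iint_bound_stmt n -> iint_lin_stmt n -> 0 <= M -> ucc M f ->
  continuous (fun t => iint (fun y => f (consr t y))).
Proof.
move=> IHb IHl M0 uf t; apply/cvgrPdist_le => e e0.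
pose k := (M *+ 2) ^+ n + 1.
have k1 : 0 <= (M *+ 2) ^+ n by rewrite exprn_ge0 ?mulrn_wge0.
have k0 : 0 < k by rewrite /k; lra.
have [r r0 H] := uf.2 _ (divr_gt0 e0 k0).
apply/nbhs_ballP; exists r => //= t' tt'.
have := IHl M 1 (-1) _ _ M0 (ucc_slice t uf) (ucc_slice t' uf).
rewrite mul1r mulN1r => <-.
apply: (@le_trans _ _ ((M *+ 2) ^+ n * (e / k))).
  apply: IHb => //; first exact: ucc_lin (ucc_slice t uf) (ucc_slice t' uf).
  move=> x; rewrite mul1r mulN1r; apply/ltW/H => i.
  by rewrite !consrE; case: unliftP => [j _|_]; rewrite ?subrr ?normr0.
rewrite mulrCA -[leRHS]mulr1 ler_pM2l// ler_pdivrMr// /k; lra.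
Qed.

Lemma iint_bound_lin n : iint_bound_stmt n /\ iint_lin_stmt n.
Proof.
elim: n => [|n [IHb IHl]].
  by split=> [M B f _ _ fB|//]; rewrite expr0 mul1r; exact: fB.
split=> [M B f M0 uf fB|M a b f g M0 uf ug].
  rewrite iintS exprS -mulrA; apply: csupp_Rintegral_le => //.
  - exact: iint_slice_continuous_aux IHb IHl M0 uf.
  - by move=> t; exact: iint_slice_supp uf.
  - by move=> t; apply: IHb => //; exact: ucc_slice.
rewrite !iintS -(@csupp_Rintegral_lin _ _ M).
- apply: eq_Rintegral => t _; apply: (IHl M) => //; exact: ucc_slice.
- exact: iint_slice_continuous_aux IHb IHl M0 uf.
- exact: iint_slice_continuous_aux IHb IHl M0 ug.
- by move=> t; exact: iint_slice_supp uf.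
- by move=> t; exact: iint_slice_supp ug.
Qed.

Lemma iint_bound n : iint_bound_stmt n.
Proof. exact: (iint_bound_lin n).1. Qed.

Lemma iint_lin n : iint_lin_stmt n.
Proof. exact: (iint_bound_lin n).2. Qed.

Lemma iint_slice_continuous n M (f : 'rV[R]_n.+1 -> R) : 0 <= M -> ucc M f ->
  continuous (fun t => iint (fun y => f (consr t y))).
Proof. exact: iint_slice_continuous_aux (@iint_bound n) (@iint_lin n). Qed.

Definition aff n (c : 'I_n -> R) (p x : 'rV[R]_n) : 'rV[R]_n :=
  \row_i (c i * (x ord0 i - p ord0 i)).

Lemma aff_consr n (c : 'I_n.+1 -> R) p t y :
  aff c p (consr t y) =
  consr (c ord0 * (t - p ord0 ord0)) (aff (fun i => c (lift ord0 i)) (tailr p) y).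
Proof.
apply/rowP => i; rewrite mxE !consrE.
by case: unliftP => [j ->|->]; rewrite ?mxE.
Qed.

Lemma iint_aff n M (c : 'I_n -> R) p (f : 'rV[R]_n -> R) : 0 <= M -> ucc M f ->
  (forall i, 0 < c i) ->
  iint (fun x => f (aff c p x)) = (\prod_i (c i)^-1) * iint f.
Proof.
elim: n c p f => [|n IH] c p f M0 uf c0.
  by rewrite big_ord0 mul1r /=; congr f; apply/rowP => -[].
pose c' i := c (lift ord0 i); pose K := \prod_i (c' i)^-1.
pose G t := iint (fun y => f (consr t y)).
have cG : continuous G by exact: iint_slice_continuous M0 uf.
have sG t : M < `|t| -> G t = 0 by exact: iint_slice_supp uf.
rewrite iintS big_ord_recl -/K.
have -> : (fun t => iint (fun y => f (aff c p (consr t y)))) =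
          (fun t => K * G (c ord0 * (t - p ord0 ord0)) + 0 * 0).
  apply/funext => t; rewrite mul0r addr0 /G -(IH c' (tailr p)) //.
    by congr iint; apply/funext => y; rewrite aff_consr.
  - exact: ucc_slice.
  - by move=> i; exact: c0.
rewrite mulrAC mulrC -(csupp_Rintegral_affine (p ord0 ord0) cG sG (c0 ord0)).
have aG : continuous (fun t => G (c ord0 * (t - p ord0 ord0))).
  move=> t; apply: continuous_comp; last exact: cG.
  by apply: cvgMr; apply: cvgB; [exact: cvg_id|exact: cvg_cst].
rewrite (@csupp_Rintegral_lin _ (fun=> 0) (M / c ord0 + `|p ord0 ord0|) K 0 aG).
- by rewrite mul0r addr0 mulrC.
- by move=> t; exact: cvg_cst.
- move=> t tM; apply: sG; rewrite normrM gtr0_norm// mulrC -ltr_pdivrMr//.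
  by have := ler_normD (t - p ord0 ord0) (p ord0 ord0); rewrite subrK; lra.
- by [].
Qed.

Lemma iint_ge0 n (f : 'rV[R]_n -> R) : (forall x, 0 <= f x) -> 0 <= iint f.
Proof.
elim: n f => [|n IH] f f0 /=; first exact: f0.
by apply: Rintegral_ge0 => t _; apply: IH => y; exact: f0.
Qed.

Lemma iint_gt0 n M (f : 'rV[R]_n -> R) x : 0 <= M -> ucc M f ->
  (forall x, 0 <= f x) -> 0 < f x -> 0 < iint f.
Proof.
elim: n f x => [|n IH] f x M0 uf f0 fx.
  by move: fx => /=; congr (_ < f _); apply/rowP => -[].
rewrite iintS; apply: (@csupp_Rintegral_gt0 _ M (x ord0 ord0)).
- exact: iint_slice_continuous M0 uf.
- by move=> t; exact: iint_slice_supp uf.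
- by move=> t; apply: iint_ge0 => y; exact: f0.
- apply: (IH _ (tailr x)) => //; first exact: ucc_slice.
  by rewrite -consr_eta.
Qed.

End IteratedIntegral.

(** * Functions of class C^k and their behaviour under diagonal affine maps *)

Section SmoothFunctions.
Context {R : realType}.

Section Ck.
Context {d : nat}.
Implicit Types f g : 'rV[R]_d -> R.

(** Carrying the partial derivatives along lets closure under sums, products and affine maps go by
    induction on [n]; [Ck_smooth] returns to the lists of [smooth_on]. *)
Fixpoint Ck (n : nat) f : Prop :=
  continuous f /\
  match n with
  | 0 => True
  | n'.+1 => forall i, exists g : 'rV[R]_d -> R,
      (forall x, is_derive x (unit_vec i) f (g x)) /\ Ck n' g
  end.

Lemma Ck_continuous n f : Ck n f -> continuous f.
Proof. by case: n => [|n] []. Qed.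

Lemma Ck_lower n f : Ck n.+1 f -> Ck n f.
Proof.
elim: n f => [|n IH] f [cf H]; split=> // i.
by have [g [dg Cg]] := H i; exists g; split=> //; exact: IH.
Qed.

Lemma Ck_partial n f i : Ck n.+1 f ->
  (forall x, is_derive x (unit_vec i) f (partial i f x)) /\ Ck n (partial i f).
Proof.
move=> [cf /(_ i)[g [dg Cg]]].
have -> : partial i f = g by apply/funext => x; rewrite /partial derive_val.
by [].
Qed.

Lemma iter_partials_Ck l f : (forall n, Ck n f) -> forall n, Ck n (iter_partials l f).
Proof.
move=> Cf; elim: l => //= i l IH n.
by have [] := Ck_partial i (IH n.+1).
Qed.

Lemma Ck_smooth f : (forall n, Ck n f) <-> smooth_on setT f.
Proof.
split=> [Cf l|].
  have Cl := iter_partials_Ck l Cf; split=> [x _|i x _].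
    exact: Ck_continuous (Cl 0%N) x.
  by have [dd _] := Ck_partial i (Cl 1%N); exact: ex_derive.
move=> sf n; elim: n f sf => [|n IH] f sf.
  by split=> // x; have [/(_ x I)] := sf [::].
split=> [x|i]; first by have [/(_ x I)] := sf [::].
exists (partial i f); split=> [x|].
  by apply: derivableP; have [_] := sf [::]; apply.
apply: IH => l; have := sf (rcons l i).
by rewrite /iter_partials foldr_rcons.
Qed.

Lemma Ck_cst n (a : R) : Ck n (fun=> a).
Proof.
have ca (b : R) : continuous (fun _ : 'rV[R]_d => b) by exact: cst_continuous.
elim: n a => [|n IH] a; split=> // i.
by exists (fun=> 0); split=> // x; exact: is_derive_cst.
Qed.

Lemma Ck_add n f g : Ck n f -> Ck n g -> Ck n (fun x => f x + g x).
Proof.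
elim: n f g => [|n IH] f g Cf Cg;
  have cf : continuous f := Ck_continuous Cf; have cg : continuous g := Ck_continuous Cg.
  by split=> // x; apply: continuousD; [exact: cf|exact: cg].
split=> [x|i]; first by apply: continuousD; [exact: cf|exact: cg].
have [df Cdf] := Ck_partial i Cf; have [dg Cdg] := Ck_partial i Cg.
exists (fun x => partial i f x + partial i g x); split=> [x|]; last exact: IH.
exact: is_deriveD.
Qed.

Lemma Ck_mul n f g : Ck n f -> Ck n g -> Ck n (fun x => f x * g x).
Proof.
elim: n f g => [|n IH] f g Cf Cg;
  have cf : continuous f := Ck_continuous Cf; have cg : continuous g := Ck_continuous Cg.
  by split=> // x; apply: continuousM; [exact: cf|exact: cg].
split=> [x|i]; first by apply: continuousM; [exact: cf|exact: cg].
have [df Cdf] := Ck_partial i Cf; have [dg Cdg] := Ck_partial i Cg.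
exists (fun x => f x * partial i g x + g x * partial i f x); split=> [x|].
  exact: is_deriveM.
by apply: Ck_add; apply: IH => //; exact: Ck_lower.
Qed.

Lemma Ck_prod n (I : Type) (r : seq I) (F : I -> 'rV[R]_d -> R) :
  (forall i, Ck n (F i)) -> Ck n (fun x => \prod_(i <- r) F i x).
Proof.
move=> CF; elim: r => [|i r IH].
  have -> : (fun x => \prod_(i <- [::]) F i x) = (fun=> 1).
    by apply/funext => x; rewrite big_nil.
  exact: Ck_cst.
have -> : (fun x => \prod_(j <- i :: r) F j x) = (fun x => F i x * \prod_(j <- r) F j x).
  by apply/funext => x; rewrite big_cons.
exact: Ck_mul.
Qed.

(** Both sides are limits of the same difference quotient; the chain rule is thereby needed only for
    functions of one real variable. *)
Lemma is_derive_lineP f (x v : 'rV[R]_d) D :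
  is_derive x v f D <-> is_derive (0 : R) (1 : R) (fun h : R => f (h *: v + x)) D.
Proof.
have E : 'D_v f x = 'D_1 (fun h : R => f (h *: v + x)) 0.
  rewrite /derive; set g1 := fun h => h^-1 *: _; set g2 := fun h => h^-1 *: _.
  suff -> : g1 = g2 by []; apply/funext => h; rewrite /g1 /g2 /=.
  by rewrite addr0 scale0r add0r [_%:A]mulr1.
split=> -[df dv]; apply: DeriveDef; rewrite -?E//.
- exact: (derivable1P f x v).1 df.
- exact: (derivable1P f x v).2 df.
- by rewrite E.
Qed.

Lemma aff_line (c : 'I_d -> R) p x i h :
  aff c p (h *: unit_vec i + x) = (c i * h) *: unit_vec i + aff c p x.
Proof.
apply/rowP => j; rewrite !mxE; case: eqP => [->|_]; rewrite ?mulr1 ?mulr0; ring.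
Qed.

Lemma is_derive_aff (c : 'I_d -> R) p f x i D :
  is_derive (aff c p x) (unit_vec i) f D ->
  is_derive x (unit_vec i) (fun y => f (aff c p y)) (c i * D).
Proof.
move=> /is_derive_lineP H; apply/is_derive_lineP.
have -> : (fun h : R => f (aff c p (h *: unit_vec i + x))) =
          (fun h : R => f (h *: unit_vec i + aff c p x)) \o (fun h : R => c i * h).
  by apply/funext => h /=; rewrite aff_line.
have dm : is_derive (0 : R) (1 : R) (fun h : R => c i * h) (c i).
  have -> : (fun h : R => c i * h) = c i \*: id by [].
  by apply: is_derive_eq; rewrite -[RHS]mulr1.
have H' : is_derive (c i * 0) (1 : R) (fun h : R => f (h *: unit_vec i + aff c p x)) D.
  by rewrite mulr0.
by apply: is_derive_eq; rewrite mulrC.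
Qed.

Lemma aff_continuous (c : 'I_d -> R) p : continuous (aff c p).
Proof.
move=> x A /nbhs_ballP[e /= e0 eA].
pose k := \sum_i `|c i| + 1.
have k0 : 0 < k by rewrite /k ltr_wpDl// sumr_ge0.
have ek : 0 < e / k by rewrite divr_gt0.
apply/nbhs_ballP; exists (e / k) => //= y /(rV_ballP _ _ ek) xy.
apply: eA; apply/(rV_ballP _ _ e0) => i; rewrite !mxE -mulrBr opprB addrA subrK normrM.
have ck : `|c i| < k.
  rewrite /k (bigD1 i)//= -addrA ltrDl ltr_wpDl// sumr_ge0//.
apply: (@le_lt_trans _ _ (k * `|x ord0 i - y ord0 i|)); first by rewrite ler_wpM2r// ltW.
by rewrite mulrC -ltr_pdivlMr.
Qed.

Lemma Ck_aff n (c : 'I_d -> R) p f : Ck n f -> Ck n (fun x => f (aff c p x)).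
Proof.
elim: n f => [|n IH] f Cf; have cf : continuous (fun x => f (aff c p x)) by
  move=> x; apply: continuous_comp; [exact: aff_continuous|exact: (Ck_continuous Cf)].
  by split.
split=> // i; have [df Cdf] := Ck_partial i Cf.
exists (fun x => c i * partial i f (aff c p x)); split=> [x|].
  exact: is_derive_aff.
by apply: Ck_mul; [exact: Ck_cst|exact: IH].
Qed.

Lemma iter_partials_scale_aff (a : R) (c : 'I_d -> R) p f l : (forall n, Ck n f) ->
  iter_partials l (fun x => a * f (aff c p x)) =
  (fun x => a * (\prod_(i <- l) c i) * iter_partials l f (aff c p x)).
Proof.
move=> Cf; elim: l => [|i l IH] /=; first by rewrite big_nil mulr1.
rewrite IH; apply/funext => x; rewrite {1}/partial.
have [df _] := Ck_partial i (iter_partials_Ck l Cf 1%N).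
have dd := is_derive_aff (df (aff c p x)).
have -> : (fun x => a * (\prod_(j <- l) c j) * iter_partials l f (aff c p x)) =
   (a * \prod_(j <- l) c j) \*: (fun x => iter_partials l f (aff c p x)) by [].
rewrite derive_val big_cons [LHS]mulrA; congr (_ * _); ring.
Qed.

Definition dseq (b : 'I_d -> nat) : seq 'I_d := flatten [seq nseq (b i) i | i <- enum 'I_d].

Lemma dpowE b f : dpow b f = iter_partials (dseq b) f.
Proof.
rewrite /dpow /dseq /iter_partials; elim: (enum 'I_d) => //= i l IH.
by rewrite foldr_cat -IH; elim: (b i) => //= n ->.
Qed.

Lemma prod_dseq b (c : 'I_d -> R) : \prod_(i <- dseq b) c i = \prod_i c i ^+ b i.
Proof.
rewrite /dseq big_flatten big_map big_enum /=.
by apply: eq_bigr => i _; rewrite big_nseq; elim: (b i) => //= n ->; rewrite exprS.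
Qed.

End Ck.

(** * Bump functions *)

(** The functions t^(-n) exp(-1/t), extended by 0. The whole family appears because differentiation
    stays inside it: the derivative of member [n] is a combination of members [n.+1] and [n.+2]. *)
Definition expinv (n : nat) (t : R) : R := if 0 < t then t^-1 ^+ n * expR (- t^-1) else 0.

Lemma expinv_ge0 n t : 0 <= expinv n t.
Proof.
rewrite /expinv; case: ifP => // t0; apply: mulr_ge0; last exact: expR_ge0.
by rewrite exprn_ge0// invr_ge0 ltW.
Qed.

Lemma expinv_gt0 n t : 0 < t -> 0 < expinv n t.
Proof. by move=> t0; rewrite /expinv t0 mulr_gt0 ?expR_gt0// exprn_gt0// invr_gt0. Qed.

Lemma expinv_le0 n t : t <= 0 -> expinv n t = 0.
Proof. by move=> t0; rewrite /expinv ltNge t0. Qed.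

(** From exp y >= y^(n+2) / (n+2)! at y = 1/t. A quadratic bound makes the difference quotient at
    the origin O(h), which settles the only delicate point of differentiability. *)
Lemma expinv_le_sqr n t : expinv n t <= n.+2`!%:R * t ^+ 2.
Proof.
rewrite /expinv; case: ifP => [t0|_]; last by rewrite mulr_ge0 ?sqr_ge0.
have y0 : 0 <= t^-1 by rewrite invr_ge0 ltW.
have := expR_ge1Dxn n.+1 y0; rewrite expRN.
set y := t^-1 => H; have E0 := expR_gt0 y.
have F0 : (0 : R) < n.+2`!%:R by rewrite ltr0n fact_gt0.
rewrite ler_pdivrMr//.
have -> : t ^+ 2 = y ^- 2 by rewrite /y exprVn invrK.
have yy : 0 < y by rewrite /y invr_gt0.
rewrite mulrAC ler_pdivlMr ?exprn_gt0// -exprD addn2 -ler_pdivrMl// mulrC.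
by apply: le_trans H; rewrite lerDr.
Qed.

Lemma is_derive_expinv n t :
  is_derive t (1 : R) (expinv n) (- n%:R * expinv n.+1 t + expinv n.+2 t).
Proof.
have [t0|t0|<-] := ltgtP 0 t.
- have tn0 : t != 0 by rewrite gt_eqF.
  pose g (u : R) := u^-1 ^+ n * expR (- u^-1).
  apply: (@near_eq_is_derive _ _ _ g).
    near=> u; rewrite /expinv ifT//; near: u; exact: lt_nbhsr.
  have -> : g = ((fun u : R => u^-1) ^+ n) * (expR \o (fun u => - u^-1)).
    have iX m : (fun u : R => u^-1) ^+ m = (fun u : R => u^-1 ^+ m).
      by elim: m => [|m IH]; apply/funext => u; rewrite ?expr0// exprS IH exprS.
    by rewrite iX.
  have d1 : is_derive t (1 : R) (fun u : R => u^-1) (- t ^- 2).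
    have := @is_deriveV _ id t 1 1 tn0 (is_derive_id _ _).
    by rewrite /= [X in is_derive _ _ _ X]mulr1.
  have d2 : is_derive t (1 : R) (fun u : R => - u^-1) (t ^- 2).
    by apply: is_derive_eq; rewrite opprK.
  apply: is_derive_eq.
  rewrite /expinv t0 /= fctE /=.
  set E := expR _; case: n {g} => [|n] /=.
    by rewrite /GRing.scale /= expr0 mulr0n; field.
  rewrite /GRing.scale /= !exprS; move: (t^-1 ^+ n) n.+1%:R => z N.
  by rewrite expr0 !mulr1; field.
- apply: (@near_eq_is_derive _ _ _ (cst 0)).
    near=> u; rewrite /expinv ifF//; apply/negbTE; rewrite -leNgt ltW//.
    by near: u; exact: lt_nbhsl.
  apply: is_derive_eq.
  by rewrite !expinv_le0 ?mulr0 ?addr0// ltW.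
- rewrite !expinv_le0// mulr0 addr0.
  suff H : h^-1 *: (expinv n (h *: 1 + 0) - expinv n 0) @[h --> 0^'] --> (0 : R).
    apply: DeriveDef; first by apply/cvg_ex; exists 0.
    by apply/cvg_lim.
  apply/cvgrPdist_le => e e0; set C : R := n.+2`!%:R.
  have C0 : 0 < C by rewrite ltr0n fact_gt0.
  apply/nbhs_ballP; exists (e / C) => /=; first by rewrite divr_gt0.
  move=> h; rewrite /ball /= sub0r normrN => hC hn0.
  rewrite sub0r normrN addr0 (expinv_le0 n (lexx 0)) subr0 [_%:A]mulr1.
  rewrite /GRing.scale /= normrM (ger0_norm (expinv_ge0 _ _)) normfV.
  rewrite ler_pdivrMl ?normr_gt0//.
  apply: le_trans (expinv_le_sqr _ _) _; rewrite -real_normK ?num_real//.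
  rewrite -/C expr2 mulrCA; apply: ler_wpM2l => //.
  by rewrite mulrC -ler_pdivlMr// ltW.
Unshelve. all: by end_near. Qed.

Lemma expinv_continuous n : continuous (expinv n).
Proof.
move=> t; apply/differentiable_continuous/derivable1_diffP.
by have := is_derive_expinv n t.
Qed.

Lemma Ck_expinv d k n (i : 'I_d) (c q : R) :
  Ck k (fun x : 'rV[R]_d => expinv n (c * x ord0 i + q)).
Proof.
have cont m : continuous (fun x : 'rV[R]_d => expinv m (c * x ord0 i + q)).
  move=> x; apply: (@continuous_comp _ _ _ (fun x : 'rV[R]_d => c * x ord0 i + q)
    (expinv m)); last exact: expinv_continuous.
  have cc : {for x, continuous (fun x : 'rV[R]_d => c * x ord0 i)}.
    by apply: continuousM; [exact: cst_continuous|exact: coord_continuous].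
  by apply: continuousD; [exact: cc|exact: cst_continuous].
elim: k n => [|k IH] n; split=> // j.
pose e := (j == i)%:R : R.
exists (fun x => e * c * (- n%:R * expinv n.+1 (c * x ord0 i + q) +
   expinv n.+2 (c * x ord0 i + q))).
split=> [x|]; last first.
  apply: Ck_mul; first exact: Ck_cst.
  apply: Ck_add; last exact: IH.
  by apply: Ck_mul; [exact: Ck_cst|exact: IH].
apply/is_derive_lineP.
have -> : (fun h : R => expinv n (c * (h *: unit_vec j + x) ord0 i + q)) =
   expinv n \o (fun h : R => (c * e) * h + (c * x ord0 i + q)).
  apply/funext => h /=; congr expinv; rewrite !mxE /e eq_sym; ring.
have dm : is_derive (0 : R) (1 : R) (fun h : R => (c * e) * h + (c * x ord0 i + q)) (c * e).
  have -> : (fun h : R => (c * e) * h + (c * x ord0 i + q)) =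
    ((c * e) \*: id) + cst (c * x ord0 i + q) by [].
  by apply: is_derive_eq; rewrite addr0 -[RHS]mulr1.
have de := is_derive_expinv n ((c * e) * 0 + (c * x ord0 i + q)).
apply: is_derive_eq.
by rewrite mulr0 add0r mulrC [c * e]mulrC.
Qed.

(** The two factors cut off at p_i - r and at p_i + r. The coefficients 1 and -1 are kept visible so
    that each factor has the form treated in [Ck_expinv]. *)
Definition bump d (p : 'rV[R]_d) (r : R) (x : 'rV[R]_d) : R :=
  \prod_i (expinv 0 (1 * x ord0 i + (r - p ord0 i)) * expinv 0 (-1 * x ord0 i + (r + p ord0 i))).

Lemma Ck_bump d (p : 'rV[R]_d) r n : Ck n (bump p r).
Proof. by apply: Ck_prod => i; apply: Ck_mul; exact: Ck_expinv. Qed.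

Lemma bump_ge0 d (p : 'rV[R]_d) r x : 0 <= bump p r x.
Proof. by apply: prodr_ge0 => i _; apply: mulr_ge0; exact: expinv_ge0. Qed.

Lemma bump_gt0 d (p : 'rV[R]_d) r : 0 < r -> 0 < bump p r p.
Proof. by move=> r0; apply: prodr_gt0 => i _; apply: mulr_gt0; apply: expinv_gt0; lra. Qed.

Lemma bump_supp d (p : 'rV[R]_d) r x : bump p r x != 0 ->
  forall i, `|p ord0 i - x ord0 i| < r.
Proof.
move=> bx i; rewrite ltNge; apply: contra bx => H.
rewrite /bump (bigD1 i)//= mulf_eq0; apply/orP; left; rewrite mulf_eq0.
have [h|h] : r <= p ord0 i - x ord0 i \/ r <= x ord0 i - p ord0 i.
  by case: (leP 0 (p ord0 i - x ord0 i)) H => s; [rewrite ger0_norm// | rewrite ltr0_norm//]; lra.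
- by rewrite expinv_le0 ?eqxx//; lra.
- by rewrite [X in _ || (X == 0)]expinv_le0 ?eqxx ?orbT//; lra.
Qed.

End SmoothFunctions.

(** * Real and imaginary parts, and the modulus *)

Section ComplexNumbers.
Context {R : realType}.
Implicit Types z w : R[i].

Lemma cplx_ext z w : cre z = cre w -> cim z = cim w -> z = w.
Proof. by case: z => ? ?; case: w => ? ? /= -> ->. Qed.

Lemma creD z w : cre (z + w) = cre z + cre w. Proof. by case: z => ? ?; case: w. Qed.
Lemma cimD z w : cim (z + w) = cim z + cim w. Proof. by case: z => ? ?; case: w. Qed.
Lemma creN z : cre (- z) = - cre z. Proof. by case: z. Qed.
Lemma cimN z : cim (- z) = - cim z. Proof. by case: z. Qed.
Lemma creM z w : cre (z * w) = cre z * cre w - cim z * cim w.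
Proof. by case: z => ? ?; case: w. Qed.
Lemma cimM z w : cim (z * w) = cre z * cim w + cim z * cre w.
Proof. by case: z => ? ?; case: w. Qed.
Lemma creZ (c : R) w : cre (Complex c 0 * w) = c * cre w.
Proof. by rewrite creM /= mul0r subr0. Qed.
Lemma cimZ (c : R) w : cim (Complex c 0 * w) = c * cim w.
Proof. by rewrite cimM /= mul0r addr0. Qed.

Lemma cabsE z : (cabs z)%:C%C = `|z|.
Proof. by case: z => a b; rewrite normc_def. Qed.

Lemma cabsD z w : cabs (z + w) <= cabs z + cabs w.
Proof. by have := ler_normD z w; rewrite -!cabsE -rmorphD/= lecR. Qed.

Lemma cabsM z w : cabs (z * w) = cabs z * cabs w.
Proof. exact: Normc.normcM. Qed.

Lemma cabsN z : cabs (- z) = cabs z.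
Proof. by case: z => a b; rewrite /cabs /= !sqrrN. Qed.

Lemma cabsB z w : cabs (z - w) <= cabs z + cabs w.
Proof. by rewrite -(cabsN w); exact: cabsD. Qed.

Lemma cabs0 : cabs (0 : R[i]) = 0. Proof. exact: Normc.normc0. Qed.

Lemma cabs_ge0 z : 0 <= cabs z.
Proof. by case: z => a b; exact: sqrtr_ge0. Qed.

Lemma cabs_real (c : R) : cabs (Complex c 0) = `|c|.
Proof. by rewrite /cabs /= expr0n addr0 sqrtr_sqr. Qed.

Lemma cabsZ (c : R) w : 0 <= c -> cabs (Complex c 0 * w) = c * cabs w.
Proof. by move=> c0; rewrite cabsM cabs_real ger0_norm. Qed.

Lemma cre_le z : `|cre z| <= cabs z.
Proof. by case: z => a b; rewrite /cabs /= -sqrtr_sqr ler_wsqrtr// lerDl sqr_ge0. Qed.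

Lemma cim_le z : `|cim z| <= cabs z.
Proof. by case: z => a b; rewrite /cabs /= -sqrtr_sqr ler_wsqrtr// lerDr sqr_ge0. Qed.

Lemma cabs_le z : cabs z <= `|cre z| + `|cim z|.
Proof.
case: z => a b; rewrite /cabs /=.
have h : 0 <= `|a| + `|b| by rewrite addr_ge0.
rewrite -[leRHS](ger0_norm h) -sqrtr_sqr; apply: ler_wsqrtr.
rewrite sqrrD !real_normK ?num_real// mulr2n.
by have := mulr_ge0 (normr_ge0 a) (normr_ge0 b); lra.
Qed.

Lemma cabs_sum (I : Type) (r : seq I) (P : pred I) (F : I -> R[i]) :
  cabs (\sum_(i <- r | P i) F i) <= \sum_(i <- r | P i) cabs (F i).
Proof.
elim/big_ind2: _ => // [|x1 x2 y1 y2 h1 h2]; first by rewrite cabs0.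
by apply: le_trans (cabsD _ _) _; exact: lerD.
Qed.

End ComplexNumbers.

(** * Continuous functions as distributions *)

Section Pairing.
Context {R : realType} {d : nat}.
Local Notation pt := 'rV[R]_d.
Implicit Types (v u : pt -> R[i]) (f g phi psi : pt -> R) (M : R).

Definition contC v := continuous (fun y => cre (v y)) /\ continuous (fun y => cim (v y)).

Lemma contC_comp (h : pt -> pt) v : continuous h -> contC v -> contC (fun x => v (h x)).
Proof.
move=> ch [c1 c2]; split=> z.
  by have := continuous_comp (ch z) (c1 (h z)); exact.
by have := continuous_comp (ch z) (c2 (h z)); exact.
Qed.

Definition off_box M f := forall x, ~ box M x -> f x = 0.

(** An explicit cube stands in for the compact support, because the constants in the bounds for
    pairings depend on [M]. *)
Definition test_box M phi := (forall n, Ck n phi) /\ off_box M phi.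

Lemma rV_contM f g : continuous f -> continuous g -> continuous (fun x => f x * g x).
Proof. by move=> cf cg x; apply: continuousM; [exact: cf|exact: cg]. Qed.

Lemma rV_contD f g : continuous f -> continuous g -> continuous (fun x => f x + g x).
Proof. by move=> cf cg x; apply: continuousD; [exact: cf|exact: cg]. Qed.

Lemma rV_cont_comp f (h : pt -> pt) : continuous h -> continuous f -> continuous (fun x => f (h x)).
Proof. by move=> ch cf x; apply: continuous_comp; [exact: ch|exact: cf]. Qed.

Lemma box_closed M : closed (box M : set pt).
Proof. by apply: compact_closed; [exact: norm_hausdorff|exact: compact_box]. Qed.

Lemma off_box_partial M f i : off_box M f -> off_box M (partial i f).
Proof.
move=> f0 x xM; rewrite /partial.
have nx : nbhs x (~` box M).
  by apply: open_nbhs_nbhs; split=> //; exact/closed_openC/box_closed.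
rewrite (@near_eq_derive _ _ _ f (cst 0)); first exact: derive_cst.
by apply: filterS nx => y; exact: f0.
Qed.

Lemma test_box_iter M phi l : test_box M phi -> test_box M (iter_partials l phi).
Proof.
move=> [Cp p0]; split; first exact: iter_partials_Ck.
by elim: l => //= i l; exact: off_box_partial.
Qed.

Lemma test_box_dpow M phi b : test_box M phi -> test_box M (dpow b phi).
Proof. by rewrite dpowE; exact: test_box_iter. Qed.

Lemma rV_coord_le_norm (x : pt) i : `|x ord0 i| <= `|x|.
Proof. by rewrite [leRHS]/Num.norm /= mx_normrE; apply/bigmax_geP; right; exists (ord0, i). Qed.

Lemma test_funP phi : test_fun setT phi -> exists2 M, 0 <= M & test_box M phi.
Proof.
move=> [sm [cs _]].
have [M [_ HM]] := compact_bounded cs.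
exists (Num.max (M + 1) 0); first by rewrite le_max lexx orbT.
split; first exact/Ck_smooth.
move=> x xM; apply/eqP/negPn/negP => px; apply: xM => i.
have xs : supp phi x by apply: subset_closure.
have := HM (M + 1) _ x xs; rewrite ltrDl ltr01 => /(_ isT) xM.
rewrite le_max; apply/orP; left; apply: le_trans xM.
exact: rV_coord_le_norm.
Qed.

Lemma test_box_supp M f : off_box M f -> supp f `<=` box M.
Proof.
move=> f0; rewrite /supp closureE => x; apply; split; first exact: box_closed.
by move=> y /= fy; apply: contrapT => /f0 fy0; rewrite fy0 eqxx in fy.
Qed.

Lemma test_box_test M phi : test_box M phi -> test_fun setT phi.
Proof.
move=> [Cp p0]; split; first exact/Ck_smooth.
split=> //; apply: (subclosed_compact _ (@compact_box R d M)); last exact: test_box_supp.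
exact: closed_closure.
Qed.

Lemma pair_ucc M f psi : continuous f -> continuous psi -> off_box M psi ->
  ucc M (fun y => f y * psi y).
Proof.
move=> cf cp p0; apply: continuous_ucc; first exact: rV_contM.
by move=> x /p0 ->; rewrite mulr0.
Qed.

Lemma box0 M : 0 <= M -> box M (0 : pt).
Proof. by move=> M0 i; rewrite mxE normr0. Qed.

Lemma continuous_box_bounded M f : continuous f -> exists2 B, 0 <= B &
  forall x, box M x -> `|f x| <= B.
Proof.
move=> cf; have cb : compact [set f x | x in box M].
  by apply: continuous_compact (@compact_box R d M); exact: continuous_subspaceT.
have [B [_ HB]] := compact_bounded cb.
exists (Num.max (B + 1) 0); first by rewrite le_max lexx orbT.
move=> x bx; rewrite le_max; apply/orP; left.
by apply: (HB (B + 1)); [rewrite ltrDl|exists x].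
Qed.

Lemma off_box_bounded M f : continuous f -> off_box M f -> exists2 B, 0 <= B &
  forall x, `|f x| <= B.
Proof.
move=> cf f0; have [B B0 HB] := continuous_box_bounded M cf.
exists B => // x; have [|/f0 ->] := pselect (box M x); first exact: HB.
by rewrite normr0.
Qed.

Lemma pairf_linl M u v (c : R) psi : 0 <= M -> contC u -> contC v -> continuous psi ->
  off_box M psi ->
  pairf (fun y => u y + Complex c 0 * v y) psi = pairf u psi + Complex c 0 * pairf v psi.
Proof.
move=> M0 [cu1 cu2] [cv1 cv2] cp p0.
apply: cplx_ext; rewrite ?creD ?cimD ?creZ ?cimZ /=.
- rewrite -[X in X + _]mul1r -(iint_lin _ _ M0 (pair_ucc cu1 cp p0) (pair_ucc cv1 cp p0)).
  by congr iint; apply/funext => y; rewrite creD creZ; ring.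
- rewrite -[X in X + _]mul1r -(iint_lin _ _ M0 (pair_ucc cu2 cp p0) (pair_ucc cv2 cp p0)).
  by congr iint; apply/funext => y; rewrite cimD cimZ; ring.
Qed.

Lemma pairf_linr M v (a b : R) phi psi : 0 <= M -> contC v -> continuous phi ->
  continuous psi -> off_box M phi -> off_box M psi ->
  pairf v (fun y => a * phi y + b * psi y) =
  Complex a 0 * pairf v phi + Complex b 0 * pairf v psi.
Proof.
move=> M0 [cv1 cv2] cp cq p0 q0.
apply: cplx_ext; rewrite ?creD ?cimD ?creZ ?cimZ /=.
- rewrite -(iint_lin _ _ M0 (pair_ucc cv1 cp p0) (pair_ucc cv1 cq q0)).
  by congr iint; apply/funext => y; ring.
- rewrite -(iint_lin _ _ M0 (pair_ucc cv2 cp p0) (pair_ucc cv2 cq q0)).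
  by congr iint; apply/funext => y; ring.
Qed.

Lemma pairfZr M v (a : R) phi : 0 <= M -> contC v -> continuous phi -> off_box M phi ->
  pairf v (fun y => a * phi y) = Complex a 0 * pairf v phi.
Proof.
move=> M0 cv cp p0; have := pairf_linr a 0 M0 cv cp cp p0 p0.
rewrite (_ : Complex 0 0 = 0)// mul0r addr0 => <-.
by congr pairf; apply/funext => y; rewrite mul0r addr0.
Qed.

Lemma pairf_bound M v psi (e B : R) : 0 <= M -> contC v -> continuous psi ->
  off_box M psi -> (forall y, box M y -> cabs (v y) <= e) -> (forall y, `|psi y| <= B) ->
  cabs (pairf v psi) <= ((M *+ 2) ^+ d * B) *+ 2 * e.
Proof.
move=> M0 [cv1 cv2] cp p0 ve pB.
have e0 : 0 <= e by apply: le_trans (ve _ (box0 M0)); exact: cabs_ge0.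
have B0 : 0 <= B by apply: le_trans (pB 0); exact: normr_ge0.
have bnd (w : pt -> R) : (forall y, `|w y| <= cabs (v y)) ->
    forall y, `|w y * psi y| <= B * e.
  move=> wv y; have [by_|/p0 ->] := pselect (box M y); last first.
    by rewrite mulr0 normr0 mulr_ge0.
  rewrite normrM mulrC; apply: ler_pM => //.
  by apply: le_trans (wv y) _; exact: ve.
apply: le_trans (cabs_le _) _; rewrite mulr2n mulrDl -mulrA /=.
apply: lerD; apply: iint_bound => //.
- exact: pair_ucc.
- by apply: bnd => y; exact: cre_le.
- exact: pair_ucc.
- by apply: bnd => y; exact: cim_le.
Qed.

Lemma contC_bounded M v : contC v -> exists2 B, 0 <= B & forall y, box M y -> cabs (v y) <= B.
Proof.
move=> [c1 c2]; have [B1 B10 H1] := continuous_box_bounded M c1.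
have [B2 B20 H2] := continuous_box_bounded M c2.
exists (B1 + B2); first exact: addr_ge0.
by move=> y bY; apply: le_trans (cabs_le _) _; apply: lerD; [exact: H1|exact: H2].
Qed.

(** Order 0 suffices: [N] is 0, and the constant combines a bound for v on a cube containing [K]
    with the volume of that cube. *)
Lemma pairf_distribution v : contC v -> Defs.distribution setT (pairf v).
Proof.
move=> cv; split.
- move=> f g /test_funP[M M0 [Cf f0]] /test_funP[M' M'0 [Cg g0]].
  have MM : 0 <= Num.max M M' by rewrite le_max M0.
  have f0' : off_box (Num.max M M') f.
    by move=> x xM; apply: f0 => b; apply: xM; apply: box_le b; rewrite le_max lexx.
  have g0' : off_box (Num.max M M') g.
    by move=> x xM; apply: g0 => b; apply: xM; apply: box_le b; rewrite le_max lexx orbT.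
  have := pairf_linr 1 1 MM cv (Ck_continuous (Cf 0%N)) (Ck_continuous (Cg 0%N)) f0' g0'.
  rewrite (_ : Complex 1 0 = 1)// !mul1r => <-.
  by congr pairf; apply/funext => y; rewrite !mul1r.
- move=> c f /test_funP[M M0 [Cf f0]].
  exact: pairfZr M0 cv (Ck_continuous (Cf 0%N)) f0.
- move=> K cK _; have [M0 [_ HM]] := compact_bounded cK.
  pose M := Num.max (M0 + 1) 0.
  have MM : 0 <= M by rewrite le_max lexx orbT.
  have [B B0 HB] := contC_bounded M cv.
  exists (((M *+ 2) ^+ d) *+ 2 * B), 0%N => f tf fK N HN.
  have [M1 _ [Cf _]] := test_funP tf.
  have f0 : off_box M f.
    move=> x xM; apply/eqP/negPn/negP => px; apply: xM => i.
    have xs : K x by apply: fK; apply: subset_closure.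
    have := HM (M0 + 1) _ x xs; rewrite ltrDl ltr01 => /(_ isT) xM.
    rewrite le_max; apply/orP; left; apply: le_trans xM.
    exact: rV_coord_le_norm.
  have := pairf_bound MM cv (Ck_continuous (Cf 0%N)) f0 HB (HN [::] isT).
  by congr (_ <= _); rewrite -!mulrnAl; ring.
Qed.

(** If [f x > 0], a bump supported where [f] stays positive has a positive pairing. The one-sided
    conclusion is enough, being applied to a difference and to its opposite. *)
Lemma fundamental_lemma f : continuous f ->
  (forall M phi, 0 <= M -> test_box M phi -> iint (fun y => f y * phi y) = 0) ->
  forall x, f x <= 0.
Proof.
move=> cf H x; rewrite leNgt; apply/negP => fx.
have [r r0 Hr] := (rV_continuous_atP f x).1 (cf x) _ fx.
pose M := \sum_i `|x ord0 i| + r.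
have M0 : 0 <= M by rewrite addr_ge0 ?sumr_ge0// ltW.
have b0 : off_box M (bump x r).
  move=> y yM; apply/eqP/negPn/negP => by_; apply: yM => i.
  have /(_ i) := bump_supp by_.
  have : `|x ord0 i| <= \sum_j `|x ord0 j| by rewrite (bigD1 i)//= lerDl sumr_ge0.
  rewrite /M; have := ler_normB (x ord0 i) (x ord0 i - y ord0 i).
  rewrite opprB addrCA subrr addr0; lra.
have tb : test_box M (bump x r) by split=> // n; exact: Ck_bump.
have := H _ _ M0 tb; apply/eqP; rewrite gt_eqF//.
apply: (@iint_gt0 _ _ M _ x) => //.
- by apply: pair_ucc => //; exact: Ck_continuous (Ck_bump x r 0%N).
- move=> y; have [->|by_] := eqVneq (bump x r y) 0; first by rewrite mulr0.
  apply: mulr_ge0; last exact: bump_ge0.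
  have := Hr y (bump_supp by_); rewrite ltr_norml; lra.
- by apply: mulr_gt0 => //; exact: bump_gt0.
Qed.

Lemma pairf_inj v u : contC v -> contC u ->
  (forall M phi, 0 <= M -> test_box M phi -> pairf v phi = pairf u phi) -> v = u.
Proof.
move=> [cv1 cv2] [cu1 cu2] H.
have key (f g : pt -> R) : continuous f -> continuous g ->
    (forall M phi, 0 <= M -> test_box M phi ->
       iint (fun y => f y * phi y) = iint (fun y => g y * phi y)) -> forall x, f x <= g x.
  move=> cf cg fg x; rewrite -subr_le0; move: x.
  apply: (@fundamental_lemma (fun x => f x - g x)).
    move=> x; apply: continuousB; [exact: cf|exact: cg].
  move=> M phi M0 [Cp p0]; have cp := Ck_continuous (Cp 0%N).
  have := iint_lin 1 (-1) M0 (pair_ucc cf cp p0) (pair_ucc cg cp p0).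
  rewrite (fg M phi M0 (conj Cp p0)) mul1r mulN1r subrr => <-.
  by congr iint; apply/funext => y; ring.
apply/funext => x; apply: cplx_ext; apply/eqP; rewrite eq_le; apply/andP; split.
- by apply: (key _ _ cv1 cu1) => M phi M0 t; have /(congr1 cre) := H _ _ M0 t.
- by apply: (key _ _ cu1 cv1) => M phi M0 t; have /(congr1 cre) := H _ _ M0 t.
- by apply: (key _ _ cv2 cu2) => M phi M0 t; have /(congr1 cim) := H _ _ M0 t.
- by apply: (key _ _ cu2 cv2) => M phi M0 t; have /(congr1 cim) := H _ _ M0 t.
Qed.

End Pairing.

(** * The operator on continuous functions, and its homogeneity under anisotropic dilations *)

Section Operator.
Context {R : realType} {d : nat} (s : 'I_d -> nat) (m : nat)
  (a : {ffun 'I_d -> 'I_m.+1} -> R[i]).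
Local Notation pt := 'rV[R]_d.
Implicit Types (v u : pt -> R[i]) (phi psi : pt -> R) (M : R).

Lemma Ldist_lin M u v (c : R) phi : 0 <= M -> contC u -> contC v -> test_box M phi ->
  Ldist s a (pairf (fun y => u y + Complex c 0 * v y)) phi =
  Ldist s a (pairf u) phi + Complex c 0 * Ldist s a (pairf v) phi.
Proof.
move=> M0 cu cv tp; rewrite /Ldist mulr_sumr -big_split /=; apply: eq_bigr => g _.
have [Cp p0] := test_box_dpow (fun i => g i) tp.
rewrite (pairf_linl c M0 cu cv (Ck_continuous (Cp 0%N)) p0); ring.
Qed.

(** All derivatives fall on [phi], so only the size of [v] on a cube enters. This is the continuity
    that carries the equation through locally uniform limits. *)
Lemma Ldist_bound M phi : 0 <= M -> test_box M phi -> exists2 B, 0 <= B &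
  forall v (e : R), contC v -> (forall y, box M y -> cabs (v y) <= e) ->
    cabs (Ldist s a (pairf v) phi) <= B * e.
Proof.
move=> M0 tp.
have /choice[B HB] : forall g : {ffun 'I_d -> 'I_m.+1}, exists B, 0 <= B /\
    forall y, `|dpow (fun i => g i) phi y| <= B.
  move=> g; have [Cp p0] := test_box_dpow (fun i => g i) tp.
  by have [B ? ?] := off_box_bounded (Ck_continuous (Cp 0%N)) p0; exists B.
pose k g : R := cabs (a g * (-1) ^+ (\sum_i (g i : nat))%N) * (((M *+ 2) ^+ d * B g) *+ 2).
have k0 g : 0 <= k g.
  apply: mulr_ge0; first exact: cabs_ge0.
  by rewrite mulrn_wge0// mulr_ge0 ?(HB g).1// exprn_ge0// mulrn_wge0.
exists (\sum_(g : {ffun 'I_d -> 'I_m.+1} | aweight s (fun i => g i) == m) k g).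
  by apply: sumr_ge0.
move=> v e cv ve; rewrite /Ldist mulr_suml; apply: le_trans (cabs_sum _ _ _) _.
apply: ler_sum => g _; rewrite cabsM /k -mulrA.
apply: ler_wpM2l; first exact: cabs_ge0.
have [Cp p0] := test_box_dpow (fun i => g i) tp.
exact: pairf_bound M0 cv (Ck_continuous (Cp 0%N)) p0 ve (HB g).2.
Qed.

Definition solution v := forall M phi, 0 <= M -> test_box M phi ->
  Ldist s a (pairf v) phi = 0.

(** Ellipticity produces a smooth [g] defining the same distribution as [v]; both being continuous,
    they agree pointwise by [pairf_inj]. *)
Lemma elliptic_smooth v : elliptic s a -> contC v -> solution v -> smoothC_on setT v.
Proof.
move=> ell cv sv.
have s0 : smoothC_on setT (fun _ : pt => 0 : R[i]).
  by split; apply/Ck_smooth => n; exact: Ck_cst.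
have [|g [sg Hg]] := ell setT openT (pairf v) (pairf_distribution cv).
  exists (fun=> 0); split=> // phi /test_funP[M M0 tp]; rewrite (sv _ _ M0 tp).
  have E : (fun y : pt => 0 * phi y) = (fun=> 0) by apply/funext => y; rewrite mul0r.
  by apply: cplx_ext; rewrite /= E iint0.
suff -> : v = g by [].
have cg : contC g.
  by case: sg => s1 s2; split; [have /Ck_smooth/(_ 0%N) := s1|have /Ck_smooth/(_ 0%N) := s2];
     exact: Ck_continuous.
by apply: pairf_inj => // M phi M0 /test_box_test/Hg.
Qed.

Definition dil (lam : R) (x z : pt) : pt := \row_i (x ord0 i + lam ^+ s i * z ord0 i).

Lemma dilE lam x z : 0 < lam ->
  dil lam x z = aff (fun i => lam ^+ s i) (\row_i (- (lam ^- s i * x ord0 i))) z.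
Proof.
move=> l0; apply/rowP => i; rewrite !mxE opprK mulrDr mulrA divff ?mul1r 1?addrC//.
by rewrite expf_neq0// gt_eqF.
Qed.

Lemma dil_continuous lam x : 0 < lam -> continuous (dil lam x).
Proof.
move=> l0; have -> : dil lam x = aff (fun i => lam ^+ s i) (\row_i (- (lam ^- s i * x ord0 i))).
  by apply/funext => z; exact: dilE.
exact: aff_continuous.
Qed.

Lemma dil_aff lam x y : 0 < lam -> dil lam x (aff (fun i => lam ^- s i) x y) = y.
Proof.
move=> l0; apply/rowP => i; rewrite !mxE mulrA divff ?mul1r 1?addrC ?subrK//.
by rewrite expf_neq0// gt_eqF.
Qed.

Lemma contC_dil lam x v : 0 < lam -> contC v -> contC (fun z => v (dil lam x z)).
Proof.
by move=> l0; apply: contC_comp; exact: dil_continuous.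
Qed.

Lemma rescE psi lam x : resc s psi lam x =
  (fun y => lam ^- (\sum_i s i)%N * psi (aff (fun i => lam ^- s i) x y)).
Proof. by []. Qed.

Lemma off_box_aff M (c : 'I_d -> R) p phi : 0 <= M -> (forall i, 0 < c i) ->
  off_box M phi -> exists2 M', 0 <= M' & off_box M' (fun y => phi (aff c p y)).
Proof.
move=> M0 c0 p0; pose k i := M / c i + `|p ord0 i|.
have k0 i : 0 <= k i by rewrite addr_ge0// divr_ge0// ltW.
exists (\sum_i k i); first exact: sumr_ge0.
move=> y yM; apply: p0 => b; apply: yM => i; apply: (@le_trans _ _ (k i)); last first.
  by rewrite (bigD1 i)//= lerDl sumr_ge0.
have := b i; rewrite mxE normrM gtr0_norm// mulrC -ler_pdivlMr// /k.
by have := ler_normD (y ord0 i - p ord0 i) (p ord0 i); rewrite subrK; lra.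
Qed.

Lemma test_box_resc M psi lam x : 0 <= M -> 0 < lam -> test_box M psi ->
  exists2 M', 0 <= M' & test_box M' (resc s psi lam x).
Proof.
move=> M0 l0 [Cp p0]; have c0 i : 0 < lam ^- s i by rewrite invr_gt0 exprn_gt0.
have [M' M'0 H] := off_box_aff x M0 c0 p0.
exists M' => //; split=> [n|y yM]; last by rewrite rescE H// mulr0.
by apply: Ck_mul; [exact: Ck_cst|exact: Ck_aff].
Qed.

(** Every multi-index in the sum has weight exactly [m], so the chain rule yields the same power
    [lam ^- m] in each term; the Jacobian of the dilation is absorbed by the normalisation in
    [resc]. *)
Lemma Ldist_dil M v phi lam x : 0 <= M -> 0 < lam -> contC v -> test_box M phi ->
  Ldist s a (pairf (fun z => v (dil lam x z))) phi =
  Complex (lam ^+ m) 0 * Ldist s a (pairf v) (resc s phi lam x).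
Proof.
move=> M0 l0 cv tp; rewrite /Ldist mulr_sumr; apply: eq_bigr => g /eqP gm.
have c0 i : 0 < lam ^- s i by rewrite invr_gt0 exprn_gt0.
have [Cp p0] := test_box_dpow (fun i => g i) tp.
rewrite rescE [in RHS]dpowE iter_partials_scale_aff; last exact: tp.1.
rewrite -dpowE prod_dseq.
have -> : \prod_i (lam ^- s i) ^+ g i = lam ^- m.
  rewrite -[X in lam ^- X]gm /aweight -exprVn -prodrXr /=; apply: eq_bigr => i _.
  by rewrite exprM; congr (_ ^+ _); rewrite exprVn.
set psi := dpow _ phi; set S := (\sum_i s i)%N.
have cP : continuous psi := Ck_continuous (Cp 0%N).
have ca : continuous (fun y => psi (aff (fun i => lam ^- s i) x y)).
  exact: (Ck_continuous (Ck_aff _ _ (Cp 0%N))).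
have [M' M'0 H] := off_box_aff x M0 c0 p0.
have key (f : pt -> R) : continuous f ->
    iint (fun y => f y * (lam ^- S * lam ^- m * psi (aff (fun i => lam ^- s i) x y))) =
    lam ^- m * iint (fun z => f (dil lam x z) * psi z).
  move=> cf; pose G z := f (dil lam x z) * psi z.
  have uG : ucc M G.
    apply: pair_ucc => //.
    by have := @rV_cont_comp R d f (dil lam x) (dil_continuous l0) cf; exact.
  have := iint_aff x M0 uG c0.
  have -> : \prod_i (lam ^- s i)^-1 = lam ^+ S.
    by rewrite /S -prodrXr; apply: eq_bigr => i _; rewrite invrK.
  move=> EG; rewrite -/G.
  have -> : iint G = lam ^- S * iint (fun y => f y * psi (aff (fun i => lam ^- s i) x y)).
    have -> : (fun y => f y * psi (aff (fun i => lam ^- s i) x y)) =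
              (fun y => G (aff (fun i => lam ^- s i) x y)).
      by apply/funext => y; rewrite /G dil_aff.
    by rewrite EG mulrA mulVf ?mul1r// expf_neq0// gt_eqF.
  have uf := pair_ucc cf ca H.
  have := iint_lin (lam ^- S * lam ^- m) 0 M'0 uf uf.
  rewrite mul0r addr0 mulrCA mulrA => <-.
  by congr iint; apply/funext => y; ring.
have -> : pairf v (fun y => lam ^- S * lam ^- m * psi (aff (fun i => lam ^- s i) x y)) =
   Complex (lam ^- m) 0 * pairf (fun z => v (dil lam x z)) psi.
  by case: cv => c1 c2; apply: cplx_ext; rewrite ?creZ ?cimZ /=; [rewrite -(key _ c1)|rewrite -(key _ c2)].
have -> : Complex (lam ^- m) 0 = (Complex (lam ^+ m) 0)^-1 :> R[i].
  by rewrite -[LHS]/((lam ^- m)%:C)%C fmorphV.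
rewrite [RHS]mulrCA; congr (_ * _).
rewrite mulrA divff ?mul1r//.
by rewrite -[X in X != 0]/((lam ^+ m)%:C)%C fmorph_eq0 expf_neq0// gt_eqF.
Qed.

Lemma solution_dil lam x v : 0 < lam -> contC v -> solution v ->
  solution (fun z => v (dil lam x z)).
Proof.
move=> l0 cv sv M phi M0 tp; rewrite (Ldist_dil x M0 l0 cv tp).
have [M' M'0 t'] := test_box_resc x M0 l0 tp.
by rewrite (sv _ _ M'0 t') mulr0.
Qed.

End Operator.

(** * Lagrange interpolation at equidistant nodes *)

Section Interpolation.
Context {R : realType}.
Implicit Types (p : {poly R}) (G : R -> R) (t h : R).

Definition node (n k : nat) : R := k%:R / n%:R.

Definition lag (n : nat) (j : 'I_n) : {poly R} := tnth (lagrange n (node n)) j.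

Lemma node_inj n : (0 < n)%N -> injective (node n).
Proof.
move=> n0 i j /(congr1 (fun x => x * n%:R)).
by rewrite /node !divfK ?pnatr_eq0 -?lt0n// => /eqP; rewrite eqr_nat => /eqP.
Qed.

Lemma node_ge0 n k : 0 <= node n k.
Proof. by rewrite divr_ge0. Qed.

Lemma node_le1 n (k : 'I_n) : node n k <= 1.
Proof.
case: n k => [[]//|n k]; rewrite /node ler_pdivrMr ?ltr0n// mul1r ler_nat.
exact/ltnW/ltn_ord.
Qed.

Lemma lagP n p : (0 < n)%N -> (size p <= n)%N ->
  p = \sum_(j < n) p.[node n j] *: lag j.
Proof.
move=> n0 sp; rewrite {1}(lagrange_gen n0 (node_inj n0) sp).
by apply: eq_bigr => j _; rewrite mul_polyC.
Qed.

Lemma lag_horner n p t : (0 < n)%N -> (size p <= n)%N ->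
  p.[t] = \sum_(j < n) (lag j).[t] * p.[node n j].
Proof.
move=> n0 sp; rewrite {1}(lagP n0 sp) horner_sum; apply: eq_bigr => j _.
by rewrite hornerZ mulrC.
Qed.

(* The error at [tau] of polynomial interpolation of G in n equidistant nodes of [0,1). *)
Definition interp_err n (tau : R) G : R := G tau - \sum_(j < n) (lag j).[tau] * G (node n j).

Lemma interp_err_poly n tau p : (0 < n)%N -> (size p <= n)%N -> interp_err n tau (horner p) = 0.
Proof. by move=> n0 sp; rewrite /interp_err -lag_horner// subrr. Qed.

Lemma interp_err_lin n tau G G' (c : R) :
  interp_err n tau (fun t => G t + c * G' t) = interp_err n tau G + c * interp_err n tau G'.
Proof.
rewrite /interp_err; under eq_bigr do rewrite mulrDr mulrCA.
rewrite big_split /= -mulr_sumr; ring.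
Qed.

Definition interp_norm n tau (w : R -> R) : R := w tau + \sum_(j < n) `|(lag j).[tau]| * w (node n j).

Lemma interp_err_le n tau G w : (forall t, `|G t| <= w t) ->
  `|interp_err n tau G| <= interp_norm n tau w.
Proof.
move=> Gw; apply: le_trans (ler_normB _ _) _; apply: lerD => //.
apply: le_trans (ler_norm_sum _ _ _) _; apply: ler_sum => j _.
by rewrite normrM ler_wpM2l.
Qed.

Lemma antiderivative (q : {poly R}) n (c : R) : (size q <= n)%N ->
  exists p, [/\ (size p <= n.+1)%N, p.[0] = c & p^`() = q].
Proof.
move=> sq; pose p := \poly_(i < n.+1) (if i is i'.+1 then q`_i' / i%:R else c).
exists p; split; first exact: size_poly.
  by rewrite horner_coef0 coef_poly.
apply/polyP => i; rewrite coef_deriv coef_poly ltnS.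
case: ltnP => ni; last by rewrite nth_default ?mul0rn// (leq_trans sq).
by rewrite -[LHS]mulr_natr divfK// pnatr_eq0.
Qed.

Lemma derive_family_continuous (G : nat -> R -> R) :
  (forall k t, is_derive t (1 : R) (G k) (G k.+1 t)) -> forall k, continuous (G k).
Proof.
move=> dG k t; apply/differentiable_continuous/derivable1_diffP.
by have := dG k t.
Qed.

Lemma mean_value_bound (H dH : R -> R) (K : R) t :
  (forall u, is_derive u (1 : R) H (dH u)) -> H 0 = 0 ->
  (forall u, `|u| <= `|t| -> `|dH u| <= K) -> `|H t| <= K * `|t|.
Proof.
move=> dd H0 Hb.
have cH : continuous H.
  by move=> u; apply/differentiable_continuous/derivable1_diffP; have := dd u.
have [t0|t0] := leP 0 t.
  have [|u + E] := MVT_segment t0 (fun u _ => dd u); first exact: continuous_subspaceT.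
  rewrite in_itv/= => /andP[u0 ut]; move: E; rewrite H0 !subr0 => ->.
  by rewrite normrM ler_wpM2r// Hb// !ger0_norm.
have [|u + E] := MVT_segment (ltW t0) (fun u _ => dd u); first exact: continuous_subspaceT.
rewrite in_itv/= => /andP[ut u0]; move: E; rewrite H0 !sub0r => /(congr1 -%R).
rewrite opprK => ->; rewrite normrN normrM normrN ler_wpM2r// Hb//.
by rewrite !ler0_norm ?lerN2// ltW.
Qed.

(** Taylor approximation by integration: the inductive hypothesis approximates the derivative by
    [q], the antiderivative of [q] with the right value at 0 is the new polynomial, and the mean
    value inequality gains one power of |t|. For [n = 0] the constant is a maximum over a compact
    interval. *)
Lemma taylor_approx n (G : nat -> R -> R) (B : R) :
  (forall k t, is_derive t (1 : R) (G k) (G k.+1 t)) -> 0 <= B ->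
  exists C p, [/\ 0 <= C, (size p <= n)%N &
    forall t, `|t| <= B -> `|G 0%N t - p.[t]| <= C * `|t| ^+ n].
Proof.
move=> + B0; elim: n G => [|n IH] G dG.
  have cG : continuous (G 0%N) := @derive_family_continuous G dG 0%N.
  have NB : - B <= B by lra.
  have cn : {within `[- B, B], continuous (fun t => `|G 0%N t|)}.
    apply: continuous_subspaceT => t.
    exact: continuous_comp (cG t) (@norm_continuous _ R^o _).
  have [c _ Hc] := EVT_max NB cn.
  exists (`|G 0%N c|), 0; split; rewrite ?size_poly0// => t tB.
  by rewrite horner0 subr0 expr0 mulr1; apply: Hc; rewrite in_itv/= -ler_norml.
have [C [q [C0 sq Hq]]] := IH (fun k => G k.+1) (fun k => dG k.+1).
have [p [sp p0 pq]] := antiderivative (G 0%N 0) sq.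
exists C, p; split=> // t tB.
rewrite exprSr mulrA; apply: (@mean_value_bound (fun u => G 0%N u - p.[u]) (fun u => G 1%N u - q.[u])).
- move=> u; have := is_derive_poly p u; rewrite pq => dp.
  exact: (is_deriveB (dG 0%N u) dp).
- by rewrite p0 subrr.
- move=> u ut; apply: le_trans (Hq u (le_trans ut tB)) _.
  by apply: ler_wpM2l => //; apply: lerXn2r; rewrite ?nnegrE.
Qed.

(** Interpolation reproduces polynomials of size at most [n], so only the Taylor remainder
    contributes; at arguments scaled by [h] it carries the factor h^n. *)
Lemma interp_err_smooth n tau (G : nat -> R -> R) : (0 < n)%N ->
  (forall k t, is_derive t (1 : R) (G k) (G k.+1 t)) ->
  exists C, forall h, 0 < h <= 1 ->
    `|interp_err n tau (fun t => G 0%N (h * t))| <= C * h ^+ n.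
Proof.
move=> n0 dG; have B0 : 0 <= `|tau| + 1 by rewrite addr_ge0.
have [C [p [C0 sp Hp]]] := taylor_approx n dG B0.
exists (interp_norm n tau (fun t => C * `|t| ^+ n)) => h /andP[h0 h1].
pose ph := p \Po (h *: 'X).
have sph : (size ph <= n)%N by rewrite size_comp_poly2// size_scale ?gt_eqF// size_polyX.
have phE t : ph.[t] = p.[h * t] by rewrite horner_comp hornerZ hornerX.
pose D t := G 0%N (h * t) + (-1) * ph.[t].
have DE : interp_err n tau (fun t => G 0%N (h * t)) = interp_err n tau D.
  by rewrite interp_err_lin interp_err_poly// mulr0 addr0.
rewrite DE /interp_err; apply: le_trans (ler_normB _ _) _.
have Db t : `|t| <= `|tau| + 1 -> `|D t| <= h ^+ n * (C * `|t| ^+ n).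
  move=> tB; rewrite /D mulN1r phE mulrCA -exprMn -[h in X in _ <= X](gtr0_norm h0) -normrM.
  apply: Hp; rewrite normrM gtr0_norm//; apply: le_trans tB.
  by rewrite ler_piMl.
rewrite /interp_norm mulrC mulrDr mulr_sumr; apply: lerD.
  by apply: Db; rewrite lerDl.
apply: le_trans (ler_norm_sum _ _ _) _; apply: ler_sum => j _.
rewrite normrM mulrCA ler_wpM2l//; apply: Db.
rewrite ger0_norm ?node_ge0//; apply: le_trans (node_le1 j) _.
by rewrite lerDr.
Qed.

Lemma powR_onto (e x : R) : e != 0 -> 0 < x -> (x `^ (e^-1)) `^ e = x.
Proof. by move=> e0 x0; rewrite -powRrM mulVf// powRr1// ltW. Qed.

Lemma le_scaled_eq0 (c K : R) : 0 <= K -> (forall x, 0 < x -> `|c| <= K * x) -> c = 0.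
Proof.
move=> K0 H; apply/eqP; rewrite -normr_eq0 eq_le normr_ge0 andbT leNgt; apply/negP => c0.
have K1 : 0 < K + 1 by lra.
have x0 : 0 < `|c| / (K + 1) / 2 by rewrite !divr_gt0.
have := H _ x0; apply/negP; rewrite -ltNge.
apply: (@le_lt_trans _ _ ((K + 1) * (`|c| / (K + 1) / 2))).
  by rewrite ler_wpM2r// ltW//; lra.
have -> : (K + 1) * (`|c| / (K + 1) / 2) = `|c| / 2 by field; lra.
lra.
Qed.

(** At scale h the quantity p_k h^k is a fixed linear combination of values of [p] at h times the
    nodes, hence at most a constant times h^e. Since e differs from k, h^(e - k) takes all positive
    values, so p_k = 0; degrees below and above e need no separate treatment. *)
Lemma poly_powR_eq0 p (M e : R) : 0 <= M -> 0 < e -> (forall n : nat, e != n%:R) ->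
  (forall t, 0 <= t -> `|p.[t]| <= M * t `^ e) -> p = 0.
Proof.
move=> M0 e0 en H; pose n := (size p).+1.
have n0 : (0 < n)%N by [].
apply/polyP => k; rewrite coef0.
pose K := \sum_(j < n) M * node n j `^ e * `|(lag j)`_k|.
have K0 : 0 <= K.
  by apply: sumr_ge0 => j _; rewrite mulr_ge0// mulr_ge0// powR_ge0.
(* Given the target [x], the scale is chosen so that h^(e - k) equals it. *)
apply: (le_scaled_eq0 K0) => x x0; pose h := x `^ ((e - k%:R)^-1).
have h0 : 0 < h by exact: powR_gt0.
have ek : e - k%:R != 0 by rewrite subr_eq0.
have <- : h `^ (e - k%:R) = x by exact: powR_onto.
rewrite powRB; last by apply/implyP => _; rewrite gt_eqF.
rewrite (powR_mulrn _ (ltW h0)) mulrA ler_pdivlMr ?exprn_gt0//.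
pose ph := p \Po (h *: 'X).
have sph : (size ph <= n)%N.
  by rewrite size_comp_poly2 ?leqnSn// size_scale ?gt_eqF// size_polyX.
have phE t : ph.[t] = p.[h * t] by rewrite horner_comp hornerZ hornerX.
have phk : ph`_k = p`_k * h ^+ k.
  rewrite /ph comp_polyE coef_sum.
  under eq_bigr do rewrite exprZn !coefZ coefXn.
  have [kp|kp] := ltnP k (size p); last first.
    rewrite (nth_default _ kp) mul0r big1// => i _.
    by rewrite gtn_eqF ?mulr0// (leq_trans (ltn_ord i)).
  rewrite (bigD1 (Ordinal kp))//= eqxx mulr1 big1 ?addr0// => i ik.
  by rewrite (_ : (k == i) = false) ?mulr0//; apply/negbTE; rewrite eq_sym; exact: ik.
rewrite -[h ^+ k in X in X <= _](ger0_norm (exprn_ge0 k (ltW h0))) -normrM -phk (lagP n0 sph) coef_sum.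
apply: le_trans (ler_norm_sum _ _ _) _; rewrite mulr_suml; apply: ler_sum => j _.
rewrite coefZ normrM phE [leRHS]mulrAC; apply: ler_wpM2r => //.
apply: le_trans (H _ (mulr_ge0 (ltW h0) (node_ge0 n j))) _.
by rewrite (powRM _ (ltW h0) (node_ge0 _ _)) [h `^ e * _]mulrC mulrA.
Qed.

End Interpolation.

(** * The uniform boundedness principle on a weighted space of functions *)

Section UniformBoundedness.
Context {R : realType} (Y I : Type) (w : Y -> R) (F : set (Y -> R))
  (T : I -> (Y -> R) -> R).

(** The unit ball of the sup norm weighted by [w]. The hypotheses below make [F] a linear space
    closed in that norm, on which the linear functionals [T i] are individually bounded and, as a
    family, pointwise bounded; no normed space has to be constructed. *)
Definition dominated (v : Y -> R) := forall y, `|v y| <= w y.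

Hypothesis F0 : F (fun=> 0).
Hypothesis Flin : forall u v c, F u -> F v -> F (fun y => u y + c * v y).
Hypothesis Flim : forall (u : nat -> Y -> R) v, (forall n, F (u n)) ->
  (forall e, 0 < e -> exists N, forall n, (N <= n)%N -> forall y, `|u n y - v y| <= e * w y) ->
  F v.
Hypothesis Tlin : forall i u v c, T i (fun y => u y + c * v y) = T i u + c * T i v.
Hypothesis Tb : forall i, exists A, forall v, F v -> dominated v -> `|T i v| <= A.
Hypothesis Tp : forall v, F v -> (exists M, forall y, `|v y| <= M * w y) ->
  exists C, forall i, `|T i v| <= C.
Hypothesis w0 : forall y, 0 <= w y.

Lemma T0 i : T i (fun=> 0) = 0.
Proof.
have := Tlin i (fun=> 0) (fun=> 0) 1.
have -> : (fun _ : Y => 0 + 1 * 0) = (fun=> 0 : R) by apply/funext => y; rewrite mulr0 addr0.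
by rewrite mul1r => /eqP; rewrite -subr_eq0 opprD addNKr oppr_eq0 => /eqP.
Qed.

(** Each [T i] has a finite supremum over the unit ball, but these suprema are unbounded in [i]. One
    [i] is taken with supremum above 4^n, then an element reaching three quarters of it; the maximum
    of the two thresholds gives both properties at once. *)
Lemma near_extremal n :
  (forall C, exists i v, [/\ F v, dominated v & C < `|T i v|]) ->
  exists iu : I * (Y -> R), [/\ F iu.2, dominated iu.2, 4 ^+ n <= `|T iu.1 iu.2| &
    forall v, F v -> dominated v -> `|T iu.1 v| <= 4 / 3 * `|T iu.1 iu.2|].
Proof.
move=> /(_ (4 ^+ n))[i [v [Fv dv Tv]]].
pose S := [set `|T i v| | v in [set v | F v /\ dominated v]].
have [A HA] := Tb i.
have hS : has_sup S.
  split; first by exists `|T i v|; exists v.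
  by exists A => _ [u [Fu du] <-]; exact: HA.
have Sv : `|T i v| <= sup S by apply: sup_upper_bound => //; exists v.
have S0 : 0 < sup S by apply: lt_le_trans Sv; apply: lt_trans Tv; rewrite exprn_gt0.
have [u [Fu du] Hu] : exists2 u, F u /\ dominated u & Num.max (4 ^+ n) (3 / 4 * sup S) < `|T i u|.
  have e0 : 0 < sup S - Num.max (4 ^+ n) (3 / 4 * sup S).
    by rewrite subr_gt0 gt_max (lt_le_trans Tv Sv)/=; lra.
  have [_ [u Fu <-]] := sup_adherent e0 hS.
  by rewrite opprB addrCA subrr addr0 => H; exists u.
exists (i, u); split=> //=.
  by apply/ltW; apply: le_lt_trans Hu; rewrite le_max lexx.
move=> v' Fv' dv'.
have v'S : `|T i v'| <= sup S by apply: sup_upper_bound => //; exists v'.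
have : 3 / 4 * sup S < `|T i u| by apply: le_lt_trans Hu; rewrite le_max lexx orbT.
lra.
Qed.

(* Sokal's proof of the uniform boundedness principle: a series of signed near-extremal
   elements, with coefficients 3^-n against norms growing like 4^n. *)
Lemma uniform_boundedness : exists C, forall i v, F v -> dominated v -> `|T i v| <= C.
Proof.
apply: contrapT => /forallNP nb.
have unb : forall C, exists i v, [/\ F v, dominated v & C < `|T i v|].
  move=> C; have /existsNP[i /existsNP[v /not_implyP[Fv /not_implyP[dv Tv]]]] := nb C.
  by exists i, v; split=> //; rewrite ltNge; exact/negP.
have /choice[iu H] := fun n => near_extremal n unb.
pose q n : R := 3 ^- n.
have q0 n : 0 < q n by rewrite invr_gt0 exprn_gt0.
have qS n : q n.+1 = q n / 3 by rewrite /q exprSr invfM.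
(* The values of the functional at the two candidates differ by 2 q_n T u, so one of them has
   modulus at least q_n |T u|. *)
pose step n (x : Y -> R) :=
  if q n * `|T (iu n).1 (iu n).2| <= `|T (iu n).1 (fun y => x y + q n * (iu n).2 y)|
  then (fun y => x y + q n * (iu n).2 y) else (fun y => x y + (- q n) * (iu n).2 y).
pose x := fix x n := if n is n'.+1 then step n' (x n') else (fun=> 0 : R).
have Fx n : F (x n).
  elim: n => //= n IH; have [Fu _ _ _] := H n.
  by rewrite /step; case: ifP => _; exact: Flin.
have Tx n : q n * `|T (iu n).1 (iu n).2| <= `|T (iu n).1 (x n.+1)|.
  rewrite /= /step; case: ifPn => //; rewrite -ltNge !Tlin => h.
  rewrite -[q n in X in X <= _](gtr0_norm (q0 n)) -normrM.
  have {h} : `|T (iu n).1 (x n) + q n * T (iu n).1 (iu n).2| < `|q n * T (iu n).1 (iu n).2|.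
    by rewrite [X in _ < X]normrM (gtr0_norm (q0 n)).
  rewrite mulNr; set a := T _ (x n); set b := q n * _ => h.
  have := ler_normB (a + b) (a - b).
  have -> : a + b - (a - b) = b *+ 2 by rewrite mulr2n; ring.
  by rewrite normrMn mulr2n; lra.
have dx n y : `|x n.+1 y - x n y| <= q n * w y.
  have [_ du _ _] := H n.
  rewrite /= /step; case: ifP => _; rewrite addrC addKr normrM ?normrN (gtr0_norm (q0 n));
    exact: (ler_wpM2l (ltW (q0 n)) (du y)).
(* Geometric series: the q_j with n <= j < n + k add up to 3/2 (q_n - q_(n+k)). *)
have dxk n k y : `|x (n + k)%N y - x n y| <= 3 / 2 * (q n - q (n + k)%N) * w y.
  elim: k => [|k IH]; first by rewrite addn0 !subrr normr0 mulr0 mul0r.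
  rewrite addnS; have := dx (n + k)%N y; have := ler_normD (x (n + k).+1 y - x (n + k)%N y)
    (x (n + k)%N y - x n y).
  rewrite addrA subrK qS; move: IH; lra.
(* The limit is the supremum of the lower bounds x_n - 3/2 q_n w; by [up] each of them lies below
   every upper bound x_j + 3/2 q_j w, which gives the rate of convergence directly. *)
pose X y := sup (range (fun n => x n y - 3 / 2 * q n * w y)).
have dX n y : `|X y - x n y| <= 3 / 2 * q n * w y.
  have up k j : x k y - 3 / 2 * q k * w y <= x j y + 3 / 2 * q j * w y.
    have qw i := mulr_ge0 (ltW (q0 i)) (w0 y).
    have [kj|jk] := leqP k j.
      have := dxk k (j - k)%N y; rewrite subnKC// ler_norml => /andP[+ _].
      have := qw j; lra.
    have := dxk j (k - j)%N y; rewrite subnKC ?(ltnW jk)// ler_norml => /andP[_ +].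
    have := qw k; lra.
  rewrite ler_distl; apply/andP; split.
    apply: ub_le_sup; last by exists n.
    by exists (x n y + 3 / 2 * q n * w y) => _ [k _ <-].
  apply: ge_sup; first by exists (x 0%N y - 3 / 2 * q 0%N * w y); exists 0%N.
  by move=> _ [k _ <-].
have qto e : 0 < e -> exists N, forall n, (N <= n)%N -> q n <= e.
  move=> e0; pose N := (Num.truncn (e^-1)).+1.
  exists N => n Nn; rewrite /q -[e]invrK lef_pV2 ?posrE ?exprn_gt0 ?invr_gt0//.
  apply: (@le_trans _ _ n%:R).
    apply: le_trans (ltW (truncnS_gt _)) _; by rewrite ler_nat.
  by rewrite -natrX ler_nat ltnW// ltn_expl.
have FX : F X.
  apply: (Flim Fx) => e e0; have [|N HN] := qto (2 / 3 * e); first lra.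
  exists N => n Nn y; rewrite distrC; apply: le_trans (dX n y) _.
  by apply: ler_wpM2r => //; have := HN n Nn; lra.
have [|C HC] := Tp FX.
  exists (3 / 2) => y; have := dX 0%N y.
  by rewrite /= subr0 /q expr0 invr1 mulr1.
have grow n : q n * 4 ^+ n <= 3 * C.
  have [Fu du Tu Tmax] := H n.
  (* The tail X - x_(n+1) is at most 3/2 q_(n+1) w = q_n w / 2, so the factor 2 / q_n puts it into
     the unit ball. By near-extremality the tail costs at most 2/3 of q_n |T u|, leaving |T X| at
     least one third of it. *)
  pose c := 2 * (q n)^-1.
  have c0 : 0 < c by rewrite mulr_gt0// invr_gt0.
  set t := `|T _ _| in Tu Tmax *.
  have Fv : F (fun y => 0 + c * (X y + (-1) * x n.+1 y)).
    by apply: (Flin c F0); apply: Flin.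
  have dv : dominated (fun y => 0 + c * (X y + (-1) * x n.+1 y)).
    move=> y; rewrite add0r mulN1r normrM gtr0_norm//.
    apply: (@le_trans _ _ (c * (3 / 2 * q n.+1 * w y))).
      exact: (ler_wpM2l (ltW c0) (dX n.+1 y)).
    have -> : c * (3 / 2 * q n.+1 * w y) = w y.
      by rewrite qS /c; field; rewrite gt_eqF.
    by [].
  have := Tmax _ Fv dv; rewrite Tlin T0 add0r Tlin mulN1r normrM gtr0_norm//.
  rewrite /c mulrAC (ler_pdivrMr _ _ (q0 n)) => h.
  have h1 := HC (iu n).1; have h2 := Tx n; rewrite -/t in h2.
  have h3 := ler_normB (T (iu n).1 X) (T (iu n).1 X - T (iu n).1 (x n.+1)).
  rewrite opprB addrCA subrr addr0 in h3.
  have h4 : q n * 4 ^+ n <= q n * t by rewrite ler_wpM2l// ltW.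
  move: h h1 h2 h3 h4; set D := `|T _ X - T _ _|; nra.
(* Bernoulli's inequality for (4/3)^n, which makes the bound [grow] impossible. *)
have bern n : 1 + n%:R / 3 <= q n * 4 ^+ n.
  elim: n => [|n IH]; first by rewrite mul0r addr0 /q !expr0 invr1 mulr1.
  rewrite qS exprS -natr1.
  have -> : q n / 3 * (4 * 4 ^+ n) = 4 / 3 * (q n * 4 ^+ n) by field.
  have := ler0n R n; move: IH; lra.
have := le_trans (bern (Num.truncn (9 * C)).+1) (grow _).
by have := truncnS_gt (9 * C); lra.
Qed.

End UniformBoundedness.

(** * Entire solutions of anisotropic growth of order eta *)

Section Liouville.
Context {R : realType} {d : nat} (s : 'I_d -> nat) (m : nat)
  (a : {ffun 'I_d -> 'I_m.+1} -> R[i]) (eta : R).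
Local Notation pt := 'rV[R]_d.
Implicit Types (v u : pt -> R[i]) (f g : pt -> R).
Hypothesis s0 : forall i, (0 < s i)%N.
Hypothesis eta0 : 0 < eta.

Local Notation solution := (solution s a).

Lemma contC0 : contC (fun _ : pt => 0 : R[i]).
Proof. by split; exact: cst_continuous. Qed.

Lemma solution0 : solution (fun=> 0).
Proof.
move=> M phi M0 tp; have [B B0 HB] := @Ldist_bound R d s m a M phi M0 tp.
have c0 := contC0.
apply: Normc.eq0_normc; apply/eqP; rewrite eq_le; apply/andP; split; last exact: cabs_ge0.
by have := HB (fun=> 0) 0 c0; rewrite mulr0; apply => y _; rewrite cabs0.
Qed.

Lemma contC_lin u v (c : R) : contC u -> contC v -> contC (fun y => u y + Complex c 0 * v y).
Proof.
move=> [u1 u2] [v1 v2]; split.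
  have -> : (fun y => cre (u y + Complex c 0 * v y)) = (fun y => cre (u y) + c * cre (v y)).
    by apply/funext => y; rewrite creD creZ.
  by apply: rV_contD => //; apply: rV_contM => //; exact: cst_continuous.
have -> : (fun y => cim (u y + Complex c 0 * v y)) = (fun y => cim (u y) + c * cim (v y)).
  by apply/funext => y; rewrite cimD cimZ.
by apply: rV_contD => //; apply: rV_contM => //; exact: cst_continuous.
Qed.

Lemma solution_lin u v (c : R) : contC u -> contC v -> solution u -> solution v ->
  solution (fun y => u y + Complex c 0 * v y).
Proof.
move=> cu cv su sv M phi M0 tp.
by rewrite (Ldist_lin s a c M0 cu cv tp) (su _ _ M0 tp) (sv _ _ M0 tp) mulr0 addr0.
Qed.

Lemma solution_scale v (c : R) : contC v -> solution v -> solution (fun y => Complex c 0 * v y).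
Proof.
move=> cv sv; have c0 := contC0.
have := solution_lin c c0 cv solution0 sv.
by congr solution; apply/funext => y; rewrite add0r.
Qed.

(** One approximant for each [e] suffices, and it need only be an almost solution: this covers
    limits of exact solutions as well as the blow-up sequence, whose images under the operator
    merely tend to 0. *)
Lemma Ldist_limit v phi M : 0 <= M -> test_box M phi -> contC v ->
  (forall e, 0 < e -> exists u, [/\ contC u, cabs (Ldist s a (pairf u) phi) <= e &
     forall y, box M y -> cabs (v y - u y) <= e]) ->
  Ldist s a (pairf v) phi = 0.
Proof.
move=> M0 tp cv H; have [B B0 HB] := @Ldist_bound R d s m a M phi M0 tp.
apply: Normc.eq0_normc; apply: (le_scaled_eq0 (K := B + 1)); first by lra.
move=> e e0; have [u [cu su Hu]] := H e e0.
rewrite ger0_norm; last exact: cabs_ge0.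
have -> : Ldist s a (pairf v) phi =
    Ldist s a (pairf (fun y => v y + Complex (-1) 0 * u y)) phi + Ldist s a (pairf u) phi.
  rewrite (Ldist_lin s a _ M0 cv cu tp) (_ : Complex (-1) 0 = -1).
    by rewrite mulN1r subrK.
  by apply: cplx_ext; rewrite /= ?oppr0.
apply: le_trans (cabsD _ _) _; rewrite mulrDl mul1r; apply: lerD => //.
apply: HB; first exact: contC_lin.
move=> y bY; have := Hu y bY; congr (cabs (_ + _) <= _).
by apply: cplx_ext; rewrite ?creZ ?cimZ ?creN ?cimN mulN1r.
Qed.

Lemma unif_limit_continuous f :
  (forall M e, 0 < e -> exists g : pt -> R, continuous g /\
     forall y, box M y -> `|g y - f y| <= e) -> continuous f.
Proof.
move=> H x; apply/rV_continuous_atP => e e0.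
have e4 : 0 < e / 4 by lra.
have [g [cg Hg]] := H (\sum_i `|x ord0 i| + 1) _ e4.
have [r r0 Hr] := (rV_continuous_atP g x).1 (cg x) _ e4.
exists (Num.min r 1); first by rewrite lt_min r0 ltr01.
move=> y xy.
have xi i : `|x ord0 i| <= \sum_j `|x ord0 j| by rewrite (bigD1 i)//= lerDl sumr_ge0.
have bx : box (\sum_i `|x ord0 i| + 1) x by move=> i; have := xi i; lra.
have by_ : box (\sum_i `|x ord0 i| + 1) y.
  move=> i; have := xy i; rewrite lt_min => /andP[_ h]; have := xi i.
  by have := ler_normB (x ord0 i) (x ord0 i - y ord0 i); rewrite opprB addrCA subrr addr0; lra.
have h1 := Hg _ bx; have h2 := Hg _ by_.
have h3 : `|g x - g y| < e / 4 by apply: Hr => i; have := xy i; rewrite lt_min => /andP[].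
move: h1 h2 h3; rewrite !ler_norml !ltr_norml; lra.
Qed.

(** The 1 absorbs the base point of a rescaling: if |x_i| <= L and L >= 1, then |x_i + L^(s_i) z_i|
    <= L^(s_i) (1 + |z_i|). Thus all normalised rescalings of an entire solution share one bound. *)
Definition wt (z : pt) : R := (\sum_i (1 + `|z ord0 i|) `^ ((s i)%:R^-1)) `^ eta.

Lemma wt_ge0 z : 0 <= wt z. Proof. exact: powR_ge0. Qed.

Lemma wt_box M z : box M z -> wt z <= wt (const_mx M).
Proof.
move=> bz; apply: ge0_ler_powR; rewrite ?nnegrE ?(ltW eta0)//.
- by apply: sumr_ge0 => i _; exact: powR_ge0.
- by apply: sumr_ge0 => i _; exact: powR_ge0.
apply: ler_sum => i _; apply: ge0_ler_powR; rewrite ?nnegrE ?invr_ge0 ?addr_ge0//.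
by rewrite lerD2l mxE; apply: le_trans (bz i) _; exact: ler_norm.
Qed.

Lemma smooth_line f i k t : smooth_on setT f ->
  is_derive t (1 : R) (fun u : R => iter_partials (nseq k i) f (u *: unit_vec i))
    (iter_partials (nseq k.+1 i) f (t *: unit_vec i)).
Proof.
move=> /Ck_smooth Cf; have Ck1 := iter_partials_Ck (nseq k i) Cf 1%N.
have [dd _] := Ck_partial i Ck1.
have := (is_derive_lineP _ _ _ _).1 (dd (t *: unit_vec i)).
set D := partial _ _ _ => H.
have -> : (fun u : R => iter_partials (nseq k i) f (u *: unit_vec i)) =
  (fun h : R => iter_partials (nseq k i) f (h *: unit_vec i + t *: unit_vec i)) \o (fun u : R => u - t).
  by apply/funext => u /=; rewrite -scalerDl subrK.
have dm : is_derive t (1 : R) (fun u : R => u - t) 1.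
  have -> : (fun u : R => u - t) = id - cst t by [].
  by apply: is_derive_eq; rewrite subr0.
have H' : is_derive (t - t) (1 : R)
   (fun h : R => iter_partials (nseq k i) f (h *: unit_vec i + t *: unit_vec i)) D.
  by rewrite subrr.
by apply: is_derive_eq; rewrite mulr1.
Qed.

(** Complex functions are encoded as real functions on points with a flag for the imaginary part,
    since [uniform_boundedness] concerns real-valued functions. *)
Definition toC (f : pt * bool -> R) : pt -> R[i] := fun z => Complex (f (z, false)) (f (z, true)).

Definition part (b : bool) (z : R[i]) : R := if b then cim z else cre z.

Lemma part_scale b (c : R) z : part b (Complex c 0 * z) = c * part b z.
Proof. by case: b; rewrite /= ?cimZ ?creZ. Qed.

(** The functionals are h^(-n) times the interpolation error. Each is a finite combination of point
    values, hence bounded on the weighted unit ball; for one solution they are bounded in [h]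
    because ellipticity makes it smooth. Outside 0 < h <= 1 the functional is set to 0, so that [h]
    may range over the whole line. *)
Lemma interp_err_uniform n tau i : elliptic s a -> (0 < n)%N ->
  exists C, forall b h v, 0 < h <= 1 -> contC v -> solution v ->
    (forall z, cabs (v z) <= wt z) ->
    `|interp_err n tau (fun t => part b (v ((h * t) *: unit_vec i)))| <= C * h ^+ n.
Proof.
move=> ell n0.
pose F : set (pt * bool -> R) := [set f | contC (toC f) /\ solution (toC f)].
pose T (hb : R * bool) (f : pt * bool -> R) : R := if 0 < hb.1 <= 1 then
  hb.1 ^- n * interp_err n tau (fun t => f ((hb.1 * t) *: unit_vec i, hb.2)) else 0.
have toC_lin (u v : pt * bool -> R) c :
    toC (fun y => u y + c * v y) = (fun z => toC u z + Complex c 0 * toC v z).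
  by apply/funext => z; apply: cplx_ext; rewrite ?creD ?cimD ?creZ ?cimZ.
have [|||||||C HC] := @uniform_boundedness R (pt * bool)%type (R * bool)%type (fun y => wt y.1) F T.
- have E0 : toC (fun=> 0) = (fun=> 0) by apply/funext => z; apply: cplx_ext.
  by rewrite /F /= E0; split; [exact: contC0|exact: solution0].
- move=> u v c [cu su] [cv sv]; rewrite /F /= toC_lin; split; first exact: contC_lin.
  exact: solution_lin.
- move=> u v Fu Huv.
  have key M e : 0 < e -> exists n, forall y, box M y -> forall b, `|u n (y, b) - v (y, b)| <= e.
    move=> e0; pose W := wt (const_mx M) + 1.
    have W0 : 0 < W by have := wt_ge0 (const_mx M); rewrite /W; lra.
    have [N HN] := Huv (e / W) (divr_gt0 e0 W0).
    exists N => y bY b; apply: le_trans (HN N (leqnn N) (y, b)) _ => /=.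
    rewrite mulrAC ler_pdivrMr//; apply: ler_wpM2l; first exact: ltW.
    by apply: le_trans (wt_box bY) _; rewrite lerDl.
  have cv : contC (toC v).
    split; apply: unif_limit_continuous => M e e0; have [N HN] := key M e e0.
      by exists (fun y => cre (toC (u N) y)); split; [exact: (Fu N).1.1|move=> y bY; exact: (HN y bY false)].
    by exists (fun y => cim (toC (u N) y)); split; [exact: (Fu N).1.2|move=> y bY; exact: (HN y bY true)].
  split=> // M phi M0 tp; apply: (Ldist_limit M0 tp cv) => e e0.
  have e2 : 0 < e / 2 by lra.
  have [N HN] := key M _ e2; exists (toC (u N)); split; first exact: (Fu N).1.
    by rewrite ((Fu N).2 _ _ M0 tp) cabs0 ltW.
  move=> y bY; apply: le_trans (cabs_le _) _; rewrite creD cimD creN cimN /=.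
  have := HN y bY false; have := HN y bY true.
  by rewrite [`|v (y, false) - _|]distrC [`|v (y, true) - _|]distrC; lra.
- move=> [h b] u v c; rewrite /T /=; case: ifP => _; last by rewrite mulr0 addr0.
  by rewrite interp_err_lin; ring.
- move=> [h b]; rewrite /T /=; case h01: (0 < h <= 1); last first.
    by exists 0 => v _ _; rewrite normr0.
  have /andP[h0 h1] := h01.
  exists (h ^- n * interp_norm n tau (fun t => wt ((h * t) *: unit_vec i))) => v _ dv.
  have hn : 0 <= h ^- n by rewrite invr_ge0 exprn_ge0// ltW.
  rewrite normrM (ger0_norm hn); apply: ler_wpM2l => //.
  by apply: interp_err_le => t; exact: (dv (_, b)).
- move=> v [cv sv] _; have [s1 s2] := elliptic_smooth ell cv sv.
  have [C1 HC1] := interp_err_smooth tau n0 (fun k t => smooth_line i k t s1).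
  have [C2 HC2] := interp_err_smooth tau n0 (fun k t => smooth_line i k t s2).
  exists (Num.max (Num.max C1 C2) 0) => -[h b]; rewrite /T /=.
  case: ifP => [h01|_]; last by rewrite normr0 le_max lexx orbT.
  have /andP[h0 h1] := h01.
  have hn : 0 < h ^- n by rewrite invr_gt0 exprn_gt0.
  rewrite normrM (gtr0_norm hn) (ler_pdivrMl _ _ (exprn_gt0 n h0)) mulrC.
  case: b.
    apply: le_trans (HC2 h h01) _; apply: ler_wpM2r; first by rewrite exprn_ge0// ltW.
    by rewrite !le_max lexx ?orbT.
  apply: le_trans (HC1 h h01) _; apply: ler_wpM2r; first by rewrite exprn_ge0// ltW.
  by rewrite !le_max lexx ?orbT.
- by move=> y; exact: wt_ge0.
exists C => b h v h01 cv sv wv.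
have /andP[h0 h1] := h01.
have hn : 0 < h ^- n by rewrite invr_gt0 exprn_gt0.
pose f (y : pt * bool) := part y.2 (v y.1).
have fv : toC f = v by apply/funext => z; apply: cplx_ext.
have Ff : F f by rewrite /F /= fv.
have := HC (h, b) f Ff; rewrite /T /= h01 normrM (gtr0_norm hn) (ler_pdivrMl _ _ (exprn_gt0 n h0)) mulrC; apply.
by move=> [z b'] /=; apply: le_trans (wv z); rewrite /f; case: b'; [exact: cim_le|exact: cre_le].
Qed.

Lemma powR_small_at_infinity (e L0 eps : R) : e < 0 -> 0 < eps ->
  exists L, [/\ L0 <= L, 1 <= L & L `^ e <= eps].
Proof.
move=> e0 p0; pose y := (eps^-1) `^ ((- e)^-1).
have ip : 0 < eps^-1 by rewrite invr_gt0.
exists (Num.max (Num.max L0 1) y); split; rewrite ?le_max ?lexx ?orbT//.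
set L := Num.max _ _.
have yL : y <= L by rewrite /L le_max lexx orbT.
have y0 : 0 <= y by exact: powR_ge0.
rewrite -[e]opprK powRN -[eps]invrK lef_pV2 ?posrE//; last first.
  by rewrite powR_gt0// /L !lt_max ltr01 orbT.
rewrite -[X in X <= _](@powR_onto _ (- e)) ?oppr_eq0 ?lt_eqF//.
apply: ge0_ler_powR; rewrite ?nnegrE ?oppr_ge0 ?(ltW e0)//.
exact: le_trans yL.
Qed.

Lemma powR_expn_root (t : R) i : 0 <= t -> (t ^+ s i) `^ ((s i)%:R^-1) = t.
Proof.
move=> t0; rewrite -powR_mulrn// -powRrM mulfV ?powRr1//.
by rewrite pnatr_eq0 -lt0n.
Qed.

Lemma sdist_dil0 (t : R) (z : pt) : 0 <= t -> sdist s 0 (\row_i (t ^+ s i * z ord0 i)) = t * sdist s 0 z.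
Proof.
move=> t0; rewrite /sdist mulr_sumr; apply: eq_bigr => i _.
rewrite !mxE !sub0r !normrN normrM (ger0_norm (exprn_ge0 _ t0)).
by rewrite powRM ?exprn_ge0// powR_expn_root.
Qed.

Lemma sdist_ge0 (x y : pt) : 0 <= sdist s x y.
Proof. by apply: sumr_ge0 => i _; exact: powR_ge0. Qed.

Section Entire.
Variable v : pt -> R[i].
Hypothesis cv : contC v.
Hypothesis sv : solution v.
Hypothesis growth : forall z, cabs (v z) <= sdist s 0 z `^ eta.

Lemma rescaled_growth (L : R) (x z : pt) : 1 <= L -> (forall i, `|x ord0 i| <= L) ->
  cabs (Complex (L `^ (- eta)) 0 * v (dil s L x z)) <= wt z.
Proof.
move=> L1 xL; have L0 : 0 < L by lra.
rewrite cabsZ ?powR_ge0// powRN ler_pdivrMl ?powR_gt0//.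
apply: le_trans (growth _) _; rewrite /wt -powRM ?(ltW L0)//; last first.
  by apply: sumr_ge0 => i _; exact: powR_ge0.
apply: ge0_ler_powR; rewrite ?nnegrE ?(ltW eta0) ?sdist_ge0//.
  by rewrite mulr_ge0 ?(ltW L0)//; apply: sumr_ge0 => i _; exact: powR_ge0.
rewrite /sdist mulr_sumr; apply: ler_sum => i _.
rewrite -[X in _ <= X * _](powR_expn_root i (ltW L0)) -powRM ?exprn_ge0 ?addr_ge0 ?(ltW L0)//.
have Ls : L <= L ^+ s i by rewrite -{1}[L]expr1; apply: ler_weXn2l.
apply: ge0_ler_powR; rewrite ?nnegrE ?invr_ge0//.
  by rewrite mulr_ge0 ?addr_ge0 ?exprn_ge0 ?(ltW L0)//.
rewrite !mxE sub0r normrN; apply: le_trans (ler_normD _ _) _.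
rewrite mulrDr mulr1 normrM (ger0_norm (exprn_ge0 _ (ltW L0))) lerD2r.
exact: le_trans (xL i) Ls.
Qed.

(** In the coordinates of the dilation by [L] about [x], a unit step along axis i becomes h =
    L^(-s_i) and the normalised solution stays below [wt]. Undoing the normalisation bounds the
    error by |C| L^eta h^n <= |C| L^(eta - n), which tends to 0 as L grows. *)
Lemma interp_err0 n tau i b (x : pt) : elliptic s a -> eta < n%:R ->
  interp_err n tau (fun t => part b (v (x + t *: unit_vec i))) = 0.
Proof.
move=> ell en.
have n0 : (0 < n)%N by rewrite -(ltr0n R); exact: lt_trans en.
have [C HC] := interp_err_uniform tau i ell n0.
set E := interp_err _ _ _.
apply: (@le_scaled_eq0 _ _ `|C|) => // eps eps0.
have e0 : eta - n%:R < 0 by lra.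
have [L [L0 L1 Le]] := powR_small_at_infinity (\sum_i `|x ord0 i|) e0 eps0.
have Lp : 0 < L by lra.
have xL j : `|x ord0 j| <= L.
  by apply: le_trans L0; rewrite (bigD1 j)//= lerDl sumr_ge0.
pose h := L ^- s i.
have h0 : 0 < h by rewrite invr_gt0 exprn_gt0.
have Ls : 1 <= L ^+ s i by rewrite exprn_ege1.
have h1 : h <= 1 by rewrite invf_le1// exprn_gt0.
pose u z := Complex (L `^ (- eta)) 0 * v (dil s L x z).
have cd := contC_dil s x Lp cv.
have c0 := contC0.
have cu : contC u.
  have := contC_lin (L `^ (- eta)) c0 cd.
  by congr contC; apply/funext => y; rewrite add0r.
have su : solution u by apply: solution_scale => //; exact: solution_dil.
have h01 : 0 < h <= 1 by rewrite h0.
have := HC b h u h01 cu su (fun z => rescaled_growth z L1 xL).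
have -> : (fun t => part b (u ((h * t) *: unit_vec i))) =
          (fun t => 0 + L `^ (- eta) * part b (v (x + t *: unit_vec i))).
  apply/funext => t; rewrite add0r /u.
  have -> : dil s L x ((h * t) *: unit_vec i) = x + t *: unit_vec i.
    apply/rowP => j; rewrite !mxE; case: eqP => [->|_]; last by rewrite !mulr0.
    by rewrite !mulr1 /h mulrA divff ?mul1r// expf_neq0// gt_eqF.
  exact: part_scale.
rewrite interp_err_lin -/E.
have -> : interp_err n tau (fun=> 0) = 0.
  by rewrite /interp_err big1 ?subr0// => j _; rewrite mulr0.
rewrite add0r normrM (ger0_norm (powR_ge0 _ _)) powRN ler_pdivrMl ?powR_gt0// => HE.
apply: le_trans HE _.
have hn : h ^+ n <= L ^- n.
  have hL : h <= L^-1.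
    rewrite /h lef_pV2 ?posrE ?exprn_gt0//.
    by rewrite -{1}[L]expr1; apply: ler_weXn2l.
  rewrite -exprVn; apply: lerXn2r hL; rewrite nnegrE; first exact: ltW.
  by rewrite invr_ge0 ltW.
have E2 : L `^ eta * L ^- n = L `^ (eta - n%:R).
  rewrite powRB; last by apply/implyP => _; rewrite gt_eqF.
  by rewrite powR_mulrn// ltW.
apply: (@le_trans _ _ (L `^ eta * (`|C| * L ^- n))).
  apply: ler_wpM2l; first exact: powR_ge0.
  apply: le_trans (ler_norm _) _; rewrite normrM (ger0_norm (exprn_ge0 _ (ltW h0))).
  exact: ler_wpM2l.
by rewrite mulrCA E2 ler_wpM2l.
Qed.

(** Only the first [k] coordinates of [P k x t] move. Moving one more is an exact interpolation
    step, with weights polynomial in t and values polynomial by induction at base points shifted by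
    the nodes; this is why the base point is left arbitrary. *)
Lemma dil_polynomial b (z : pt) : elliptic s a ->
  exists p : {poly R}, forall t, part b (v (\row_i (t ^+ s i * z ord0 i))) = p.[t].
Proof.
move=> ell; pose n := (Num.truncn eta).+1.
have en : eta < n%:R by exact: truncnS_gt.
pose P k (x : pt) (t : R) : pt :=
  \row_i (x ord0 i + if (i < k)%N then t ^+ s i * z ord0 i else 0).
suff H k : (k <= d)%N -> forall x, exists p : {poly R}, forall t, part b (v (P k x t)) = p.[t].
  have [p Hp] := H d (leqnn d) 0; exists p => t; rewrite -Hp; congr (part b (v _)).
  by apply/rowP => i; rewrite !mxE ltn_ord add0r.
elim: k => [|k IH] kd x.
  exists ((part b (v x))%:P) => t; rewrite hornerC; congr (part b (v _)).
  by apply/rowP => i; rewrite !mxE addr0.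
pose i : 'I_d := Ordinal kd.
have /choice[q Hq] : forall j : 'I_n, exists p : {poly R}, forall t,
    part b (v (P k (x + node n j *: unit_vec i) t)) = p.[t] by move=> j; exact: IH (ltnW kd) _.
exists (\sum_(j < n) (lag j \Po (z ord0 i *: 'X^(s i))) * q j) => t.
rewrite horner_sum.
have -> : P k.+1 x t = P k x t + (t ^+ s i * z ord0 i) *: unit_vec i.
  apply/rowP => j; rewrite !mxE ltnS leq_eqVlt -addrA; congr (_ + _).
  have [->|ji] := eqVneq j i; first by rewrite !eqxx ltnn add0r mulr1.
  rewrite mulr0 addr0 (_ : (j == k :> nat) = false)//.
  by apply/negbTE; apply: contra ji => /eqP jk; apply/eqP/val_inj.
have := interp_err0 (t ^+ s i * z ord0 i) i b (P k x t) ell en.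
move=> /eqP; rewrite subr_eq0 => /eqP ->; apply: eq_bigr => j _.
rewrite hornerM horner_comp hornerZ hornerXn [z ord0 i * _]mulrC -Hq; congr (_ * part b (v _)).
by apply/rowP => l; rewrite !mxE addrAC.
Qed.

Theorem liouville : elliptic s a -> (forall n : nat, eta != n%:R) -> v = (fun=> 0).
Proof.
move=> ell en; apply/funext => z.
have key b : part b (v z) = 0.
  have [p Hp] := dil_polynomial b z ell.
  have p0 : p = 0.
    apply: (@poly_powR_eq0 _ p (sdist s 0 z `^ eta) eta) => // [|t t0].
      exact: powR_ge0.
    rewrite -Hp mulrC -powRM ?sdist_ge0// -sdist_dil0//.
    apply: le_trans (growth _).
    by case: (b); [exact: cim_le|exact: cre_le].
  have := Hp 1; rewrite p0 horner0 => <-; congr (part b (v _)).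
  by apply/rowP => i; rewrite !mxE expr1n mul1r.
by apply: cplx_ext; [exact: key false|exact: key true].
Qed.

End Entire.

End Liouville.

(** * Compactness of the blow-up sequence *)

Section Compactness.
Context {R : realType} {d : nat} (s : 'I_d -> nat) (m : nat)
  (a : {ffun 'I_d -> 'I_m.+1} -> R[i]) (eta : R).
Local Notation pt := 'rV[R]_d.
Implicit Types (v u : pt -> R[i]) (phi psi : pt -> R).
Hypothesis s0 : forall i, (0 < s i)%N.
Hypothesis eta0 : 0 < eta.

(** The limit is the supremum of the [t] with t <= f_j for U-almost every j: just below it this set
    of indices is in [U], and just above it the ultrafilter contains the complement. *)
Lemma ultra_limit (U : set_system nat) (f : nat -> R) (B : R) : UltraFilter U ->
  U [set j | `|f j| <= B] ->
  exists l, forall e, 0 < e -> U [set j | `|f j - l| <= e].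
Proof.
move=> UU fB; have PU : ProperFilter U by exact: ultra_proper.
have UI A A' : U A -> U A' -> U (A `&` A') by move=> UA UA'; exact: filterI.
pose S := [set t | U [set j | t <= f j]].
have Sub t : S t -> t <= B.
  move=> St; have /filter_ex[j [/= h1]] := UI _ _ St fB.
  by rewrite ler_norml => /andP[_ h2]; exact: le_trans h2.
have hS : has_sup S.
  split; last by exists B.
  exists (- B); apply: filterS fB => j /=; by rewrite ler_norml => /andP[].
exists (sup S) => e e0.
have [t St tl] := sup_adherent e0 hS.
have hi : U [set j | ~ (sup S + e <= f j)].
  have [|//] := in_ultra_setVsetC [set j | sup S + e <= f j] UU.
  move=> /(sup_upper_bound hS); lra.
apply: filterS (UI _ _ St hi) => j /= [h1 /negP]; rewrite -ltNge => h2.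
rewrite ler_norml; lra.
Qed.

Lemma cabs_part (z : R[i]) (e : R) : (forall b, `|part b z| <= e) -> cabs z <= e + e.
Proof. by move=> H; apply: le_trans (cabs_le _) _; apply: lerD; [exact: (H false)|exact: (H true)]. Qed.

Lemma part_cabs b (z : R[i]) : `|part b z| <= cabs z.
Proof. by case: b; [exact: cim_le|exact: cre_le]. Qed.

Lemma partB b (z w : R[i]) : part b (z - w) = part b z - part b w.
Proof. by case: b; rewrite /= ?creD ?cimD ?creN ?cimN. Qed.

Lemma cabs_distC (z w : R[i]) : cabs (z - w) = cabs (w - z).
Proof. by rewrite -cabsN opprB. Qed.

Lemma cabs_dist_trans (z w x : R[i]) : cabs (z - x) <= cabs (z - w) + cabs (w - x).
Proof. by have := cabsD (z - w) (w - x); rewrite addrA subrK. Qed.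

(* The sequence converges locally uniformly along an ultrafilter to an entire
   solution, to which the Liouville theorem applies. *)
Lemma blowup_limit (V : nat -> pt -> R[i]) (Rad : nat -> R) (M0 : R) :
  elliptic s a -> (forall n : nat, eta != n%:R) ->
  (forall j, contC (V j)) ->
  (forall N, \forall j \near \oo, N <= Rad j) ->
  (forall j z, sdist s 0 z < Rad j -> cabs (V j z) <= sdist s 0 z `^ eta) ->
  (forall M phi, 0 <= M -> test_box M phi -> forall e, 0 < e ->
     \forall j \near \oo, cabs (Ldist s a (pairf (V j)) phi) <= e) ->
  (forall (x : pt) (e : R), 0 < e -> exists2 r : R, 0 < r & \forall j \near \oo, forall y : pt,
     (forall i, `|x ord0 i - y ord0 i| < r) -> cabs (V j x - V j y) <= e) ->
  exists j, forall z, box M0 z -> cabs (V j z) <= 4^-1.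
Proof.
move=> ell en cV hR hg hL hq.
have [U [UU Uoo]] := @ultraFilterLemma nat (\oo) _.
have PU : ProperFilter U by exact: ultra_proper.
have UI A A' : U A -> U A' -> U (A `&` A') by move=> UA UA'; exact: filterI.
have near_U (P : set nat) : (\forall j \near \oo, P j) -> U P by move=> H; exact: Uoo.
have /choice[l Hl] : forall zb : pt * bool, exists l, forall e, 0 < e ->
    U [set j | `|part zb.2 (V j zb.1) - l| <= e].
  move=> [z b]; apply: (@ultra_limit _ _ (sdist s 0 z `^ eta)) => //=.
  apply: near_U; apply: filterS (hR (sdist s 0 z + 1)) => j /= h.
  by apply: le_trans (part_cabs _ _) _; apply: hg; lra.
have [v Hv] : exists v : pt -> R[i], forall z e, 0 < e -> U [set j | cabs (V j z - v z) <= e].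
  exists (fun z => Complex (l (z, false)) (l (z, true))) => z e e0.
  pose v z : R[i] := Complex (l (z, false)) (l (z, true)). have e2 : 0 < e / 2 by lra.
  apply: filterS (UI _ _ (Hl (z, false) _ e2) (Hl (z, true) _ e2)) => j /= [h1 h2].
  rewrite -/(v z); have -> : e = e / 2 + e / 2 by lra.
  by apply: cabs_part => -[]; rewrite partB.
have vq (x : pt) e : 0 < e -> exists2 r : R, 0 < r & forall y : pt,
     (forall i, `|x ord0 i - y ord0 i| < r) -> cabs (v x - v y) <= e.
  move=> e0; have e3 : 0 < e / 3 by lra.
  have [r r0 Hr] := hq x _ e3; exists r => // y xy.
  have /filter_ex[j [/= [h1 h2] h3]] := UI _ _ (UI _ _ (Hv x _ e3) (Hv y _ e3)) (near_U _ Hr).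
  have := cabs_dist_trans (v x) (V j x) (v y); have := cabs_dist_trans (V j x) (V j y) (v y).
  have := h3 y xy; rewrite (cabs_distC (v x) (V j x)); lra.
(* Pointwise limits become uniform on the cube: each point has a neighbourhood to which
   equicontinuity transfers its estimate, and compactness merges these neighbourhoods into one set
   of [U]. *)
have unif M e : 0 < e -> U [set j | forall z, box M z -> cabs (V j z - v z) <= e].
  move=> e0; have e3 : 0 < e / 3 by lra.
  have /compact_near_coveringP cov := @compact_box R d M.
  apply: (cov nat U (fun j z => cabs (V j z - v z) <= e)) => x _.
  have [r r0 Hr] := hq x _ e3; have [r' r'0 Hr'] := vq x _ e3.
  have rr : 0 < Num.min r r' by rewrite lt_min r0.
  have rmin1 : Num.min r r' <= r by rewrite ge_min lexx.
  have rmin2 : Num.min r r' <= r' by rewrite ge_min lexx orbT.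
  exists (ball x (Num.min r r'), [set j | cabs (V j x - v x) <= e / 3] `&`
     [set j | forall y : pt, (forall i, `|x ord0 i - y ord0 i| < r) -> cabs (V j x - V j y) <= e / 3]).
    split=> /=; first exact: nbhsx_ballx.
    by apply: filterI; [exact: Hv|exact: near_U].
  move=> [y j] /= [/(rV_ballP _ _ rr) xy [h1 h2]].
  have h3 := h2 y (fun i => lt_le_trans (xy i) rmin1).
  have h4 := Hr' y (fun i => lt_le_trans (xy i) rmin2).
  have := cabs_dist_trans (V j y) (V j x) (v y); have := cabs_dist_trans (V j x) (v x) (v y).
  rewrite (cabs_distC (V j y) (V j x)); lra.
have cv : contC v.
  have cb b : continuous (fun y => part b (v y)).
    apply: unif_limit_continuous => M e e0; have /filter_ex[j /= Hj] := unif M e e0.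
    exists (fun y => part b (V j y)); split.
      by case: (b); [exact: (cV j).2|exact: (cV j).1].
    by move=> y bY; rewrite -partB; apply: le_trans (part_cabs _ _) _; exact: Hj.
  by split; [exact: (cb false)|exact: (cb true)].
have sv : solution s a v.
  move=> M phi M1 tp; apply: (Ldist_limit M1 tp cv) => e e0.
  have /filter_ex[j [/= h1 h2]] := UI _ _ (unif M e e0) (near_U _ (hL M phi M1 tp e e0)).
  exists (V j); split=> // y bY; rewrite cabs_distC; exact: h1.
have gv z : cabs (v z) <= sdist s 0 z `^ eta.
  apply/ler_addgt0Pr => e e0.
  have /filter_ex[j [/= h1 h2]] := UI _ _ (Hv z _ e0) (near_U _ (hR (sdist s 0 z + 1))).
  have h3 : cabs (V j z) <= sdist s 0 z `^ eta by apply: hg; lra.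
  have := cabs_dist_trans (v z) (V j z) 0; rewrite !subr0 (cabs_distC (v z) (V j z)); lra.
(* The limit is 0, and any positive threshold could follow; 1/4 is chosen to contradict the lower
   bound 1/2 at the normalised point. *)
have v0 := liouville s0 eta0 cv sv gv ell en.
have q0 : 0 < (4^-1 : R) by lra.
have /filter_ex[j /= Hj] := unif M0 _ q0.
by exists j => z /Hj; rewrite v0 subr0.
Qed.

Lemma powR_le (b x y : R) : 0 <= b -> 0 <= x -> x <= y -> x `^ b <= y `^ b.
Proof.
by move=> b0 x0 xy; apply: ge0_ler_powR => //; rewrite nnegrE//; exact: le_trans xy.
Qed.

Lemma sdist_eq0 (x y : pt) : sdist s x y = 0 -> x = y.
Proof.
move=> /eqP; rewrite psumr_eq0; last by move=> j _; exact: powR_ge0.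
move=> /allP H; apply/rowP => i; have := H i (mem_index_enum _).
by rewrite powR_eq0 normr_eq0 subr_eq0 => /andP[/eqP].
Qed.

(** Since e' <= 1 and the exponent [\sum_i s i] is at least each [s i], every coordinate contributes
    at most e'. Dividing by [d.+1] keeps the quotient meaningful for [d = 0]. *)
Lemma sdist_small e : 0 < e -> exists2 r, 0 < r & forall x y : pt,
  (forall i, `|x ord0 i - y ord0 i| < r) -> sdist s x y <= e.
Proof.
move=> e0; pose e' := Num.min (e / d.+1%:R) 1.
have e'0 : 0 < e' by rewrite lt_min ltr01 andbT divr_gt0// ltr0n.
have e'1 : e' <= 1 by rewrite ge_min lexx orbT.
exists (e' ^+ (\sum_i s i)%N); first exact: exprn_gt0.
move=> x y xy; apply: (@le_trans _ _ (\sum_(i < d) e')).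
  apply: ler_sum => i _.
  rewrite -[leRHS](@powR_expn_root _ _ s s0 e' i (ltW e'0)).
  apply: ge0_ler_powR; rewrite ?nnegrE ?invr_ge0 ?exprn_ge0 ?(ltW e'0)//.
  apply: le_trans (ltW (xy i)) _; apply: ler_wiXn2l; rewrite ?(ltW e'0)//.
  by rewrite (bigD1 i)//= leq_addr.
rewrite sumr_const card_ord -mulr_natr.
have : e' <= e / d.+1%:R by rewrite ge_min lexx.
rewrite ler_pdivlMr ?ltr0n// => h; apply: le_trans h.
by apply: ler_wpM2l; rewrite ?(ltW e'0)// ler_nat.
Qed.

(** All that is kept of the unknown polynomial: a degree bound along every line, which survives
    dilations and scaling whatever happens to the coefficients. *)
Definition line_poly n (Q : pt -> R[i]) := forall x b (c : bool),
  exists p : {poly R}, (size p <= n)%N /\ forall t, part c (Q (x + t *: b)) = p.[t].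

(** Nodes moved into [1/2, 1): the polynomial will be bounded only at positive parameters, because
    the seminorms skip coinciding points. *)
Definition node_shift (n k : nat) : R := 2^-1 + 2^-1 * node n k.

Lemma node_shift01 n (k : 'I_n) : 0 < node_shift n k <= 1.
Proof. have := @node_ge0 R n k; have := @node_le1 R n k; rewrite /node_shift; lra. Qed.

Lemma continuous_sumR (I : Type) (r : seq I) (f : I -> R -> R) :
  (forall i, continuous (f i)) -> continuous (fun t => \sum_(i <- r) f i t).
Proof.
move=> cf; elim: r => [|i r IH].
  have -> : (fun t => \sum_(i <- [::]) f i t) = (fun=> 0).
    by apply/funext => t; rewrite big_nil.
  exact: cst_continuous.
have -> : (fun t => \sum_(j <- i :: r) f j t) = (fun t => f i t + \sum_(j <- r) f j t).
  by apply/funext => t; rewrite big_cons.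
by move=> t; apply: continuousD; [exact: cf|exact: IH].
Qed.

(** In the Lagrange basis at the shifted nodes the coefficients of [p] are its values there, at most
    [B] in modulus; so near 0 the modulus of continuity is that of finitely many basis polynomials,
    uniformly in [p]. The argument [2 * t - 1] undoes the shift of the nodes. *)
Lemma poly_modulus n (e : R) : (0 < n)%N -> 0 < e -> exists2 r, 0 < r & forall (p : {poly R}) (B t t' : R),
  (size p <= n)%N -> (forall u : R, 0 < u <= 1 -> `|p.[u]| <= B) -> 0 <= t < r -> 0 <= t' < r ->
  `|p.[t] - p.[t']| <= e * B.
Proof.
move=> n0 e0.
pose g (j : 'I_n) (t : R) := (lag j).[2 * t - 1].
pose w t := \sum_(j < n) `|g j t - g j 0|.
have cw : continuous w.
  have cg j : continuous (fun t => `|g j t - g j 0|).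
    move=> t; have c1 : {for t, continuous (fun t : R => 2 * t - 1)}.
      by apply: cvgB; [apply: cvgMr; exact: cvg_id|exact: cvg_cst].
    have c2 : {for t, continuous (fun t => g j t - g j 0)}.
      apply: cvgB; last exact: cvg_cst.
      exact: continuous_comp c1 (@continuous_horner _ (lag j) _).
    exact: continuous_comp c2 (@norm_continuous _ R^o _).
  exact: continuous_sumR.
have w0 : w 0 = 0 by rewrite /w big1// => j _; rewrite subrr normr0.
have e2 : 0 < e / 2 by lra.
have /cvgrPdist_lt/(_ _ e2)/nbhs_ballP[r /= r0 Hr] := cw 0.
have wt t : 0 <= t < r -> w t < e / 2.
  move=> /andP[t0 tr]; have := Hr t; rewrite /ball/= w0 !sub0r !normrN ger0_norm// => /(_ tr).
  by rewrite ger0_norm// sumr_ge0.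
exists r => // p B t t' sp pB tr t'r.
have B0 : 0 <= B by apply: le_trans (pB 1 _); rewrite ?ltr01 ?lexx.
pose q := p \Po (2^-1%:P + 2^-1 *: 'X).
have s2 : size (2^-1%:P + 2^-1 *: 'X : {poly R}) = 2%N.
  by rewrite addrC -mul_polyC size_MXaddC polyC_eq0 invr_eq0 pnatr_eq0 /= size_polyC invr_eq0 pnatr_eq0.
have sq : (size q <= n)%N by rewrite size_comp_poly2.
have pq (u : R) : p.[u] = q.[2 * u - 1].
  by rewrite horner_comp hornerD hornerC hornerZ hornerX; congr p.[_]; field.
have qn (j : 'I_n) : `|q.[node n j]| <= B.
  rewrite horner_comp hornerD hornerC hornerZ hornerX.
  exact: (pB (node_shift n j) (node_shift01 j)).
rewrite !pq !(lag_horner _ n0 sq) -sumrB.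
apply: (@le_trans _ _ ((w t + w t') * B)); last first.
  by apply: ler_wpM2r => //; have := wt _ tr; have := wt _ t'r; lra.
rewrite /w -big_split mulr_suml /=; apply: le_trans (ler_norm_sum _ _ _) _.
apply: ler_sum => j _; rewrite -mulrBl normrM; apply: ler_pM => //.
have := ler_normB (g j t - g j 0) (g j t' - g j 0).
by rewrite opprB addrA subrK.
Qed.

(* Near x, the function V differs from a polynomial Q of bounded degree by o(1);
   Q is bounded on a neighbourhood of x of fixed size since V is, and a polynomial
   of bounded degree which is bounded there has a controlled modulus of continuity. *)
Lemma equicontinuity n alpha (x : pt) (e : R) : (0 < n)%N -> 0 < alpha -> alpha < eta -> 0 < e ->
  exists r N, 0 < r /\ forall (V : pt -> R[i]) (Rad : R), N <= Rad -> contC V ->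
    (forall z, sdist s 0 z < Rad -> cabs (V z) <= sdist s 0 z `^ eta) ->
    (forall y, 0 < sdist s 0 y < Rad -> exists W Q, line_poly n Q /\
       forall z, 0 < sdist s y z < Rad -> cabs (W z) <= sdist s y z `^ eta /\
         cabs (V z - W z - Q z) <=
           sdist s y z `^ alpha * (sdist s 0 y + sdist s y z) `^ (eta - alpha)) ->
    forall y : pt, (forall i, `|x ord0 i - y ord0 i| < r) -> cabs (V x - V y) <= e.
Proof.
move=> n0 al0 al e0.
have powR_small b (c : R) : 0 < b -> 0 < c -> (c `^ b^-1) `^ b = c.
  by move=> b0 c0; apply: powR_onto => //; rewrite gt_eqF.
(* [K] bounds both the distance from 0 and the distance from [x] on the unit cube around [x]. *)
pose K := \sum_i (`|x ord0 i| + 1) `^ ((s i)%:R^-1) + d%:R + 1.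
have K0 : 0 <= \sum_i (`|x ord0 i| + 1) `^ ((s i)%:R^-1).
  by apply: sumr_ge0 => i _; exact: powR_ge0.
have K1 : 1 <= K by rewrite /K; have := ler0n R d; lra.
have sK (z : pt) : (forall i, `|x ord0 i - z ord0 i| <= 1) -> sdist s 0 z <= K.
  move=> xz; apply: (@le_trans _ _ (\sum_i (`|x ord0 i| + 1) `^ ((s i)%:R^-1))); last first.
    by rewrite /K; have := ler0n R d; lra.
  apply: ler_sum => i _; apply: ge0_ler_powR; rewrite ?nnegrE ?invr_ge0 ?addr_ge0//.
  rewrite mxE sub0r normrN; have := xz i.
  by have := ler_normB (x ord0 i) (x ord0 i - z ord0 i); rewrite opprB addrCA subrr addr0; lra.
have sd (z : pt) : (forall i, `|x ord0 i - z ord0 i| <= 1) -> sdist s x z <= K.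
  move=> xz; apply: (@le_trans _ _ (\sum_(i < d) 1)); last first.
    by rewrite sumr_const card_ord /K; lra.
  apply: ler_sum => i _; apply: (@le_trans _ _ (1 `^ ((s i)%:R^-1))); last by rewrite powR1.
  by apply: ge0_ler_powR; rewrite ?nnegrE ?invr_ge0.
have ea : 0 < eta - alpha by lra.
pose D := (K + K) `^ (eta - alpha).
have D0 : 0 < D by apply: powR_gt0; lra.
pose B := K `^ eta + K `^ eta + K `^ alpha * D.
have B0 : 0 < B.
  have h1 : 0 < K `^ eta by apply: powR_gt0; lra.
  have h2 : 0 <= K `^ alpha * D by rewrite mulr_ge0 ?powR_ge0// ltW.
  by rewrite /B; lra.
(* Distances up to [t1] and [t2] make the two error terms, d^eta and d^alpha D, at most e / 16
   each. *)
pose t1 := (e / 16) `^ (eta^-1); pose t2 := (e / 16 / D) `^ (alpha^-1).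
have e16 : 0 < e / 16 by lra.
have e16D : 0 < e / 16 / D by rewrite divr_gt0.
have t10 : 0 < t1 by exact: powR_gt0.
have t20 : 0 < t2 by exact: powR_gt0.
have tt0 : 0 < Num.min t1 t2 by rewrite lt_min t10.
have [r1 r10 Hr1] := sdist_small tt0.
have eB : 0 < e / 16 / B by rewrite divr_gt0.
have [r2 r20 Hr2] := poly_modulus n0 eB.
pose r := Num.min (Num.min r1 r2) 1.
have r0 : 0 < r by rewrite !lt_min r10 r20 ltr01.
have rr1 : r <= r1 by rewrite /r !ge_min lexx.
have rr2 : r <= r2 by rewrite /r !ge_min lexx orbT.
have rle1 : r <= 1 by rewrite /r !ge_min lexx !orbT.
clearbody r; exists r, (K + 1); split=> // V Rad RadN cV gV hV y xy.
have near_small (z : pt) : (forall i, `|x ord0 i - z ord0 i| < r) ->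
    sdist s x z `^ eta <= e / 16 /\ sdist s x z `^ alpha * D <= e / 16.
  move=> xz; have := Hr1 x z (fun i => lt_le_trans (xz i) rr1).
  rewrite le_min => /andP[h1 h2]; split.
    rewrite -[leRHS](powR_small eta)//.
    by apply: powR_le => //; [exact: ltW|exact: sdist_ge0].
  rewrite -ler_pdivlMr// -[leRHS](powR_small alpha)//.
  by apply: powR_le => //; [exact: ltW|exact: sdist_ge0].
(* The comparison with a germ member at [x] is available only away from the origin; at the origin
   the growth bound alone is enough. *)
have [sx|sx] := eqVneq (sdist s 0 x) 0.
  have x0 : x = 0 by rewrite (sdist_eq0 sx).
  have h1 : cabs (V x) <= 0.
    have := gV x; rewrite sx powR0 ?gt_eqF//; apply; lra.
  have [h2 _] := near_small y xy.
  have h3 : cabs (V y) <= sdist s 0 y `^ eta.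
    apply: gV; have := sK y (fun i => le_trans (ltW (xy i)) rle1); lra.
  rewrite -x0 in h3; have := cabsB (V x) (V y); lra.
have sx0 : 0 < sdist s 0 x by rewrite lt_def sx sdist_ge0.
have x1 i : `|x ord0 i - x ord0 i| <= 1 by rewrite subrr normr0.
have [|W [Q [lQ HWQ]]] := hV x; first by rewrite sx0 /=; have := sK x x1; lra.
have [->|yx] := eqVneq y x; first by rewrite subrr cabs0 ltW.
pose t := `|y - x|.
have t0 : 0 < t by rewrite normr_gt0 subr_eq0.
pose b : pt := t^-1 *: (y - x).
have yE : y = x + t *: b by rewrite /b scalerA divff ?gt_eqF// scale1r addrC subrK.
have b1 i : `|b ord0 i| <= 1.
  rewrite mxE normrM normfV (gtr0_norm t0) ler_pdivrMl// mulr1.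
  exact: rV_coord_le_norm.
clearbody b.
have tr : t < r.
  rewrite /t; have [i ->] : exists i, `|y - x| = `|(y - x) ord0 i|.
    have : mx_norm (y - x) != 0 by rewrite -[mx_norm _]/(`|y - x|) gt_eqF.
    move=> /mx_norm_neq0[[i0 i] /= E]; exists i.
    by rewrite -[LHS]/(mx_norm (y - x)) E (ord1 i0).
  by rewrite !mxE distrC; exact: xy.
pose z (u : R) := x + u *: b.
have zx (u : R) i : x ord0 i - z u ord0 i = - (u * b ord0 i) by rewrite /z !mxE opprD addNKr.
have zd (u : R) i : 0 <= u -> `|x ord0 i - z u ord0 i| <= u.
  move=> u0; rewrite zx normrN normrM ger0_norm//.
  by rewrite -[leRHS]mulr1 ler_wpM2l.
have z_pos (u : R) : 0 < u -> 0 < sdist s x (z u).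
  move=> u0; rewrite lt_def sdist_ge0 andbT; apply/eqP => /sdist_eq0 xz.
  have ub : u *: b = 0 by apply: (addrI x); rewrite addr0 -[LHS]/(z u) -xz.
  have b0 : b = 0 by apply/eqP; move/eqP: ub; rewrite scaler_eq0 (gt_eqF u0).
  by move: yx; rewrite yE b0 scaler0 addr0 eqxx.
have z_dom (u : R) : 0 < u <= 1 -> 0 < sdist s x (z u) < Rad.
  move=> /andP[u0 u1]; rewrite z_pos//=.
  have := sd (z u) (fun i => le_trans (zd u i (ltW u0)) u1); lra.
have err (u : R) : 0 < u <= 1 -> cabs (V (z u) - W (z u) - Q (z u)) <= sdist s x (z u) `^ alpha * D.
  move=> u01; have [_ h] := HWQ (z u) (z_dom u u01).
  apply: le_trans h _; apply: ler_wpM2l; first exact: powR_ge0.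
  have /andP[u0 u1] := u01.
  have := sd (z u) (fun i => le_trans (zd u i (ltW u0)) u1); have := sK x x1 => h1 h2.
  by apply: powR_le; [exact: ltW|rewrite addr_ge0 ?sdist_ge0|exact: lerD].
have QB c (u : R) : 0 < u <= 1 -> `|part c (Q (z u))| <= B.
  move=> u01; have [h1 _] := HWQ (z u) (z_dom u u01); have h2 := err u u01.
  have /andP[u0 u1] := u01; have xz1 i := le_trans (zd u i (ltW u0)) u1.
  have h3 : cabs (V (z u)) <= K `^ eta.
    apply: le_trans (gV (z u) _) _; first by have := sK (z u) xz1; lra.
    by apply: powR_le; [exact: ltW|exact: sdist_ge0|exact: sK].
  have h4 : sdist s x (z u) `^ eta <= K `^ eta.
    by apply: powR_le; [exact: ltW|exact: sdist_ge0|exact: sd].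
  have h5 : sdist s x (z u) `^ alpha * D <= K `^ alpha * D.
    apply: ler_wpM2r; first exact: ltW.
    by apply: powR_le; [exact: ltW|exact: sdist_ge0|exact: sd].
  apply: le_trans (part_cabs c _) _; rewrite /B.
  have := cabs_dist_trans (Q (z u)) (V (z u) - W (z u)) 0; rewrite !subr0 cabs_distC.
  have := cabsB (V (z u)) (W (z u)); lra.
have Qmod (u u' : R) : 0 < u < r -> 0 < u' < r -> cabs (Q (z u) - Q (z u')) <= e / 16 + e / 16.
  move=> /andP[u0 ur] /andP[u'0 u'r]; apply: cabs_part => c; rewrite partB.
  have [p [sp Hp]] := lQ x b c; rewrite /z !Hp.
  have -> : e / 16 = e / 16 / B * B by field; rewrite gt_eqF.
  apply: Hr2 => //; first by move=> w w01; rewrite -Hp; exact: QB.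
  - by rewrite (ltW u0) (lt_le_trans ur).
  - by rewrite (ltW u'0) (lt_le_trans u'r).
have VW (u : R) : 0 < u < r -> cabs (V (z u) - Q (z u)) <= e / 16 + e / 16.
  move=> /andP[u0 ur]; have u01 : 0 < u <= 1 by rewrite u0 (ltW (lt_le_trans ur rle1)).
  have [h1 h2] := near_small (z u) (fun i => le_lt_trans (zd u i (ltW u0)) ur).
  have [h3 _] := HWQ (z u) (z_dom u u01); have h4 := err u u01.
  have -> : V (z u) - Q (z u) = (V (z u) - W (z u) - Q (z u)) + W (z u) by ring.
  have := cabsD (V (z u) - W (z u) - Q (z u)) (W (z u)); lra.
have Vdiff (u u' : R) : 0 < u < r -> 0 < u' < r -> cabs (V (z u) - V (z u')) <= 6 * (e / 16).
  move=> h h'; have := Qmod u u' h h'; have := VW u h; have := VW u' h'.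
  have := cabs_dist_trans (V (z u)) (Q (z u)) (V (z u')).
  have := cabs_dist_trans (Q (z u)) (Q (z u')) (V (z u')).
  rewrite (cabs_distC (Q (z u')) (V (z u'))); lra.
(* At [x] itself neither the error bound nor the bound on [Q] is available; continuity of [V]
   replaces [x] by a nearby [z u] at a cost of e / 8. Here [u] may depend on [V], while [r] does
   not. *)
have [k1 k10 Hk1] := (rV_continuous_atP _ x).1 (cV.1 x) _ e16.
have [k2 k20 Hk2] := (rV_continuous_atP _ x).1 (cV.2 x) _ e16.
pose u := Num.min (Num.min k1 k2) r / 2.
have m0 : 0 < Num.min (Num.min k1 k2) r by rewrite !lt_min k10 k20 r0.
have u0 : 0 < u by rewrite divr_gt0.
have ur : u < Num.min (Num.min k1 k2) r by rewrite /u ltr_pdivrMr// ltr_pMr// ltr1n.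
clearbody u.
move: ur; rewrite !lt_min => /andP[/andP[uk1 uk2] ur].
have h1 : cabs (V x - V (z u)) <= e / 16 + e / 16.
  apply: cabs_part => c; rewrite partB; apply: ltW; case: c.
    by apply: Hk2 => i; exact: le_lt_trans (zd u i (ltW u0)) uk2.
  by apply: Hk1 => i; exact: le_lt_trans (zd u i (ltW u0)) uk1.
have h2 : cabs (V (z u) - V y) <= 6 * (e / 16).
  by rewrite yE; apply: Vdiff; rewrite ?u0 ?t0.
have := cabs_dist_trans (V x) (V (z u)) (V y); lra.
Qed.

Lemma size_prod_bound (I : Type) (r : seq I) (F : I -> {poly R}) k :
  (forall i, (size (F i) <= k.+1)%N) -> (size (\prod_(i <- r) F i)%R <= (k * size r).+1)%N.
Proof.
move=> HF; elim: r => [|i r IH]; first by rewrite big_nil size_poly1.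
rewrite big_cons; apply: leq_trans (size_polyMleq _ _) _.
by have := HF i; move: IH; rewrite /= mulnS; lia.
Qed.

Lemma partM_real b (z : R[i]) (r : R) : part b (z * Complex r 0) = part b z * r.
Proof. by rewrite mulrC part_scale mulrC. Qed.

Lemma part_sum b (I : Type) (r : seq I) (P : pred I) (F : I -> R[i]) :
  part b (\sum_(i <- r | P i) F i) = \sum_(i <- r | P i) part b (F i).
Proof.
apply: (big_morph (part b)) => [z w|]; last by case: b.
by case: b; rewrite /= ?creD ?cimD.
Qed.

Lemma line_poly_polyval k (c : {ffun 'I_d -> 'I_k.+1} -> R[i]) :
  line_poly (k * d).+1 (polyval s c).
Proof.
move=> x h b.
pose L i : {poly R} := (x ord0 i)%:P + h ord0 i *: 'X.
have sL i : (size (L i) <= 2)%N.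
  rewrite /L addrC -mul_polyC size_MXaddC; case: ifP => // _.
  by rewrite size_polyC; case: (_ == 0).
pose P (g : {ffun 'I_d -> 'I_k.+1}) := \prod_i L i ^+ g i.
exists (\sum_(g : {ffun 'I_d -> 'I_k.+1} | (aweight s (fun i => g i) <= k)%N) part b (c g) *: P g).
split=> [|t].
  apply: (leq_trans (size_sum _ _ _)); apply/bigmax_leqP => g _.
  apply: leq_trans (size_scale_leq _ _) _; rewrite /P.
  have -> : (\prod_i L i ^+ g i)%R = (\prod_(i <- enum 'I_d) L i ^+ g i)%R by rewrite big_enum.
  rewrite -[X in (k * X)%N](size_enum_ord d); apply: size_prod_bound.
  move=> i; apply: leq_trans (size_poly_exp_leq _ _) _; rewrite ltnS.
  have := sL i; have := ltn_ord (g i); case: (size (L i)) => [|[|[|?]]]//= ; lia.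
rewrite part_sum horner_sum; apply: eq_bigr => g _.
rewrite partM_real hornerZ; congr (_ * _).
rewrite horner_prod; apply: eq_bigr => i _.
by rewrite horner_exp hornerD hornerC hornerZ hornerX !mxE mulrC.
Qed.

Lemma line_poly_dil n Q lam (x0 : pt) (c : R) : line_poly n Q ->
  line_poly n (fun z => Complex c 0 * Q (dil s lam x0 z)).
Proof.
move=> lQ x b k.
have [p [sp Hp]] := lQ (dil s lam x0 x) (\row_i (lam ^+ s i * b ord0 i)) k.
exists (c *: p); split; first exact: leq_trans (size_scale_leq _ _) sp.
move=> t; rewrite part_scale hornerZ -Hp; congr (_ * part k (Q _)).
by apply/rowP => i; rewrite !mxE; ring.
Qed.

(** [negnorm] tests only with functions from [Bset]. Dilation by [N] shrinks the support of [phi]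
    into the unit ball and division by [Z] normalises the derivatives, so [phi] at scale [r] is a
    multiple of an admissible function at scale [r * N], with [N] and [A] independent of [r]. *)
Lemma Bset_rescale k M phi : 0 <= M -> test_box M phi -> exists psi N A,
  [/\ Bset s k psi, (exists2 M', 0 <= M' & test_box M' psi), 1 <= N, 0 <= A &
   forall r x, 0 < r -> resc s phi r x = (fun y => A * resc s psi (r * N) x y)].
Proof.
move=> M0 tp.
pose N : R := \sum_i M `^ ((s i)%:R^-1) + 1.
have N1 : 1 <= N by rewrite /N lerDr sumr_ge0// => i _; exact: powR_ge0.
have N0 : 0 < N by lra.
have /choice[Bd HB] : forall g : {ffun 'I_d -> 'I_k.+1}, exists B, 0 <= B /\
    forall y, `|dpow (fun i => g i) phi y| <= B.
  move=> g; have [Cp p0] := test_box_dpow (fun i => g i) tp.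
  by have [B ? ?] := off_box_bounded (Ck_continuous (Cp 0%N)) p0; exists B.
(* Differentiating the dilated function produces the power of [N] in [E g]. A weight at most [k]
   forces entries at most [k], so finitely many [g] occur and [Z] majorises them all. *)
pose E g := \prod_i (N ^+ s i) ^+ (nat_of_ord ((g : {ffun 'I_d -> 'I_k.+1}) i)) * Bd g.
have E0 g : 0 <= E g.
  rewrite mulr_ge0 ?(HB g).1//; apply: prodr_ge0 => i _.
  by rewrite !exprn_ge0// ltW.
pose Z := \sum_g E g + 1.
have Z0 : 0 < Z by rewrite ltr_wpDl// sumr_ge0.
have c0 i : 0 < N ^+ s i by rewrite exprn_gt0.
pose psi y := Z^-1 * phi (aff (fun i => N ^+ s i) 0 y).
have Cpsi n : Ck n psi by apply: Ck_mul; [exact: Ck_cst|apply: Ck_aff; exact: tp.1].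
have [M' M'0 HM'] := off_box_aff 0 M0 c0 tp.2.
exists psi, N, (N ^+ (\sum_i s i)%N * Z); split=> //.
- split.
  + exact/Ck_smooth.
  + move=> y sy /=.
    have yb i : `|y ord0 i| <= M / N ^+ s i.
      have : closed [set y : pt | `|y ord0 i| <= M / N ^+ s i].
        have cc : continuous (fun y : pt => `|y ord0 i|).
          move=> w; apply: (@continuous_comp _ _ _ (fun y : pt => y ord0 i) (fun t : R => `|t|)).
            exact: coord_continuous.
          exact: (@norm_continuous _ R^o).
        by apply: (@closed_comp _ _ (fun y : pt => `|y ord0 i|) [set t | t <= M / N ^+ s i]);
          [move=> w _; exact: cc|exact: closed_le].
      move=> cl; move: sy; rewrite /supp closureE => /(_ [set y : pt | `|y ord0 i| <= M / N ^+ s i]) sy.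
      apply: sy; split=> // w /= pw.
      rewrite ler_pdivlMr// mulrC -[X in X * _](gtr0_norm (c0 i)) -normrM.
      have bw : box M (aff (fun i => N ^+ s i) 0 w).
        apply: contrapT => /tp.2 pw0; move: pw.
        by rewrite /psi pw0 mulr0 eqxx.
      by have := bw i; rewrite !mxE subr0.
    apply: (@le_lt_trans _ _ (\sum_i M `^ ((s i)%:R^-1) / N)).
      apply: ler_sum => i _; rewrite mxE sub0r normrN ler_pdivlMr//.
      rewrite -[X in _ * X <= _](@powR_expn_root _ _ s s0 N i (ltW N0)) -powRM ?exprn_ge0 ?(ltW N0)//.
      apply: ge0_ler_powR; rewrite ?nnegrE ?invr_ge0 ?mulr_ge0 ?(ltW (c0 i))//.
      by rewrite -ler_pdivlMr.
    by rewrite -mulr_suml ltr_pdivrMr// mul1r /N ltrDl.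
  + move=> b bk y; rewrite dpowE iter_partials_scale_aff; last exact: tp.1.
    rewrite -dpowE prod_dseq.
    have bi i : (b i < k.+1)%N.
      rewrite ltnS; apply: leq_trans bk; rewrite /aweight (bigD1 i)//=.
      by apply: leq_trans (leq_addr _ _); rewrite leq_pmull.
    pose g : {ffun 'I_d -> 'I_k.+1} := [ffun i => Ordinal (bi i)].
    have gb : b = (fun i => g i : nat) by apply/funext => i; rewrite ffunE.
    rewrite gb; set w := aff _ _ _.
    have pr0 : 0 <= \prod_i (N ^+ s i) ^+ g i.
      by apply: prodr_ge0 => i _; rewrite !exprn_ge0// ltW.
    rewrite !normrM (gtr0_norm (_ : 0 < Z^-1)) ?invr_gt0// (ger0_norm pr0) -mulrA.
    rewrite ler_pdivrMl// mulr1; apply: (@le_trans _ _ (E g)).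
      by apply: ler_wpM2l => //; exact: (HB g).2.
    by rewrite /Z (bigD1 g)//= -addrA lerDl addr_ge0// sumr_ge0.
- by exists M' => //; split=> // y yM; rewrite /psi HM'// mulr0.
- by rewrite mulr_ge0 ?exprn_ge0// ltW.
move=> r x r0; rewrite !rescE; apply/funext => y; rewrite /psi.
have -> : aff (fun i => N ^+ s i) 0 (aff (fun i => (r * N) ^- s i) x y) =
          aff (fun i => r ^- s i) x y.
  apply/rowP => i; rewrite !mxE subr0 exprMn invfM mulrCA !mulrA.
  by rewrite divfK ?gt_eqF.
rewrite exprMn; field.
by rewrite !gt_eqF// ?exprn_gt0.
Qed.

End Compactness.

(** * Rescaling a failing germ at a nearly extremal pair *)

Section BlowUp.
Context {R : realType} {d : nat} (s : 'I_d -> nat) (m : nat)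
  (a : {ffun 'I_d -> 'I_m.+1} -> R[i]) (alpha eta : R).
Local Notation pt := 'rV[R]_d.
Implicit Types (V : pt -> R[i]) (phi psi : pt -> R).
Hypothesis s0 : forall i, (0 < s i)%N.
Hypothesis eta0 : 0 < eta.

(** An infinite term would make the right-hand side infinite and the inequality true, so its failure
    makes all three terms finite. *)
Lemma ge0_ereal_split (N H S : \bar R) (P C : R) :
  (0 <= N)%E -> (0 <= H)%E -> (0 <= S)%E -> 0 < C ->
  ~ (P%:E <= C%:E * (N + H + S))%E ->
  exists n h t : R, [/\ N = n%:E, H = h%:E, S = t%:E, [/\ 0 <= n, 0 <= h & 0 <= t] &
    C * (n + h + t) < P].
Proof.
move=> N0 H0 S0 C0 nle.
have T : (N + H + S < +oo)%E.
  rewrite ltNge leye_eq; apply/negP => /eqP E; apply: nle.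
  by rewrite E gt0_muley ?lte_fin// leey.
have NH : (N + H < +oo)%E by apply: le_lt_trans T; exact: leeDl.
have Nf : N \is a fin_num by rewrite ge0_fin_numE//; apply: le_lt_trans NH; exact: leeDl.
have Hf : H \is a fin_num by rewrite ge0_fin_numE//; apply: le_lt_trans NH; exact: leeDr.
have Sf : S \is a fin_num.
  by rewrite ge0_fin_numE//; apply: le_lt_trans T; apply: leeDr; exact: adde_ge0.
exists (fine N), (fine H), (fine S); rewrite !fineK//; split=> //.
  by split; exact: fine_ge0.
rewrite ltNge; apply/negP => h; apply: nle.
by rewrite -(fineK Nf) -(fineK Hf) -(fineK Sf) -!EFinD -EFinM lee_fin.
Qed.

Lemma sdist_dil lam (x y z : pt) : 0 < lam ->
  sdist s (dil s lam x y) (dil s lam x z) = lam * sdist s y z.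
Proof.
move=> l0; rewrite /sdist mulr_sumr; apply: eq_bigr => i _; rewrite !mxE.
rewrite (_ : _ - _ = lam ^+ s i * (y ord0 i - z ord0 i)); last by ring.
have h0 := exprn_ge0 (s i) (ltW l0).
by rewrite normrM (ger0_norm h0) powRM// powR_expn_root// ltW.
Qed.

Lemma dil_0 lam (x : pt) : dil s lam x 0 = x.
Proof. by apply/rowP => i; rewrite !mxE mulr0 addr0. Qed.

Lemma sdist_le1_box (e : pt) : sdist s 0 e <= 1 -> box 1 e.
Proof.
move=> e1 i.
have h : `|e ord0 i| `^ ((s i)%:R^-1) <= 1.
  apply: le_trans e1; rewrite /sdist (bigD1 i)//= mxE sub0r normrN lerDl.
  by apply: sumr_ge0 => j _; exact: powR_ge0.
have -> : `|e ord0 i| = (`|e ord0 i| `^ ((s i)%:R^-1)) ^+ s i.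
  rewrite -powR_mulrn ?powR_ge0// -powRrM mulVf ?powRr1//.
  by rewrite pnatr_eq0 -lt0n.
by apply: exprn_ile1; rewrite ?powR_ge0.
Qed.

(** The germ seminorm says nothing about coinciding points, so V(0) = 0 comes from continuity, along
    the curve with coordinates t^(s_i) e_i, on which the distance to 0 is t. *)
Lemma growth_at_0 V (e : pt) (Rad : R) : contC V -> sdist s 0 e = 1 -> 0 < Rad ->
  (forall z, 0 < sdist s 0 z < Rad -> cabs (V z) <= sdist s 0 z `^ eta) ->
  forall z, sdist s 0 z < Rad -> cabs (V z) <= sdist s 0 z `^ eta.
Proof.
move=> [c1 c2] e1 R0 H z zR.
have [z0|z0] := eqVneq (sdist s 0 z) 0; last by apply: H; rewrite lt_def z0 sdist_ge0.
have <- := sdist_eq0 z0; apply: le_trans (powR_ge0 _ _).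
apply/ler_addgt0Pr => q q0; rewrite add0r.
have q3 : 0 < q / 3 by lra.
have [k1 k10 Hk1] := (rV_continuous_atP _ 0).1 (c1 0) _ q3.
have [k2 k20 Hk2] := (rV_continuous_atP _ 0).1 (c2 0) _ q3.
pose t := Num.min (Num.min (Num.min k1 k2) (Num.min 1 ((q / 3) `^ (eta^-1)))) Rad / 2.
have [t0 tk1 tk2 t1 [tq tR]] : [/\ 0 < t, t < k1, t < k2, t < 1 & t < (q / 3) `^ (eta^-1) /\ t < Rad].
  have : 0 < Num.min (Num.min (Num.min k1 k2) (Num.min 1 ((q / 3) `^ (eta^-1)))) Rad.
    by rewrite !lt_min k10 k20 ltr01 powR_gt0.
  rewrite /t; set M := Num.min _ _ => M0.
  have : M / 2 < M by rewrite ltr_pdivrMr// ltr_pMr// ltr1n.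
  have : 0 < M / 2 by rewrite divr_gt0.
  by rewrite /M !lt_min => ? /andP[/andP[/andP[? ?] /andP[? ?]] ?].
clearbody t.
pose w : pt := \row_i (t ^+ s i * e ord0 i).
have wt : sdist s 0 w = t by rewrite /w sdist_dil0 ?e1 ?mulr1// ltW.
have wi i : `|(0 : pt) ord0 i - w ord0 i| <= t.
  rewrite !mxE sub0r normrN normrM (ger0_norm (exprn_ge0 _ (ltW t0))).
  have ei : `|e ord0 i| <= 1 by apply: sdist_le1_box; rewrite e1.
  apply: (@le_trans _ _ (t ^+ s i * 1)); first by rewrite ler_wpM2l// exprn_ge0// ltW.
  rewrite mulr1 -[leRHS]expr1; by apply: ler_wiXn2l; rewrite ?(ltW t0) ?(ltW t1)// s0.
have h1 := Hk1 w (fun i => le_lt_trans (wi i) tk1).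
have h2 := Hk2 w (fun i => le_lt_trans (wi i) tk2).
have h3 : cabs (V 0 - V w) <= q / 3 + q / 3.
  by apply: cabs_part => -[]; rewrite partB ltW.
have h4 : cabs (V w) <= q / 3.
  apply: le_trans (H w _) _; first by rewrite wt t0.
  rewrite wt -[leRHS](@powR_onto _ eta) ?gt_eqF//.
  by apply: powR_le; rewrite ?ltW.
have := cabs_dist_trans (V 0) (V w) 0; rewrite !subr0; lra.
Qed.

(** The infimum over polynomials need not be attained; the strict bound by [P] still provides one
    polynomial within [P]. *)
Lemma holnorm_poly (U : pt -> pt -> R[i]) (rho P : R) (x y : pt) :
  (holnorm s eta alpha U rho < P%:E)%E -> 0 < sdist s x y < rho ->
  exists c : {ffun 'I_d -> 'I_(Num.truncn eta).+1} -> R[i],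
    forall z, 0 < sdist s y z < rho ->
      cabs (U x z - U y z - polyval s c z) /
        (sdist s y z `^ alpha * (sdist s x y + sdist s y z) `^ (eta - alpha)) <= P.
Proof.
move=> hP xy.
have := le_lt_trans (ereal_sup_ubound (ex_intro _ x (ex_intro _ y (conj xy erefl)))) hP.
move=> /ereal_inf_lt[_ [c ->] ltc]; exists c => z yz; rewrite -lee_fin.
by apply: le_trans (ltW ltc); apply: ereal_sup_ubound; exists z.
Qed.

Lemma Ldist_scale_test M (T : pt -> R[i]) (A : R) psi : 0 <= M -> contC T -> test_box M psi ->
  Ldist s a (pairf T) (fun y => A * psi y) = Complex A 0 * Ldist s a (pairf T) psi.
Proof.
move=> M0 cT tp; rewrite /Ldist mulr_sumr; apply: eq_bigr => g _.
have [Cp p0] := test_box_dpow (fun i => g i) tp.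
have -> : dpow (fun i => g i) (fun y => A * psi y) = (fun y => A * dpow (fun i => g i) psi y).
  have E y : aff (fun=> 1) 0 y = y :> pt by apply/rowP => i; rewrite !mxE subr0 mul1r.
  have -> : (fun y => A * psi y) = (fun y => A * psi (aff (fun=> 1) 0 y)).
    by apply/funext => y; rewrite E.
  rewrite !dpowE iter_partials_scale_aff; last exact: tp.1.
  by apply/funext => y; rewrite E big1 ?mulr1.
by rewrite (pairfZr _ M0 cT (Ck_continuous (Cp 0%N)) p0) mulrCA.
Qed.

Local Notation kB := (absz (Num.ceil `|eta - m%:R|)).
Local Notation nQ := ((Num.truncn eta) * d).+1%N.

(** What survives of a germ violating the estimate with constant [C]: the bound 1/2 from
    near-extremality, the radius from the sup-norm term, the Holder comparison with constant 1, and
    smallness A / C from the negative norm, in the form delivered by [Bset_rescale]. *)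
Definition blowup (C : R) V (e : pt) (Rad : R) :=
  [/\ contC V, sdist s 0 e = 1 /\ 2^-1 <= cabs (V e), 0 < Rad /\ C / 2 <= Rad `^ eta,
    forall z, sdist s 0 z < Rad -> cabs (V z) <= sdist s 0 z `^ eta &
    (forall y, 0 < sdist s 0 y < Rad -> exists W Q, line_poly nQ Q /\
       forall z, 0 < sdist s y z < Rad -> cabs (W z) <= sdist s y z `^ eta /\
         cabs (V z - W z - Q z) <=
           sdist s y z `^ alpha * (sdist s 0 y + sdist s y z) `^ (eta - alpha)) /\
    (forall phi M psi N A, 0 <= M -> test_box M phi ->
       (exists2 M', 0 <= M' & test_box M' psi) -> Bset s kB psi -> 1 <= N -> 0 <= A ->
       (forall r x, 0 < r -> resc s phi r x = (fun y => A * resc s psi (r * N) x y)) ->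
       N < Rad -> cabs (Ldist s a (pairf V) phi) <= A / C)].

(** With P the seminorm and r the distance of a pair (x0, y0) exceeding half of it, V is U_(x0)
    composed with the dilation by r about x0 and divided by P r^eta. *)
Lemma blowup_exists (C rho : R) (U : pt -> pt -> R[i]) :
  eta < m%:R -> 1 <= C -> 0 < rho -> germ U -> (posnorm s eta U rho < +oo)%E ->
  ~ (posnorm s eta U rho <=
       C%:E * (negnorm s (eta - m%:R) (fun x => Ldist s a (pairf (U x))) rho
               + holnorm s eta alpha U rho
               + (rho `^ (- eta))%:E * supnorm s U rho))%E ->
  exists V e Rad, blowup C V e Rad.
Proof.
move=> em C1 rho0 gU Pfin nle; have C0 : 0 < C by lra.
have cU x : contC (U x) by have [] := gU x.
(* Without a pair at positive distance below [rho], as for [d = 0], the left-hand side is the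
   supremum of the empty set and the estimate cannot fail. *)
have [x1 [y1 xy1]] : exists x y : pt, 0 < sdist s x y < rho.
  apply: contrapT => /forallNP nx; apply: nle.
  apply: ge_ereal_sup => q [x [y [h _]]].
  by exfalso; apply: (nx x); exists y.
have P0 : (0 <= posnorm s eta U rho)%E.
  apply: (@le_trans _ _ (cabs (U x1 y1) / sdist s x1 y1 `^ eta)%:E).
    by rewrite lee_fin divr_ge0 ?cabs_ge0 ?powR_ge0.
  by apply: ereal_sup_ubound; exists x1, y1.
have N0 : (0 <= negnorm s (eta - m%:R) (fun x => Ldist s a (pairf (U x))) rho)%E.
  have t0 : test_box 0 (fun _ : pt => 0 : R) by split=> [n|//]; exact: Ck_cst.
  have [psi [N [A [Bp _ _ _ _]]]] := Bset_rescale s0 kB (lexx 0) t0.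
  have r2 : 0 < rho / 2 < rho by apply/andP; split; lra.
  have /andP[r2a r2b] := r2.
  apply: le_trans (ereal_sup_ubound _); last by exists psi, (rho / 2), x1.
  by rewrite lee_fin mulr_ge0 ?cabs_ge0 ?powR_ge0.
have H0 : (0 <= holnorm s eta alpha U rho)%E.
  apply: le_trans (ereal_sup_ubound _); last by exists x1, y1.
  apply: le_ereal_inf_tmp => _ [c ->].
  (* The reflection of x1 in y1 is an admissible evaluation point, so the inner supremum is not over
     the empty set. *)
  have z1 : sdist s y1 (y1 + (y1 - x1)) = sdist s x1 y1.
    apply: eq_bigr => i _; rewrite !mxE; congr (`|_| `^ _); ring.
  apply: le_trans (ereal_sup_ubound _); last first.
    by exists (y1 + (y1 - x1)); split; [rewrite z1|].
  by rewrite lee_fin divr_ge0 ?cabs_ge0// mulr_ge0 ?powR_ge0.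
have S0 : (0 <= (rho `^ (- eta))%:E * supnorm s U rho)%E.
  apply: mule_ge0; first by rewrite lee_fin powR_ge0.
  have /andP[_ h] := xy1.
  apply: le_trans (ereal_sup_ubound _); last by exists x1, y1.
  by rewrite lee_fin cabs_ge0.
have Pf : posnorm s eta U rho \is a fin_num by rewrite ge0_fin_numE.
set P := fine (posnorm s eta U rho).
have PE : posnorm s eta U rho = P%:E by rewrite fineK.
clearbody P.
move: nle; rewrite PE => nle.
have [n [h [t [En Eh Et [n0 h0 t0] lt]]]] := ge0_ereal_split N0 H0 S0 C0 nle.
have sum0 : 0 <= n + h + t by lra.
have Cs : n + h + t <= C * (n + h + t) by rewrite ler_peMl.
have Pp : 0 < P by apply: le_lt_trans lt; rewrite mulr_ge0// ltW.
have Cn : C * n < P by apply: le_lt_trans lt; rewrite ler_pM2l//; lra.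
have Ct : C * t < P by apply: le_lt_trans lt; rewrite ler_pM2l//; lra.
have hP : h < P by apply: le_lt_trans lt; lra.
have Ub x y : 0 < sdist s x y < rho -> cabs (U x y) <= P * sdist s x y `^ eta.
  move=> hxy; have /andP[p _] := hxy.
  rewrite -ler_pdivrMr ?powR_gt0// -lee_fin -PE.
  by apply: ereal_sup_ubound; exists x, y.
have [x0 [y0 [hxy lt2]]] : exists x y, 0 < sdist s x y < rho /\
    P / 2 < cabs (U x y) / sdist s x y `^ eta.
  have : ((P / 2)%:E < posnorm s eta U rho)%E by rewrite PE lte_fin; lra.
  by move=> /ereal_sup_gt[_ [x [y [hxy ->]]]]; rewrite lte_fin => h'; exists x, y.
move: hxy lt2; set r := sdist s x0 y0 => hxy lt2; have rE : sdist s x0 y0 = r by [].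
clearbody r; have /andP[r0 rrho] := hxy.
have re0 : 0 < r `^ eta by exact: powR_gt0.
pose k := P^-1 * r `^ (- eta).
have k0 : 0 <= k by rewrite mulr_ge0 ?powR_ge0// invr_ge0 ltW.
have kP : k * P * r `^ eta = 1.
  by rewrite /k powRN; field; rewrite !gt_eqF.
clearbody k.
pose Rad := rho / r.
have Rad0 : 0 < Rad by rewrite divr_gt0.
have scaleR u : (r * u < rho) = (u < Rad) by rewrite /Rad ltr_pdivlMr// mulrC.
have RadE : Rad `^ eta = rho `^ eta / r `^ eta.
  by rewrite /Rad powRM ?invr_ge0 ?(ltW rho0) ?(ltW r0)// -powR_inv1 ?(ltW r0)// powRAC powR_inv1 ?powR_ge0.
clearbody Rad.
pose W y z := Complex k 0 * U (dil s r x0 y) (dil s r x0 z).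
have Wg y z : 0 < sdist s y z < Rad -> cabs (W y z) <= sdist s y z `^ eta.
  move=> /andP[yz0 yzR]; rewrite /W (cabsZ _ k0).
  apply: (@le_trans _ _ (k * (P * (r * sdist s y z) `^ eta))).
    apply: ler_wpM2l => //; rewrite -(sdist_dil x0 y z r0); apply: Ub.
    by rewrite (sdist_dil x0 y z r0) mulr_gt0//= scaleR.
  by rewrite powRM ?sdist_ge0 ?(ltW r0)// !mulrA kP mul1r.
pose V := W 0.
have cV : contC V.
  have := contC_lin k (contC0 (d := d)) (contC_dil s x0 r0 (cU x0)).
  by congr contC; apply/funext => z; rewrite add0r /V /W dil_0.
pose e : pt := \row_i (r ^- s i * (y0 ord0 i - x0 ord0 i)).
have ye : dil s r x0 e = y0.
  apply/rowP => i; rewrite !mxE mulrA divff ?mul1r; last first.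
    by rewrite expf_neq0// gt_eqF.
  by rewrite addrC subrK.
have e1 : sdist s 0 e = 1.
  have := sdist_dil x0 0 e r0; rewrite dil_0 ye rE => /esym/eqP.
  by rewrite -[X in _ == X]mulr1 mulrC [r * 1]mulrC => /eqP/(mulIf (lt0r_neq0 r0)).
have big : P / 2 * r `^ eta < cabs (U x0 y0) by rewrite -ltr_pdivlMr.
exists V, e, Rad; split=> //.
- split=> //; rewrite /V /W dil_0 ye (cabsZ _ k0).
  apply: (@le_trans _ _ (k * (P / 2 * r `^ eta))).
    have -> : k * (P / 2 * r `^ eta) = (k * P * r `^ eta) / 2 by field.
    by rewrite kP mul1r.
  by apply: ler_wpM2l => //; exact: ltW.
- split=> //.
  (* The value |U_(x0)(y0)| exceeds P r^eta / 2 but is at most rho^eta t, where C t < P; hence (rho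
     / r)^eta >= C / 2. *)
  have Ut : rho `^ (- eta) * cabs (U x0 y0) <= t.
    rewrite -lee_fin -Et EFinM; apply: lee_wpmul2l.
      by rewrite lee_fin powR_ge0.
    by apply: ereal_sup_ubound; exists x0, y0; rewrite rE.
  have rhoe : 0 < rho `^ eta by exact: powR_gt0.
  have h1 : C * (rho `^ (- eta) * (P / 2 * r `^ eta)) <= P.
    apply: le_trans (ltW Ct); rewrite ler_pM2l//; apply: le_trans Ut.
    by apply: ler_wpM2l; [exact: powR_ge0|exact: ltW].
  rewrite RadE.
  rewrite ler_pdivlMr//.
  have : C * (rho `^ (- eta) * (P / 2 * r `^ eta)) = P * (rho `^ eta)^-1 * (C / 2 * r `^ eta).
    by rewrite powRN; ring.
  move=> E; move: h1; rewrite E -mulrA -[X in _ <= X]mulr1 ler_pM2l// ler_pdivrMl//.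
  by rewrite mulr1.
- by apply: (growth_at_0 cV e1 Rad0) => z; exact: Wg.
split.
- move=> y /andP[y00 yR].
  have xy : sdist s x0 (dil s r x0 y) = r * sdist s 0 y.
    by rewrite -(sdist_dil x0 0 y r0) dil_0.
  have xyr : 0 < sdist s x0 (dil s r x0 y) < rho by rewrite xy mulr_gt0//= scaleR.
  have hlt : (holnorm s eta alpha U rho < P%:E)%E by rewrite Eh lte_fin.
  have [c Hc] := holnorm_poly hlt xyr.
  exists (W y), (fun z => Complex k 0 * polyval s c (dil s r x0 z)); split.
    by apply: line_poly_dil; exact: line_poly_polyval.
  move=> z yz; split; first exact: Wg.
  have /andP[yz0 yzR] := yz.
  have yzr : sdist s (dil s r x0 y) (dil s r x0 z) = r * sdist s y z by exact: sdist_dil.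
  have := Hc (dil s r x0 z); rewrite yzr xy mulr_gt0// scaleR => /(_ yzR).
  rewrite -mulrDr !powRM ?sdist_ge0 ?addr_ge0 ?sdist_ge0 ?(ltW r0)//.
  rewrite mulrACA -powRD; last by apply/implyP => _; rewrite gt_eqF.
  rewrite (_ : alpha + (eta - alpha) = eta); last by rewrite addrC subrK.
  have den0 : 0 < r `^ eta * (sdist s y z `^ alpha * (sdist s 0 y + sdist s y z) `^ (eta - alpha)).
    rewrite !mulr_gt0 ?powR_gt0//; exact: addr_gt0.
  rewrite ler_pdivrMr// => h3.
  have -> : V z - W y z - Complex k 0 * polyval s c (dil s r x0 z) = Complex k 0 *
     (U x0 (dil s r x0 z) - U (dil s r x0 y) (dil s r x0 z) - polyval s c (dil s r x0 z)).
    by rewrite /V /W dil_0 !mulrBr.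
  rewrite (cabsZ _ k0); apply: le_trans (ler_wpM2l k0 h3) _.
  by rewrite !mulrA kP mul1r.
- move=> phi M psi N A M0 tphi [M' M'0 tpsi] Bpsi N1 A0 resE NR.
  have Nr0 : 0 < r * N by rewrite mulr_gt0//; lra.
  have Nrr : r * N < rho by rewrite scaleR.
  have VE : V = (fun z => 0 + Complex k 0 * U x0 (dil s r x0 z)).
    by apply/funext => z; rewrite add0r /V /W dil_0.
  have cd := contC_dil s x0 r0 (cU x0).
  rewrite VE (Ldist_lin s a k M0 (contC0 (d := d)) cd tphi).
  rewrite (solution0 s a M0 tphi) add0r (Ldist_dil s a x0 M0 r0 (cU x0) tphi).
  have [M2 M20 t2] := test_box_resc s x0 M'0 Nr0 tpsi.
  rewrite (resE _ _ r0) (Ldist_scale_test A M20 (cU x0) t2).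
  have rm0 : 0 <= r ^+ m by rewrite exprn_ge0// ltW.
  rewrite (cabsZ _ k0) (cabsZ _ rm0) (cabsZ _ A0); set L := cabs _.
  have Ln : (r * N) `^ (m%:R - eta) * L <= n.
    rewrite -lee_fin -En; apply: ereal_sup_ubound; exists psi, (r * N), x0; split=> //.
    by rewrite opprB.
  (* The factor r^m from the dilation splits into r^eta, cancelled by the normalisation [k], and
     r^(m - eta), the weight in the negative norm; the extra N^(m - eta) is at least 1 as eta <
     m. *)
  have rme : r ^+ m = r `^ eta * r `^ (m%:R - eta).
    rewrite -powRD; last by apply/implyP => _; rewrite gt_eqF.
    rewrite (_ : eta + (m%:R - eta) = m%:R); last by rewrite addrC subrK.
    by rewrite powR_mulrn// ltW.
  have Nm : 1 <= N `^ (m%:R - eta).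
    rewrite (@le_trans _ _ (1 `^ (m%:R - eta)))//; [by rewrite powR1|apply: powR_le => //; lra].
  have L0 : 0 <= L by exact: cabs_ge0.
  have rL : r `^ (m%:R - eta) * L <= n.
    apply: le_trans Ln; apply: ler_wpM2r => //.
    rewrite powRM ?(ltW r0)//; last by lra.
    by rewrite ler_peMr ?powR_ge0.
  rewrite rme.
  have -> : k * (r `^ eta * r `^ (m%:R - eta) * (A * L)) =
            (k * P * r `^ eta) * (A * (P^-1 * (r `^ (m%:R - eta) * L))).
    by field; rewrite gt_eqF.
  rewrite kP mul1r; apply: ler_wpM2l => //.
  apply: (@le_trans _ _ (P^-1 * n)); first by rewrite ler_wpM2l// invr_ge0 ltW.
  by rewrite ler_pdivrMl// ler_pdivlMr// mulrC ltW.
Qed.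

End BlowUp.

(** * The contradiction, with constants tending to infinity *)

Lemma nat_near_ge (R : realType) (x : R) : \forall j \near \oo, x <= j.+1%:R.
Proof.
exists (Num.truncn x) => // j /= xj; apply: le_trans (ltW (truncnS_gt x)) _.
by rewrite ler_nat ltnS.
Qed.

Unset Implicit Arguments.
Set Strict Implicit.

Theorem theorem3p7 (R : realType) (d : nat) (s : 'I_d -> nat) (m : nat)
  (a : {ffun 'I_d -> 'I_m.+1} -> R[i]) (alpha eta : R) :
  (forall i, (0 < s i)%N) ->
  elliptic s a ->
  0 < alpha -> alpha < eta -> eta < m%:R ->
  (forall n : nat, alpha != n%:R) -> (forall n : nat, eta != n%:R) ->
  exists C : R, 0 < C /\
  forall (rho : R) (U : 'rV[R]_d -> 'rV[R]_d -> R[i]),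
    0 < rho -> germ U ->
    (posnorm s eta U rho < +oo)%E ->
    (posnorm s eta U rho <=
       C%:E * (negnorm s (eta - m%:R) (fun x => Ldist s a (pairf (U x))) rho
               + holnorm s eta alpha U rho
               + (rho `^ (- eta))%:E * supnorm s U rho))%E.
Proof.
move=> s0 ell al0 ae em _ en; have eta0 : 0 < eta by exact: lt_trans ae.
apply: contrapT => /forallNP nC.
have /choice[VeR HV] : forall j : nat, exists VeR : ('rV[R]_d -> R[i]) * 'rV[R]_d * R,
    blowup s a alpha eta j.+1%:R VeR.1.1 VeR.1.2 VeR.2.
  move=> j; have j0 : (0 : R) < j.+1%:R by rewrite ltr0n.
  have /not_andP[//|] := nC j.+1%:R.
  move=> /existsNP[rho /existsNP[U /not_implyP[r0 /not_implyP[gU /not_implyP[Pf nle]]]]].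
  have j1 : (1 : R) <= j.+1%:R by rewrite ler1n.
  have [V [e [Rad H]]] := blowup_exists s0 eta0 em j1 r0 gU Pf nle.
  by exists (V, e, Rad).
(* Rad^eta >= (j + 1) / 2 forces the radii to infinity; the maximum with 0 is there because [N] may
   be negative. *)
have hR N : \forall j \near \oo, N <= (VeR j).2.
  apply: filterS (nat_near_ge (2 * (Num.max N 0) `^ eta + 1)) => j hj.
  have [_ _ [Rad0 HRad] _ _] := HV j.
  rewrite leNgt; apply/negP => RN.
  have : (VeR j).2 `^ eta <= (Num.max N 0) `^ eta.
    by apply: powR_le; rewrite ?ltW// lt_max RN.
  by move: HRad hj; set x := _ `^ eta; set y := _ `^ eta; lra.
have [j Hj] : exists j, forall z, box 1 z -> cabs ((VeR j).1.1 z) <= 4^-1.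
  apply: (@blowup_limit R d s m a eta s0 eta0 (fun j => (VeR j).1.1) (fun j => (VeR j).2) 1 ell en _ hR).
  - by move=> j; have [] := HV j.
  - by move=> j; have [] := HV j.
  - move=> M phi M0 tp e e0.
    have [psi [N [A [Bp tpsi N1 A0 resE]]]] := Bset_rescale s0 (absz (Num.ceil `|eta - m%:R|)) M0 tp.
    apply: filterS2 (hR (N + 1)) (nat_near_ge (A / e)) => j NR Aj.
    have [_ _ _ _ [_ HL]] := HV j.
    have NR' : N < (VeR j).2 by apply: lt_le_trans NR; rewrite ltrDl.
    apply: le_trans (HL phi M psi N A M0 tp tpsi Bp N1 A0 resE NR') _.
    by rewrite ler_pdivrMr ?ltr0n// mulrC -ler_pdivrMr.
  - move=> x e e0.
    have n0 : (0 < (Num.truncn eta * d).+1)%N by [].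
    have [r [N [r0 H]]] := equicontinuity s0 eta0 x n0 al0 ae e0.
    exists r => //; apply: filterS (hR N) => j NR.
    have [cV _ _ gV [qV _]] := HV j.
    exact: H NR cV gV qV.
(* The normalised point has distance 1 from 0, hence lies in the cube on which the modulus is at
   most 1/4. *)
have [_ [e1 he] _ _ _] := HV j.
have be : box 1 (VeR j).1.2 by apply: (sdist_le1_box s0); rewrite e1.
by have := le_trans he (Hj _ be); lra.
Qed.
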